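(* Given $u_0\in H^3(\mathbb{R})$, let $u$, with $u(t,\cdot)\in H^3(\mathbb{R})$, be the corresponding unique solution of $$u_t-u_{txx}+uu_x-uu_{xxx}=0,\qquad u(0,x)=u_0(x).$$ If $m_0=u_0-u_0''\in L^1(\mathbb{R})\cap H^1(\mathbb{R})$ does not change sign, then the solution $u$ exists globally in $C^0([0,\infty);H^3(\mathbb{R}))\cap C^1([0,\infty);H^2(\mathbb{R}))$.
   Context: $H^s(\mathbb{R})$ is the usual Sobolev space. The problem is locally well-posed in $H^s(\mathbb{R})$, $s>3/2$: for $u_0\in H^s(\mathbb{R})$ there are $T>0$ and a unique solution $u\in C^0([0,T);H^s(\mathbb{R}))\cap C^1([0,T);H^{s-1}(\mathbb{R}))$. ''$m_0$ does not change sign'' means $m_0\ge0$ everywhere or $m_0\le0$ everywhere. *)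

(* Defs.v *)
From HB Require Import structures.
From mathcomp Require Import all_boot all_order all_algebra.
From mathcomp Require Import all_classical all_reals all_analysis.

Set Implicit Arguments.
Unset Strict Implicit.
Unset Printing Implicit Defensive.

Import Order.TTheory GRing.Theory Num.Theory.
Import numFieldNormedType.Exports.

Local Open Scope classical_set_scope.
Local Open Scope ring_scope.

(* Elements of L^p and of Sobolev spaces are represented by Borel functions
   R -> R, and equality in these spaces is equality almost everywhere with
   respect to [lebesgue_measure]. *)

Definition test_function (R : realType) (phi : R -> R) : Prop :=
  (forall n x, derivable (derive1n n phi) x 1) /\
  (exists M : R, forall x, M < `|x| -> phi x = 0).

(* [g] is a [k]-th weak (distributional) derivative of [f] on the line. *)
Definition is_weak_derivative (R : realType) (k : nat) (f g : R -> R) : Prop :=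
  [/\ locally_integrable setT f,
      locally_integrable setT g &
      forall phi : R -> R, test_function phi ->
        (\int[lebesgue_measure]_x (f x * derive1n k phi x) =
         (-1) ^+ k * \int[lebesgue_measure]_x (g x * phi x))%R].

(* A chosen representative of the [k]-th weak derivative, which is unique up to
   almost everywhere equality; the zero function if there is none. *)
Definition weak_derivative (R : realType) (k : nat) (f : R -> R) : R -> R :=
  xget (fun=> 0) [set g | is_weak_derivative k f g].

(* Membership in H^k(R) = W^{k,2}(R), for a natural number [k]. *)
Definition in_sobolev (R : realType) (k : nat) (f : R -> R) : Prop :=
  f \in Lfun (@lebesgue_measure R) 2%:E /\
  forall j, (1 <= j <= k)%N ->
    exists2 g, is_weak_derivative j f g & g \in Lfun (@lebesgue_measure R) 2%:E.

(* Meaningful only on H^k(R), because of the default value in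
   [weak_derivative]. *)
Definition sobolev_norm (R : realType) (k : nat) (f : R -> R) : \bar R :=
  ((\sum_(j < k.+1)
      'N[lebesgue_measure]_2%:E[EFin \o weak_derivative j f] ^+ 2)
   `^ 2^-1)%E.

(* u \in C^0(I; H^k(R)), where [u t] is the function u(t, .). *)
Definition C0_sobolev (R : realType) (I : set R) (k : nat) (u : R -> R -> R)
    : Prop :=
  (forall t, I t -> in_sobolev k (u t)) /\
  (forall t, I t ->
     sobolev_norm k (u s \- u t) @[s --> within I (nbhs t)] --> 0%E).

(* [ut t] is the derivative at [t] of u : I -> H^k(R), in the norm of H^k(R);
   the derivative is one-sided at an endpoint of [I] belonging to [I]. *)
Definition is_sobolev_derivative (R : realType) (I : set R) (k : nat)
    (u ut : R -> R -> R) : Prop :=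
  forall t, I t ->
    sobolev_norm k (fun x => (u s x - u t x) / (s - t) - ut t x)
      @[s --> within I t^'] --> 0%E.

(* [u] is a solution on the time interval [I], which contains 0, of
     u_t - u_txx + u u_x - u u_xxx = 0,   u(0, x) = u0(x),
   in C^0(I; H^3(R)) and C^1(I; H^2(R)).  At each time, u_t belongs to H^2(R)
   and all terms of the equation belong to L^2(R): the equation is required
   for almost every x. *)
Definition is_solution (R : realType) (I : set R) (u0 : R -> R)
    (u : R -> R -> R) : Prop :=
  C0_sobolev I 3 u /\
  exists ut : R -> R -> R,
    [/\ C0_sobolev I 2 ut,
        is_sobolev_derivative I 2 u ut,
        (forall t, I t ->
           {ae lebesgue_measure, forall x : R,
              ut t x - weak_derivative 2 (ut t) x
              + u t x * weak_derivative 1 (u t) x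
              - u t x * weak_derivative 3 (u t) x = 0}) &
        {ae lebesgue_measure, forall x : R, u 0 x = u0 x}].

(* Main.v *)
(** The momentum [m = u - u_xx] is transported by the velocity: [m_t + u m_x = 0].
    Let [phi] be the flow of [u] and [p = log phi_x].  Then [m (phi x) = m0 x], and
    [u (phi x)] and [u_x (phi x)] are half the sum and half the difference of the
    integrals of [m0 exp p] against the kernel [exp (- |phi x - phi y|)] over
    [y <= x] and [y >= x], so that [p] solves the ODE [p_t = u_x (phi)] in the space of
    bounded continuous functions.  As these kernels integrate to at most 1 against
    [phi_x], the vector field is bounded by [sup |m0|], and it is Lipschitz on bounded
    sets: the ODE has a global solution.  Back in Eulerian coordinates, [m = m0 o phi^-1]
    is continuous in time with values in H^1 and differentiable with values in L^2, with
    derivative [- u m_x], and [u = (1 - d_x^2)^-1 m] is the solution.  Uniqueness is an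
    energy estimate in L^2 for the difference of two momenta. *)

From HB Require Import structures.
Require Import Defs.
From mathcomp Require Import all_boot all_order all_algebra.
From mathcomp Require Import all_classical all_reals all_analysis.
From mathcomp Require Import measurable_realfun ring lra.

Import Order.TTheory GRing.Theory Num.Theory.
Import numFieldNormedType.Exports.

Local Open Scope classical_set_scope.
Local Open Scope ring_scope.

Set Implicit Arguments.
Unset Strict Implicit.
Unset Printing Implicit Defensive.

(** * Integrals and primitives on the line *)

Section integrals.
Context {R : realType}.
Notation mu := (@lebesgue_measure R).
Implicit Types (f g h : R -> R) (D E : set R) (a b c : R).

(** For m in H^1 the field - u m_x is only in L^2: it loses a derivative, and a fixed point in
    Eulerian coordinates is out of reach. Along the flow [m0] enters undifferentiated, and the loss
    disappears. Taking the logarithm of the Jacobian as unknown keeps the Jacobian positive without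
    any constraint, and a bound on p bounds it from both sides, so that the flow is a bijection at
    all times. The kernel sees only differences phi x - phi y, which p determines. The price is paid
    on the way back. As m_x is merely in L^2, strong continuity in time comes from the density of
    test functions, and differentiability from duality: after a change of variables the time
    dependence sits on the test function, where it is regular. For uniqueness, with W = V - U and n
    = W - W_xx, one has n_t = - V n_x - W (U_x - U_xxx). The last factor is only in L^2, so W is
    measured in sup norm, which the L^2 norm of n controls. Throughout, Sobolev functions are
    handled through chains of explicit absolutely continuous representatives, so that the calculus
    is pointwise and the chosen [weak_derivative] appears only at both ends. *)

Definition integrable_on D f := mu.-integrable D (EFin \o f).

Lemma ae_imp (P Q : R -> Prop) : (forall x, P x -> Q x) ->
  {ae mu, forall x, P x} -> {ae mu, forall x, Q x}.
Proof. by move=> PQ; apply: filterS; first exact: (ae_filter_ringOfSetsType mu). Qed.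

Lemma ae_imp2 (P Q S : R -> Prop) : (forall x, P x -> Q x -> S x) ->
  {ae mu, forall x, P x} -> {ae mu, forall x, Q x} -> {ae mu, forall x, S x}.
Proof. by move=> PQ; apply: filterS2; first exact: (ae_filter_ringOfSetsType mu). Qed.

Lemma ae_all (P : R -> Prop) : (forall x, P x) -> {ae mu, forall x, P x}.
Proof. by move=> h; apply: filterE; first exact: (ae_filter_ringOfSetsType mu). Qed.

Lemma integrable_onP D f : measurable D ->
  integrable_on D f <-> measurable_fun D f /\ (\int[mu]_(x in D) `|(f x)%:E| < +oo)%E.
Proof.
move=> mD; split; first by move=> /integrableP[/measurable_EFinP].
by move=> [mf fi]; apply/integrableP; split => //; exact/measurable_EFinP.
Qed.

Lemma integrable_onM D f : integrable_on D f -> measurable_fun D f.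
Proof. by move=> /measurable_int /measurable_EFinP. Qed.

Lemma integrable_on_le D g f : measurable D -> measurable_fun D f ->
  integrable_on D g -> (forall x, D x -> `|f x| <= g x) -> integrable_on D f.
Proof.
move=> mD mf ig fg; apply: (@le_integrable _ _ _ mu D _ (EFin \o f) (EFin \o g)) => //.
  exact/measurable_EFinP.
by move=> x Dx /=; rewrite lee_fin (le_trans (fg _ Dx))// ler_norm.
Qed.

Lemma integrable_onD D f g : measurable D -> integrable_on D f ->
  integrable_on D g -> integrable_on D (fun x => f x + g x).
Proof.
move=> mD i1 i2; rewrite /integrable_on.
have -> : EFin \o (fun x => f x + g x) = ((EFin \o f) \+ (EFin \o g))%E by apply/funext => x /=; rewrite EFinD.
exact: integrableD.
Qed.

Lemma integrable_onN D f : measurable D -> integrable_on D f ->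
  integrable_on D (fun x => - f x).
Proof.
move=> mD i1; rewrite /integrable_on.
have -> : EFin \o (fun x => - f x) = (-%E \o (EFin \o f))%E by [].
exact: integrableN.
Qed.

Lemma integrable_onB D f g : measurable D -> integrable_on D f ->
  integrable_on D g -> integrable_on D (fun x => f x - g x).
Proof.
by move=> mD i1 i2; apply: (@integrable_onD D f (fun x => - g x)) => //; exact: integrable_onN.
Qed.

Lemma integrable_onZ D k f : measurable D -> integrable_on D f ->
  integrable_on D (fun x => k * f x).
Proof.
move=> mD i1; rewrite /integrable_on.
have -> : EFin \o (fun x => k * f x) = (fun x => k%:E * (EFin \o f) x)%E by [].
exact: integrableZl.
Qed.

Lemma integrable_on_norm D f : measurable D -> integrable_on D f ->
  integrable_on D (fun x => `|f x|).
Proof. by move=> mD /integrable_norm. Qed.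

Lemma integrable_on_bounded D (M : R) f g : measurable D -> measurable_fun D g ->
  (forall x, D x -> `|g x| <= M) -> integrable_on D f ->
  integrable_on D (fun x => g x * f x).
Proof.
move=> mD mg gM i1.
apply: (@integrable_on_le D (fun x => M * `|f x|)) => //.
- by apply: measurable_funM => //; exact: integrable_onM.
- exact/integrable_onZ/integrable_on_norm.
- by move=> x Dx; rewrite normrM ler_wpM2r// gM.
Qed.

Lemma integrable_onS D E f : measurable D -> measurable E -> E `<=` D ->
  integrable_on D f -> integrable_on E f.
Proof. by move=> mD mE ED; apply: (@integrableS _ _ _ mu D E). Qed.

Lemma integrable_on_continuous (a b : R) f : {within `[a, b], continuous f} ->
  integrable_on `[a, b] f.
Proof. by move=> cf; apply: continuous_compact_integrable => //; exact: segment_compact. Qed.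

Lemma integrable_on_restrict D f : measurable D ->
  integrable_on D f <-> integrable_on setT (fun x => \1_D x * f x).
Proof.
move=> mD; rewrite /integrable_on.
have -> : EFin \o (fun x => \1_D x * f x) = (EFin \o f) \_ D.
  apply/funext => x /=; rewrite patchE indicE.
  by case: (x \in D) => /=; rewrite ?mul1r ?mul0r.
by apply: integrable_mkcond.
Qed.

Lemma Rintegral_indic D f :
  \int[mu]_(x in D) f x = \int[mu]_x (\1_D x * f x).
Proof.
rewrite Rintegral_mkcond; apply: eq_Rintegral => x _ /=.
by rewrite patchE indicE; case: (x \in D) => /=; rewrite ?mul1r ?mul0r.
Qed.

Lemma integrable_on_indic D f : measurable D -> integrable_on setT f ->
  integrable_on setT (fun x => \1_D x * f x).
Proof. by move=> mD iF; apply: (proj1 (integrable_on_restrict _ mD)); apply: integrable_onS iF. Qed.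

Lemma indic_le1 D (x : R) : 0 <= (\1_D x : R) <= 1.
Proof. by rewrite indicE; case: (_ \in _); rewrite /= ?lexx ?ler01. Qed.

Lemma RintegralD_on D f g : measurable D -> integrable_on D f ->
  integrable_on D g ->
  \int[mu]_(x in D) (f x + g x) = \int[mu]_(x in D) f x + \int[mu]_(x in D) g x.
Proof. by move=> mD i1 i2; apply: RintegralD. Qed.

Lemma RintegralB_on D f g : measurable D -> integrable_on D f ->
  integrable_on D g ->
  \int[mu]_(x in D) (f x - g x) = \int[mu]_(x in D) f x - \int[mu]_(x in D) g x.
Proof. by move=> mD i1 i2; apply: RintegralB. Qed.

Lemma RintegralZ_on D k f : measurable D -> integrable_on D f ->
  \int[mu]_(x in D) (k * f x) = k * \int[mu]_(x in D) f x.
Proof. by move=> mD i1; apply: RintegralZl. Qed.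

Lemma RintegralN_on D f : measurable D -> integrable_on D f ->
  \int[mu]_(x in D) (- f x) = - \int[mu]_(x in D) f x.
Proof.
move=> mD i1; rewrite -[RHS]mulN1r -RintegralZ_on//.
by apply: eq_Rintegral => x _; rewrite mulN1r.
Qed.

Lemma le_Rintegral_on D f g : measurable D -> integrable_on D f ->
  integrable_on D g -> (forall x, D x -> f x <= g x) ->
  \int[mu]_(x in D) f x <= \int[mu]_(x in D) g x.
Proof. by move=> mD i1 i2 fg; apply: le_Rintegral. Qed.

Lemma le_Rintegral_sub D f : measurable D -> integrable_on setT f ->
  (forall x, 0 <= f x) -> \int[mu]_(x in D) f x <= \int[mu]_x f x.
Proof.
move=> mD iF f0; rewrite Rintegral_indic; apply: le_Rintegral_on => //.
  exact: integrable_on_indic.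
by move=> x _; rewrite ler_piMl//; case/andP: (indic_le1 D x).
Qed.

Lemma le_Rintegral_dom D f g : measurable D -> measurable_fun D f ->
  integrable_on D g -> (forall x, D x -> `|f x| <= g x) ->
  `|\int[mu]_(x in D) f x| <= \int[mu]_(x in D) g x.
Proof.
move=> mD mf ig fg.
have iF : integrable_on D f by apply: integrable_on_le ig fg.
apply: (@le_trans _ _ (\int[mu]_(x in D) `|f x|)); first exact: le_normr_Rintegral.
by apply: le_Rintegral_on => //; exact: integrable_on_norm.
Qed.

Lemma dominated_Rintegral D (u : nat -> R -> R) f g : measurable D ->
  (forall n, measurable_fun D (u n)) ->
  (forall x, D x -> u n x @[n --> \oo] --> f x) ->
  integrable_on D g -> (forall n x, D x -> `|u n x| <= g x) ->
  integrable_on D f /\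
  \int[mu]_(x in D) u n x @[n --> \oo] --> \int[mu]_(x in D) f x.
Proof.
move=> mD mun uf ig ug.
have mf : measurable_fun D f by apply: (measurable_fun_cvg mun).
have [i1 _ i2] : [/\ integrable_on D f,
  [sequence \int[mu]_(x in D) `|(u n x)%:E - (f x)%:E| ]_n%E @ \oo --> 0%E &
  [sequence \int[mu]_(x in D) (u n x)%:E ]_n%E @ \oo --> (\int[mu]_(x in D) (f x)%:E)%E].
  apply: (@dominated_convergence _ _ _ mu D _ (fun n => EFin \o u n) (EFin \o f) (EFin \o g)) => //.
  - by move=> n; apply/measurable_EFinP; exact: mun.
  - exact/measurable_EFinP.
  - apply/aeW => x Dx; apply: cvg_EFin (uf _ Dx).
    by apply: nearW.
  - by apply/aeW => x Dx n; rewrite lee_fin ug.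
split => //; apply: fine_cvg; rewrite fineK//.
exact: integrable_fin_num.
Qed.

Lemma ae_Rintegral D f g : measurable D -> measurable_fun D f -> measurable_fun D g ->
  {ae mu, forall x, D x -> f x = g x} ->
  \int[mu]_(x in D) f x = \int[mu]_(x in D) g x.
Proof.
move=> mD mf mg fg; congr fine; apply: ae_eq_integral => //; [exact/measurable_EFinP..|].
by apply: ae_imp fg => x fgx Dx; rewrite fgx.
Qed.

Lemma ae_integrable_on D f g : measurable D -> measurable_fun D g ->
  {ae mu, forall x, D x -> f x = g x} -> integrable_on D f -> integrable_on D g.
Proof.
move=> mD mg fg /(integrable_onP _ mD)[mf i1]; apply/(integrable_onP _ mD).
split => //; move: i1; apply: le_lt_trans.
rewrite le_eqVlt; apply/orP; left; apply/eqP; apply: ae_eq_integral => //.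
- by apply: measurableT_comp => //; exact/measurable_EFinP.
- by apply: measurableT_comp => //; exact/measurable_EFinP.
- by apply: ae_imp fg => x fgx Dx; rewrite /= fgx.
Qed.

Lemma Rintegral_eq0_ae f : integrable_on setT f -> (forall x, 0 <= f x) ->
  \int[mu]_x f x = 0 -> {ae mu, forall x, f x = 0}.
Proof.
move=> i1 f0 f00.
have mf : measurable_fun setT (EFin \o f) by apply/measurable_EFinP; exact: integrable_onM i1.
have : ae_eq mu setT (EFin \o f) (cst 0%E).
  apply/(ae_eq_integral_abs mu measurableT mf).
  rewrite -[RHS]/(0%:E) -f00 fineK//; last exact: (integrable_fin_num measurableT i1).
  by apply: eq_integral => x _ /=; rewrite ger0_norm.
by apply: ae_imp => x /(_ I) /= [].
Qed.
End integrals.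

(** * Local integrability and absolutely continuous primitives *)

Section absolutely_continuous.
Context {R : realType}.
Notation mu := (@lebesgue_measure R).
Implicit Types (f g h F G H : R -> R) (a b c : R).

Definition loc_integrable g := forall a b, integrable_on `[a, b] g.

(** The truncations of [g] to the intervals [-n, n] are measurable and converge pointwise to [g]. *)
Lemma loc_integrableM g : loc_integrable g -> measurable_fun setT g.
Proof.
move=> ig; have gE : forall x : R, setT x -> (\1_(`[- n%:R, n%:R]) x * g x : R) @[n --> \oo] --> g x.
  move=> x _; have [N Nx] : exists N : nat, `|x| <= N%:R.
    by exists (Num.truncn `|x|).+1; rewrite ltW// truncnS_gt.
  apply: cvg_near_cst; exists N => // n /= Nn.
  rewrite indicE mem_set ?mul1r//= in_itv/= -ler_norml (le_trans Nx)// ler_nat//.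
apply: (measurable_fun_cvg _ gE) => n.
have := ig (- n%:R) n%:R => /integrable_on_restrict.
by move=> /(_ (measurable_itv _)) /integrable_onM.
Qed.

Lemma loc_integrableP g : loc_integrable g <-> locally_integrable setT g.
Proof.
split=> ig; last first.
  move=> a b; apply/integrable_onP => //; case: ig => mg _ h; split; last first.
    by apply: h => //; exact: segment_compact.
  exact: measurable_funS mg.
split; [exact: loc_integrableM|exact: openT|move=> K _ /[dup] cK /compact_bounded].
move=> [M0 [_ hM]]; set M := M0 + 1; have KM : forall x, K x -> `|x| <= M by apply: hM; rewrite ltrDl.
have [_ +] := (integrable_onP _ (measurable_itv _)).1 (ig (- M) M).
apply: le_lt_trans; apply: ge0_subset_integral => //.
- exact: compact_measurable.
- apply/measurable_EFinP/measurableT_comp => //.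
  by apply: measurable_funTS; exact: loc_integrableM.
- by move=> x Kx /=; rewrite in_itv/= -ler_norml; exact: KM.
Qed.

Lemma integrable_loc g : integrable_on setT g -> loc_integrable g.
Proof. by move=> ig a b; apply: integrable_onS ig. Qed.

Lemma continuous_loc g : continuous g -> loc_integrable g.
Proof.
move=> cg a b; apply: integrable_on_continuous; exact: continuous_subspaceT.
Qed.

Lemma loc_integrableD f g : loc_integrable f -> loc_integrable g ->
  loc_integrable (fun x => f x + g x).
Proof. by move=> lf lg a b; apply: integrable_onD. Qed.

Lemma loc_integrableB f g : loc_integrable f -> loc_integrable g ->
  loc_integrable (fun x => f x - g x).
Proof. by move=> lf lg a b; apply: integrable_onB. Qed.

Lemma loc_integrableZ k f : loc_integrable f -> loc_integrable (fun x => k * f x).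
Proof. by move=> lf a b; apply: integrable_onZ. Qed.

Lemma continuous_bounded_itv f a b : continuous f ->
  exists M : R, forall x : R, a <= x <= b -> `|f x| <= M.
Proof.
move=> cf; have [ab|ab] := leP a b; last first.
  exists 0 => x /andP[ax xb]; move: (lt_le_trans ab (le_trans ax xb)).
  by rewrite ltxx.
have : compact (f @` `[a, b]).
  apply: continuous_compact; last exact: segment_compact.
  exact: continuous_subspaceT.
move=> /compact_bounded [M [_ hM]]; exists (M + 1) => x xab.
by apply: (hM (M + 1)); [rewrite ltrDl|exists x => //=; rewrite in_itv].
Qed.

Lemma loc_integrableMc f g : continuous f -> loc_integrable g ->
  loc_integrable (fun x => f x * g x).
Proof.
move=> cf lg a b; have [M hM] := continuous_bounded_itv a b cf.
apply: (@integrable_on_bounded _ _ M) => //.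
- apply: measurable_funTS; exact: continuous_measurable_fun.
Qed.

Lemma ae_loc_integrable f g : measurable_fun setT g -> {ae mu, forall x, f x = g x} ->
  loc_integrable f -> loc_integrable g.
Proof.
move=> mg fg lf a b; apply: (@ae_integrable_on _ _ f) => //.
  exact: measurable_funTS.
by apply: ae_imp fg.
Qed.

Lemma Rintegral_itvD g a b c : a <= b -> b <= c -> loc_integrable g ->
  \int[mu]_(x in `[a, c]) g x = \int[mu]_(x in `[a, b]) g x + \int[mu]_(x in `[b, c]) g x.
Proof.
move=> ab bc lg.
have := @Rintegral_itvB _ g (BLeft a) (BRight c) b (lg a c).
rewrite !bnd_simp => /(_ ab bc).
rewrite Rintegral_itv_obnd_cbnd => [<-|]; first by rewrite addrC subrK.
apply: (integrable_onS _ _ _ (lg b c)) => //.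
by apply: subset_itvr; rewrite bnd_simp.
Qed.

Lemma Rintegral_itv1 g a : \int[mu]_(x in `[a, a]) g x = 0.
Proof. by rewrite set_itv1 Rintegral_set1. Qed.

(* [F] is locally absolutely continuous with almost everywhere derivative [g]. *)
Definition primitive_of F g := loc_integrable g /\
  forall a b, a <= b -> F b - F a = \int[mu]_(x in `[a, b]) g x.

(* Intervals with their endpoints in the wrong order are empty, hence the two terms. *)
Definition sprim g x :=
  \int[mu]_(y in `[0, x]) g y - \int[mu]_(y in `[x, 0]) g y.

Lemma Rintegral_itv_gt g a b : b < a -> \int[mu]_(x in `[a, b]) g x = 0.
Proof. by move=> ba; rewrite set_itv_ge ?Rintegral_set0// bnd_simp -ltNge. Qed.

Lemma sprim_primitive g : loc_integrable g -> primitive_of (sprim g) g.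
Proof.
move=> lg; split => // a b ab; rewrite /sprim.
have [a0|a0] := leP 0 a; have [b0|b0] := leP 0 b.
- rewrite (Rintegral_itvD a0 ab lg).
  have -> : \int[mu]_(y in `[b, 0]) g y = 0.
    by move: b0; rewrite le_eqVlt => /predU1P[<-|?]; rewrite ?Rintegral_itv1// Rintegral_itv_gt.
  have -> : \int[mu]_(y in `[a, 0]) g y = 0.
    by move: a0; rewrite le_eqVlt => /predU1P[<-|?]; rewrite ?Rintegral_itv1// Rintegral_itv_gt.
  lra.
- lra.
- rewrite (Rintegral_itv_gt _ a0) (Rintegral_itvD (ltW a0) b0 lg).
  have -> : \int[mu]_(y in `[b, 0]) g y = 0.
    by move: b0; rewrite le_eqVlt => /predU1P[<-|?]; rewrite ?Rintegral_itv1// Rintegral_itv_gt.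
  lra.
- rewrite (Rintegral_itv_gt _ a0) (Rintegral_itv_gt _ b0) (Rintegral_itvD ab (ltW b0) lg).
  lra.
Qed.

(** On ]x - 1, x + 1[ the function [F] is a constant plus an integral with moving upper end, which
    is continuous. *)
Lemma primitive_of_continuous F g : primitive_of F g -> continuous F.
Proof.
move=> [lg Fg] x.
have ab : x - 1 < x + 1 by lra.
have /(continuous_within_itvP _ ab)[+ _ _] :=
  parameterized_integral_continuous (ltW ab) (lg (x - 1) (x + 1)).
have xi : x \in `](x - 1), (x + 1)[ by rewrite in_itv/=; apply/andP; split; lra.
move=> /(_ x xi).
rewrite /continuous_at => h.
have h2 : (fun y => F (x - 1) + \int[mu]_(t in `[x - 1, y]) g t) y @[y --> x] --> F x.
  rewrite (_ : F x = F (x - 1) + \int[mu]_(t in `[x - 1, x]) g t).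
    by apply: cvgD => //; exact: cvg_cst.
  by rewrite -(Fg (x - 1) x); lra.
apply: cvg_trans h2; apply: near_eq_cvg.
have : \forall y \near x, y \in `](x - 1), (x + 1)[ by exact: near_in_itvoo.
apply: filterS => y; rewrite in_itv/= => /andP[y1 y2].
by rewrite -(Fg (x - 1) y); lra.
Qed.

Lemma primitive_of_derivable F f : continuous f -> (forall x : R, is_derive x (1 : R) F (f x)) ->
  primitive_of F f.
Proof.
move=> cf dF; split; first exact: continuous_loc.
move=> a b; rewrite le_eqVlt => /predU1P[<-|ab]; first by rewrite Rintegral_itv1 subrr.
rewrite /Rintegral (@continuous_FTC2 _ f F)//.
- exact: continuous_subspaceT.
- have cF : continuous F by move=> x; apply/differentiable_continuous/derivable1_diffP; case: (dF x).
  split=> [x _||]; first by case: (dF x).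
    exact/cvg_at_right_filter/cF.
  exact/cvg_at_left_filter/cF.
- by move=> x _; rewrite derive1E; case: (dF x).
Qed.
End absolutely_continuous.

(** * Product rule and integrals of derivatives over the line *)

Section integration_by_parts.
Context {R : realType}.
Notation mu := (@lebesgue_measure R).
Implicit Types (f g h F G H : R -> R) (a b c e A : R).

(** Both sides are iterated integrals of f(x) g(y) over the half-plane y <= x. This is the source of
    integration by parts for functions with only an almost everywhere derivative. *)
Lemma fubini_triangle f g : integrable_on setT f -> integrable_on setT g ->
  \int[mu]_x (f x * \int[mu]_(y in `]-oo, x]) g y) =
  \int[mu]_y (g y * \int[mu]_(x in `[y, +oo[) f x).
Proof.
move=> intf intg.
have mf : measurable_fun setT f by exact: integrable_onM.
have mg : measurable_fun setT g by exact: integrable_onM.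
pose k (z : measurableTypeR R * measurableTypeR R) := (f z.1 * g z.2 * ((z.2 : R) <= z.1)%R%:R)%:E.
have mk : measurable_fun setT k.
  apply/measurable_EFinP; apply: measurable_funM.
    apply: measurable_funM.
      by apply: (measurableT_comp mf); exact: measurable_fst.
    by apply: (measurableT_comp mg); exact: measurable_snd.
  have mb : measurable_fun setT (fun b : bool => b%:R : R) by move=> _ Y mY.
  apply: (measurableT_comp mb).
  by apply: measurable_fun_ler; [exact: measurable_snd|exact: measurable_fst].
have kE1 x : (\int[mu]_y k (x, y) = (f x * \int[mu]_(y in `]-oo, x]) g y)%:E)%E.
  rewrite Rintegral_indic EFinM.
  rewrite fineK; last first.
    by apply: integrable_fin_num => //; exact: integrable_on_indic.
  rewrite -integralZl//; last first.
    by exact: integrable_on_indic.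
  apply: eq_integral => y _; rewrite /k /= -EFinM indicE.
  by rewrite mem_setE in_itv/=; congr EFin; ring.
have kE2 y : (\int[mu]_x k (x, y) = (g y * \int[mu]_(x in `[y, +oo[) f x)%:E)%E.
  rewrite Rintegral_indic EFinM.
  rewrite fineK; last first.
    by apply: integrable_fin_num => //; exact: integrable_on_indic.
  rewrite -integralZl//; last first.
    by exact: integrable_on_indic.
  apply: eq_integral => x _; rewrite /k /= -EFinM indicE.
  by rewrite mem_setE in_itv/= andbT; congr EFin; ring.
have mak : measurable_fun setT (abse \o k) by exact: measurableT_comp.
have ik : (mu \x mu)%E.-integrable setT k.
  apply/integrable12ltyP => //.
  have ing : integrable_on setT (fun y => `|g y|) by exact: integrable_on_norm.
  have inf : integrable_on setT (fun y => `|f y|) by exact: integrable_on_norm.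
  apply: (@le_lt_trans _ _ (\int[mu]_x ((\int[mu]_y `|g y|) * `|f x|)%:E)%E).
    apply: ge0_le_integral => //=.
    - by move=> x _; exact: integral_ge0.
    - exact: (@measurable_fun_fubini_tonelli_F _ _ _ _ _ mu _ mak (fun=> abse_ge0 _)).
    - apply/measurable_EFinP; apply: measurable_funM => //.
      exact: measurableT_comp.
    - move=> x _; rewrite mulrC EFinM fineK; last exact: integrable_fin_num.
      rewrite -integralZl//; apply: ge0_le_integral => //.
      + exact: (measurableT_comp mak (pair1_measurable x)).
      + apply/measurable_EFinP; apply: measurable_funM => //.
        exact: measurableT_comp.
      + move=> y _; rewrite lee_fin /k /= !normrM; apply: ler_piMr => //.
        by case: (y <= x)%R; rewrite /= ?normr1 ?normr0.
  apply: integrable_lty => //.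
  exact: (@integrable_onZ _ setT (\int[mu]_y `|g y|) (fun x => `|f x|)).
have := Fubini ik.
rewrite (eq_integral _ _ (fun x _ => kE1 x)) (eq_integral _ _ (fun x _ => kE2 x)) => h.
by rewrite /Rintegral h.
Qed.

(** Apply [fubini_triangle] to [f] and [g] cut to [a, b]: the inner integrals are G x - G a and F b
    - F x, and the identity rearranges into the product rule. *)
Lemma primitive_mul F G f g : primitive_of F f -> primitive_of G g ->
  primitive_of (fun x => F x * G x) (fun x => f x * G x + F x * g x).
Proof.
move=> pF pG; have [lf Ff] := pF; have [lg Gg] := pG.
have lfG : loc_integrable (fun x => f x * G x).
  rewrite (_ : (fun x => _) = (fun x => G x * f x)); last by apply/funext => x; rewrite mulrC.
  by apply: loc_integrableMc => //; exact: primitive_of_continuous pG.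
have lFg : loc_integrable (fun x => F x * g x).
  by apply: loc_integrableMc => //; exact: primitive_of_continuous pF.
split; first exact: loc_integrableD.
move=> a b ab; rewrite RintegralD_on//.
pose f1 x := \1_(`[a, b]) x * f x; pose g1 x := \1_(`[a, b]) x * g x.
have i1 : integrable_on setT f1 by apply: (proj1 (integrable_on_restrict _ (measurable_itv _))).
have i2 : integrable_on setT g1 by apply: (proj1 (integrable_on_restrict _ (measurable_itv _))).
have := fubini_triangle i1 i2.
rewrite [LHS](_ : _ = \int[mu]_(x in `[a, b]) (f x * G x - G a * f x)); last first.
  rewrite [RHS]Rintegral_indic; apply: eq_Rintegral => x _.
  rewrite /f1 indicE; have [|_] := boolP (x \in _); last by rewrite !mul0r.
  rewrite inE/= in_itv/= => /andP[ax xb]; rewrite !mul1r.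
  rewrite (_ : \int[mu]_(y in _) _ = G x - G a); first by ring.
  rewrite (Gg _ _ ax) Rintegral_indic [RHS]Rintegral_indic; apply: eq_Rintegral => y _.
  rewrite /g1 !indicE !mem_setE !in_itv/=.
  by have [yx|yx] := leP y x; have [ay|ay] := leP a y; have [yb|yb] := leP y b;
    rewrite /= ?mul1r ?mul0r ?mulr0//; lra.
rewrite [RHS](_ : _ = \int[mu]_(x in `[a, b]) (F b * g x - F x * g x)); last first.
  rewrite [RHS]Rintegral_indic; apply: eq_Rintegral => x _.
  rewrite /g1 indicE; have [|_] := boolP (x \in _); last by rewrite !mul0r.
  rewrite inE/= in_itv/= => /andP[ax xb]; rewrite !mul1r.
  rewrite (_ : \int[mu]_(y in _) _ = F b - F x); first by ring.
  rewrite (Ff _ _ xb) Rintegral_indic [RHS]Rintegral_indic; apply: eq_Rintegral => y _.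
  rewrite /f1 !indicE !mem_setE !in_itv/= andbT.
  by have [yx|yx] := leP x y; have [ay|ay] := leP a y; have [yb|yb] := leP y b;
    rewrite /= ?mul1r ?mul0r ?mulr0//; lra.
rewrite !RintegralB_on//; [|exact: loc_integrableZ..].
rewrite !RintegralZ_on// -Ff// -Gg//; lra.
Qed.

Lemma cvg_Rintegral_itv f : integrable_on setT f ->
  \int[mu]_(x in `[- n%:R, n%:R]) f x @[n --> \oo] --> \int[mu]_x f x.
Proof.
move=> intf.
have mf := integrable_onM intf.
rewrite (_ : (fun n => _) = (fun n => \int[mu]_x (\1_(`[- n%:R, n%:R]) x * f x))); last first.
  by apply/funext => n; rewrite Rintegral_indic.
apply: (proj2 (@dominated_Rintegral _ setT _ f (fun x => `|f x|) _ _ _ _ _)) => //.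
- move=> n; apply: measurable_funM => //; exact: measurable_indic.
- move=> x _; have [N Nx] : exists N : nat, `|x| <= N%:R.
    by exists (Num.truncn `|x|).+1; rewrite ltW// truncnS_gt.
  apply: cvg_near_cst; exists N => // n /= Nn.
  rewrite indicE mem_set ?mul1r//= in_itv/= -ler_norml (le_trans Nx)// ler_nat//.
- exact: integrable_on_norm.
- move=> n x _; rewrite indicE normrM ler_piMl//.
  by case: (_ \in _); rewrite ?normr1 ?normr0.
Qed.

Lemma Rintegral_cst_itv (e a b : R) : a <= b -> \int[mu]_(x in `[a, b]) e = e * (b - a).
Proof.
move=> ab; rewrite Rintegral_cst//= lebesgue_measure_itv/= lte_fin.
case: ifPn => //=; rewrite -leNgt => ba.
by have -> : a = b; [apply/eqP; rewrite eq_le ab ba|rewrite subrr].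
Qed.

(** Points beyond any bound where [F] is small stand in for a limit at infinity, which integrability
    alone does not provide. *)
Lemma exists_small_itv F e A : integrable_on setT F -> 0 < e ->
  (exists2 x, A < x & `|F x| < e) /\ (exists2 x, x < A & `|F x| < e).
Proof.
move=> iF e0.
have inF : integrable_on setT (fun x => `|F x|) by exact: integrable_on_norm.
have key a b : a <= b -> (forall x, a <= x <= b -> e <= `|F x|) ->
    e * (b - a) <= \int[mu]_x `|F x|.
  move=> ab h; rewrite -Rintegral_cst_itv//.
  apply: (@le_trans _ _ (\int[mu]_(x in `[a, b]) `|F x|)).
    apply: le_Rintegral_on => //.
    + apply: integrable_on_continuous; exact: cst_continuous.
    + exact: integrable_onS inF.
  exact: le_Rintegral_sub.
(* On an interval of this length, |F| >= e would force an integral of at least 1 more than the total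
   one. *)
pose L := (\int[mu]_x `|F x| + 1) / e.
have L0 : 0 <= L.
  by apply: divr_ge0; [apply: addr_ge0 => //; apply: Rintegral_ge0|exact: ltW].
have eL : e * L = \int[mu]_x `|F x| + 1 by rewrite /L mulrC divfK// gt_eqF.
split; apply: contrapT => h.
- have := @key (A + 1) (A + 1 + L); rewrite (_ : A + 1 + L - (A + 1) = L); last by lra.
  rewrite eL => /(_ _ _)/wrap[]; first by lra.
    move=> x /andP[x1 x2]; rewrite leNgt; apply/negP => Fx; apply: h; exists x => //; lra.
  by rewrite gerDl ler10.
- have := @key (A - 1 - L) (A - 1); rewrite (_ : A - 1 - (A - 1 - L) = L); last by lra.
  rewrite eL => /(_ _ _)/wrap[]; first by lra.
    move=> x /andP[x1 x2]; rewrite leNgt; apply/negP => Fx; apply: h; exists x => //; lra.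
  by rewrite gerDl ler10.
Qed.

(** Choose N so that |g| has little mass outside [-N, N], then y < -N and x > N where [F] is small:
    the integral of [g] over [y, x] is F x - F y. *)
Lemma primitive_integral0 F g : primitive_of F g -> integrable_on setT F ->
  integrable_on setT g -> \int[mu]_x g x = 0.
Proof.
move=> [lg Fg] iF ig.
have ing : integrable_on setT (fun x => `|g x|) by exact: integrable_on_norm.
apply/eqP; rewrite -normr_le0; apply/ler_addgt0Pl => e e0; rewrite addr0.
have e3 : 0 < e / 3 by lra.
have /cvgrPdist_lt/(_ _ e3)[N _ /(_ N (leqnn _))] := cvg_Rintegral_itv ing.
rewrite /= => hN.
have [[x Nx Fx] _] := @exists_small_itv _ _ (N%:R) iF e3.
have [_ [y Ny Fy]] := @exists_small_itv _ _ (- N%:R) iF e3.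
have N0 : (0 : R) <= N%:R by [].
have yx : y <= x by lra.
have h1 : `|\int[mu]_z g z - \int[mu]_(z in `[y, x]) g z| < e / 3.
  apply: le_lt_trans hN; rewrite [in X in _ <= X]ger0_norm; last first.
    by rewrite subr_ge0; exact: le_Rintegral_sub.
  rewrite (Rintegral_indic `[y, x]) (Rintegral_indic `[- N%:R, N%:R]) -!RintegralB_on//; last 2 first.
  - exact: integrable_on_indic.
  - exact: integrable_on_indic.
  apply: le_Rintegral_dom => //.
  - apply: measurable_funB; first exact: integrable_onM.
    apply: measurable_funM; [exact: measurable_indic|exact: integrable_onM].
  - apply: integrable_onB => //.
    exact: integrable_on_indic.
  move=> z _; rewrite -[X in `|X - _|]mul1r -mulrBl normrM -[X in _ <= X - _]mul1r -mulrBl.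
  apply: ler_wpM2r => //; rewrite !indicE !mem_setE !in_itv/=.
  have [yz|yz] := leP y z; have [zx|zx] := leP z x;
    have [nz|nz] := leP (- N%:R) z; have [zn|zn] := leP z N%:R;
    rewrite /= ?subrr ?subr0 ?normr0 ?normr1 ?ler01 //; lra.
have h2 : `|\int[mu]_(z in `[y, x]) g z| < e / 3 + e / 3.
  by rewrite -Fg// (le_lt_trans (ler_normB _ _))// ltrD.
rewrite -(subrK (\int[mu]_(z in `[y, x]) g z) (\int[mu]_z g z)).
apply: (le_trans (ler_normD _ _)); lra.
Qed.
End integration_by_parts.

(** * Square-integrable functions *)

Section square_integrable.
Context {R : realType}.
Notation mu := (@lebesgue_measure R).
Implicit Types (f g h F G H : R -> R) (a b c e A k M : R).

Definition L2 f := measurable_fun setT f /\ integrable_on setT (fun x => f x ^+ 2).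

(** The square of the L^2 norm, so that no root appears; the triangle inequality takes the form of
    [nsqD], with factors 2. *)
Definition nsq f : R := \int[mu]_x f x ^+ 2.

Lemma nsq_ge0 f : 0 <= nsq f.
Proof. by apply: Rintegral_ge0 => x _; exact: sqr_ge0. Qed.

Lemma integrable_setT_le g f : measurable_fun setT f -> integrable_on setT g ->
  (forall x, `|f x| <= g x) -> integrable_on setT f.
Proof. by move=> mf ig fg; apply: integrable_on_le ig _. Qed.

Lemma L2_mul f g : L2 f -> L2 g -> integrable_on setT (fun x => f x * g x).
Proof.
move=> [mf f2] [mg g2]; apply: (@integrable_setT_le (fun x => f x ^+ 2 + g x ^+ 2)).
- exact: measurable_funM.
- exact: integrable_onD.
- move=> x; rewrite ler_norml; apply/andP; split.
    rewrite -subr_ge0 (_ : _ - _ = (f x ^+ 2 + g x ^+ 2 + (f x + g x) ^+ 2) / 2); last by field.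
    by rewrite divr_ge0// !addr_ge0 ?sqr_ge0.
  rewrite -subr_ge0 (_ : _ - _ = (f x ^+ 2 + g x ^+ 2 + (f x - g x) ^+ 2) / 2); last by field.
  by rewrite divr_ge0// !addr_ge0 ?sqr_ge0.
Qed.

Lemma L2D f g : L2 f -> L2 g -> L2 (fun x => f x + g x).
Proof.
move=> Lf Lg; have [mf f2] := Lf; have [mg g2] := Lg.
split; first exact: measurable_funD.
rewrite (_ : (fun x => _) = fun x => f x ^+ 2 + 2 * (f x * g x) + g x ^+ 2); last first.
  by apply/funext => x; ring.
apply: integrable_onD => //; apply: integrable_onD => //; apply: integrable_onZ => //.
exact: L2_mul.
Qed.

Lemma L2_bounded M f g : measurable_fun setT g -> (forall x, `|g x| <= M) ->
  L2 f -> L2 (fun x => g x * f x).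
Proof.
move=> mg gM [mf f2]; split; first exact: measurable_funM.
apply: (@integrable_setT_le (fun x => M ^+ 2 * f x ^+ 2)).
- by apply: measurable_funX; exact: measurable_funM.
- exact: integrable_onZ.
- move=> x; rewrite ger0_norm ?sqr_ge0// exprMn ler_wpM2r ?sqr_ge0//.
  by rewrite -(ger0_norm (sqr_ge0 (g x))) normrX lerXn2r// ?nnegrE// (le_trans _ (gM x)).
Qed.

Lemma L2Z k f : L2 f -> L2 (fun x => k * f x).
Proof. by move=> Lf; apply: (@L2_bounded `|k|). Qed.

Lemma L2N f : L2 f -> L2 (fun x => - f x).
Proof.
by move=> /(L2Z (-1)); rewrite (_ : (fun x => -1 * _) = (fun x => - f x))//; apply/funext => x; rewrite mulN1r.
Qed.

Lemma L2B f g : L2 f -> L2 g -> L2 (fun x => f x - g x).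
Proof. by move=> Lf Lg; apply: L2D => //; exact: L2N. Qed.

Lemma L2_ae f g : measurable_fun setT g -> {ae mu, forall x, f x = g x} -> L2 f -> L2 g.
Proof.
move=> mg fg [mf f2]; split => //.
apply: (@ae_integrable_on _ _ (fun x => f x ^+ 2)) => //.
  exact: measurable_funX.
by apply: ae_imp fg => x -> .
Qed.

Lemma L2_le g f : measurable_fun setT f -> L2 g -> (forall x, `|f x| <= `|g x|) -> L2 f.
Proof.
move=> mf [mg g2] fg; split => //; apply: integrable_setT_le g2 _ => //.
  exact: measurable_funX.
move=> x; rewrite ger0_norm ?sqr_ge0// -[leLHS]real_normK ?num_real// -[leRHS]real_normK ?num_real//.
by rewrite lerXn2r ?nnegrE.
Qed.

Lemma nsq_ae f g : measurable_fun setT f -> measurable_fun setT g ->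
  {ae mu, forall x, f x = g x} -> nsq f = nsq g.
Proof.
move=> mf mg fg; apply: ae_Rintegral => //; [exact: measurable_funX|exact: measurable_funX|].
by apply: ae_imp fg => x ->.
Qed.

Lemma nsq_eq0 f : L2 f -> nsq f = 0 -> {ae mu, forall x, f x = 0}.
Proof.
move=> [mf f2] /Rintegral_eq0_ae -/(_ f2)/(_ (fun x => sqr_ge0 _)); apply: ae_imp => x.
by move/eqP; rewrite sqrf_eq0 => /eqP.
Qed.

Lemma nsq_le f g : L2 f -> L2 g -> (forall x, `|f x| <= `|g x|) -> nsq f <= nsq g.
Proof.
move=> [mf f2] [mg g2] fg; apply: le_Rintegral_on => // x _.
rewrite -[leLHS]real_normK ?num_real// -[leRHS]real_normK ?num_real//.
by rewrite lerXn2r ?nnegrE.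
Qed.

Lemma nsqZ k f : L2 f -> nsq (fun x => k * f x) = k ^+ 2 * nsq f.
Proof.
move=> [mf f2]; rewrite /nsq -RintegralZ_on//; apply: eq_Rintegral => x _; exact: exprMn.
Qed.

Lemma nsqN f : nsq (fun x => - f x) = nsq f.
Proof. by apply: eq_Rintegral => x _; rewrite sqrrN. Qed.

Lemma nsqD f g : L2 f -> L2 g -> nsq (fun x => f x + g x) <= 2 * nsq f + 2 * nsq g.
Proof.
move=> Lf Lg; have [mf f2] := Lf; have [mg g2] := Lg.
rewrite /nsq -!RintegralZ_on// -RintegralD_on//; [|exact: integrable_onZ..].
apply: le_Rintegral_on => //; first by have [] := L2D Lf Lg.
  by apply: integrable_onD => //; exact: integrable_onZ.
move=> x _; rewrite -subr_ge0 (_ : _ - _ = (f x - g x) ^+ 2) ?sqr_ge0//; ring.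
Qed.

Lemma nsqB f g : L2 f -> L2 g -> nsq (fun x => f x - g x) <= 2 * nsq f + 2 * nsq g.
Proof. by move=> Lf Lg; rewrite -(nsqN g); apply: nsqD => //; exact: L2N. Qed.

Lemma nsqD_expand f g : L2 f -> L2 g ->
  nsq (fun x => f x + g x) = nsq f + 2 * (\int[mu]_x (f x * g x)) + nsq g.
Proof.
move=> Lf Lg; have [mf f2] := Lf; have [mg g2] := Lg.
have fg := L2_mul Lf Lg.
rewrite /nsq -!RintegralZ_on// -!RintegralD_on//.
- by apply: eq_Rintegral => x _; ring.
- by apply: integrable_onD => //; exact: integrable_onZ.
- exact: integrable_onZ.
Qed.

(** The quadratic polynomial k -> nsq (f + k g) is nonnegative; it is evaluated at its minimum k = -
    I / nsq g. If nsq g = 0 it is affine, and its slope must vanish. *)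
Lemma cauchy_schwarz f g : L2 f -> L2 g ->
  (\int[mu]_x (f x * g x)) ^+ 2 <= nsq f * nsq g.
Proof.
move=> Lf Lg; set I := \int[mu]_x _.
have key (k : R) : 0 <= nsq f + 2 * (k * I) + k ^+ 2 * nsq g.
  have := nsq_ge0 (fun x => f x + k * g x); rewrite nsqD_expand//; last exact: L2Z.
  rewrite nsqZ// (_ : \int[mu]_x (f x * (k * g x)) = k * I)//.
  by rewrite -RintegralZ_on//; [apply: eq_Rintegral => x _; rewrite mulrCA|exact: L2_mul].
have [g0|g0] := eqVneq (nsq g) 0.
  rewrite g0 mulr0; have : I = 0.
    apply/eqP; apply: contrapT => /negP I0.
    (* At this k the affine polynomial takes the value -1. *)
    have := key (- (nsq f + 1) / (2 * I)); rewrite g0 mulr0 addr0.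
    rewrite (_ : 2 * _ = - (nsq f + 1)); last by field.
    by rewrite opprD addrA subrr add0r oppr_ge0 ler10.
  by move=> ->; rewrite expr0n.
have g1 : 0 < nsq g by rewrite lt_def g0 nsq_ge0.
have := key (- I / nsq g); rewrite -(pmulr_lge0 _ g1).
have -> : (nsq f + 2 * (- I / nsq g * I) + (- I / nsq g) ^+ 2 * nsq g) * nsq g
  = nsq f * nsq g - I ^+ 2 by field.
by rewrite subr_ge0.
Qed.

Lemma dominated_nsq (u : nat -> R -> R) f g : (forall n, measurable_fun setT (u n)) ->
  measurable_fun setT f ->
  (forall x, u n x @[n --> \oo] --> f x) -> L2 g -> (forall n x, `|u n x - f x| <= `|g x|) ->
  nsq (fun x => u n x - f x) @[n --> \oo] --> 0.
Proof.
move=> mun mf uf [mg g2] ug.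
have := @dominated_Rintegral _ setT (fun n x => (u n x - f x) ^+ 2) (fun=> 0) (fun x => g x ^+ 2).
case=> //.
- by move=> n; apply: measurable_funX; exact: measurable_funB.
- move=> x _; rewrite (_ : 0 = (f x - f x) ^+ 2); last by rewrite subrr expr0n.
  have h : (u n x - f x) @[n --> \oo] --> f x - f x by apply: cvgB => //; exact: cvg_cst.
  by rewrite expr2; under eq_fun do rewrite expr2; exact: cvgM.
- move=> n x _; rewrite ger0_norm ?sqr_ge0//.
  rewrite -[leLHS]real_normK ?num_real// -[leRHS]real_normK ?num_real//.
  by rewrite lerXn2r ?nnegrE.
by move=> _; rewrite Rintegral_cst// mul0r.
Qed.

Lemma L2_loc f : L2 f -> loc_integrable f.
Proof.
move=> [mf f2] a b; apply: (@integrable_on_le _ _ (fun x => 1 + f x ^+ 2)) => //.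
- exact: measurable_funTS.
- apply: integrable_onD => //; last exact: integrable_onS f2.
  by apply: integrable_on_continuous; exact: cst_continuous.
- move=> x _; rewrite -(real_normK (num_real (f x))); set y := `|_|.
  rewrite -subr_ge0 (_ : _ - _ = (y - 1/2) ^+ 2 + 3/4); last by field.
  by rewrite addr_ge0// sqr_ge0.
Qed.

End square_integrable.

(** * Test functions *)

Section smooth_functions.
Context {R : realType}.
Notation mu := (@lebesgue_measure R).
Implicit Types (f g h : R -> R) (a b c k M x : R).

(** Differentiability n times, with the derivatives as witnesses instead of [derive1n]: closure
    under products and compositions is then a plain induction. *)
Fixpoint Cn (n : nat) f : Prop :=
  if n is m.+1 then exists2 f', (forall x : R, is_derive x (1 : R) f (f' x)) & Cn m f'
  else True.

Lemma CnS n f : Cn n.+1 f -> Cn n f.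
Proof.
elim: n f => // n IH f [f' df Cf]; exists f' => //; exact: IH.
Qed.

Lemma is_derive_derive1 f f' : (forall x : R, is_derive x (1 : R) f (f' x)) -> f^`()%classic = f'.
Proof. by move=> df; apply/funext => x; rewrite derive1E; have [_ ->] := df x. Qed.

Lemma smoothP f : (forall n (x : R), derivable (derive1n n f) x 1) <-> forall n, Cn n f.
Proof.
split=> h n.
  elim: n f h => // n IH f h /=; exists (f^`())%classic.
    by move=> x; apply: DeriveDef; [exact: (h 0%N x)|rewrite derive1E].
  by apply: IH => m x; rewrite -derive1Sn.
elim: n f h => [|n IH] f h x.
  by have [f' df _] := h 1%N; case: (df x).
rewrite derive1Sn; apply: IH => m; have [f' df Cf] := h m.+1.
by rewrite (is_derive_derive1 df).
Qed.

Lemma Cn_cst n k : Cn n (fun=> k).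
Proof.
elim: n k => // n IH k /=; exists (fun=> 0) => // x; exact: is_derive_cst.
Qed.

Lemma CnD n f g : Cn n f -> Cn n g -> Cn n (fun x => f x + g x).
Proof.
elim: n f g => // n IH f g [f' df Cf] [g' dg Cg] /=; exists (fun x => f' x + g' x).
  by move=> x; apply: is_deriveD.
exact: IH.
Qed.

Lemma CnM n f g : Cn n f -> Cn n g -> Cn n (fun x => f x * g x).
Proof.
elim: n f g => // n IH f g Cf Cg; have [f' df Cf'] := Cf; have [g' dg Cg'] := Cg.
exists (fun x => f x * g' x + g x * f' x); first by move=> x; exact: is_deriveM.
by apply: CnD; apply: IH => //; exact: CnS.
Qed.

Lemma CnZ n k f : Cn n f -> Cn n (fun x => k * f x).
Proof. by move=> Cf; apply: CnM => //; exact: Cn_cst. Qed.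

Lemma is_derive_comp1 f g (x : R) a b : is_derive (g x) (1 : R) f a ->
  is_derive x (1 : R) g b -> is_derive x (1 : R) (fun y => f (g y)) (a * b).
Proof. exact: is_derive1_comp. Qed.

Lemma Cn_expR n f : Cn n f -> Cn n (fun x => expR (f x)).
Proof.
elim: n f => // n IH f Cf; have [f' df Cf'] := Cf.
exists (fun x => expR (f x) * f' x).
  by move=> x; apply: is_derive_comp1.
by apply: CnM => //; apply: IH; exact: CnS.
Qed.

Lemma is_derive_affine k c (x : R) : is_derive x (1 : R) (fun y => k * y + c) k.
Proof.
have h : is_derive x (1 : R) (k \*: (@id R) + cst c) (k *: (1 : R) + 0).
  apply: is_deriveD.
apply: (is_derive_eq h).
by rewrite addr0 /GRing.scale/= mulr1.
Qed.

Lemma Cn_affine n k c f : Cn n f -> Cn n (fun x => f (k * x + c)).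
Proof.
elim: n f => // n IH f [f' df Cf'].
exists (fun x => f' (k * x + c) * k).
  by move=> x; apply: is_derive_comp1; exact: is_derive_affine.
by under eq_fun do rewrite mulrC; apply: CnZ; exact: IH.
Qed.

(** The powers of 1/x make the family stable under differentiation, which turns the smoothness of
    exp(-1/x) at 0 into an induction. *)
Definition theta (n : nat) x : R := if 0 < x then x^-1 ^+ n * expR (- x^-1) else 0.

(** exp(1/x) dominates the term of degree n + 1 of its series. *)
Lemma theta_le n x : 0 < x -> theta n x <= (n.+1)`!%:R * x.
Proof.
move=> x0; rewrite /theta x0 expRN -ler_pdivlMr ?invr_gt0 ?expR_gt0// invrK.
have y0 : 0 <= x^-1 by rewrite invr_ge0 ltW.
have f0 : 0 < (n.+1)`!%:R :> R by rewrite ltr0n fact_gt0.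
apply: (@le_trans _ _ ((n.+1)`!%:R * x * (x^-1 ^+ n.+1 / (n.+1)`!%:R))).
  rewrite exprS le_eqVlt; apply/orP; left; apply/eqP; field.
  by rewrite (gt_eqF x0) (gt_eqF f0).
apply: ler_wpM2l; first by rewrite mulr_ge0// ltW.
by apply: le_trans (expR_ge1Dxn n y0); rewrite lerDr.
Qed.

Lemma theta_ge0 n x : 0 <= theta n x.
Proof.
rewrite /theta; case: ifPn => // x0.
by rewrite mulr_ge0 ?expR_ge0// exprn_ge0// invr_ge0 ltW.
Qed.

(** Away from 0 this is calculus. At 0 the difference quotient at h > 0 is [theta n.+1 h], which
    [theta_le] sends to 0. *)
Lemma is_derive_theta n x :
  is_derive x (1 : R) (theta n) (- n%:R * theta n.+1 x + theta n.+2 x).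
Proof.
have [x0|x0|->] := ltgtP x 0.
- rewrite [X in is_derive _ _ _ X](_ : _ = 0); last first.
    by rewrite /theta ltNge (ltW x0)/= mulr0 addr0.
  have dc : is_derive x (1 : R) (cst (0 : R)) (0 : R) by exact: is_derive_cst.
  apply: near_eq_is_derive dc.
  near=> y; rewrite /theta/= ltNge (_ : y <= 0)//=.
  by apply: ltW; near: y; exact: lt_nbhsl.
- have dV : is_derive x (1 : R) (fun y => y^-1) (- x ^- 2).
    have h := @is_deriveV R id x 1 1 (lt0r_neq0 x0) (is_derive_id _ _).
    by apply: (is_derive_eq h); rewrite /GRing.scale/= mulr1.
  have dE : is_derive x (1 : R) (fun y => expR (- y^-1)) (expR (- x^-1) * x ^- 2).
    apply: is_derive_comp1.
    by apply: (is_derive_eq (is_deriveN dV)); rewrite opprK.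
  have dP := @is_deriveX R _ (fun y : R => y^-1) n x 1 _ dV.
  have dPE := is_deriveM dP dE.
  rewrite mulrfctE exprfctE in dPE.
  have dF : is_derive x (1 : R) (fun y => y^-1 ^+ n * expR (- y^-1)) (- n%:R * theta n.+1 x + theta n.+2 x).
    apply: (is_derive_eq dPE); rewrite /theta x0 /=.
    rewrite /GRing.scale/= !exprS; case: n {dP dPE} => [|n] /=.
      by rewrite !mulr0n ?expr0; field; rewrite gt_eqF.
    by rewrite -mulr_natr !exprS; field; rewrite gt_eqF.
  apply: near_eq_is_derive dF.
  near=> y; rewrite /theta (_ : 0 < y)//.
  by near: y; exact: lt_nbhsr.
- rewrite [X in is_derive _ _ _ X](_ : _ = 0); last first.
    by rewrite /theta ltxx mulr0 addr0.
  have h : h^-1 *: (theta n (h *: 1 + 0) - theta n 0) @[h --> 0^'] --> (0 : R).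
    apply/cvgrPdist_le => e e0; near=> h.
    rewrite sub0r normrN /theta ltxx subr0 addr0 /GRing.scale/= mulr1.
    have := theta_ge0 n h; rewrite /theta.
    case: ifPn => [h0|_]; last by move=> _; rewrite mulr0 normr0 ltW.
    rewrite mulrA -exprS => _; have := @theta_le n.+1 h h0; have := theta_ge0 n.+1 h.
    rewrite /theta h0 => ? hle; rewrite ger0_norm//; apply: le_trans hle _.
    have f0 : 0 < (n.+2)`!%:R :> R by rewrite ltr0n fact_gt0.
    rewrite mulrC -ler_pdivlMr// -(ger0_norm (ltW h0)).
    near: h; apply: dnbhs0_le; exact: divr_gt0.
  split; first by apply/cvg_ex; exists 0.
  exact: cvg_lim.
Unshelve. all: by end_near. Qed.

Lemma Cn_theta m n : Cn m (theta n).
Proof.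
elim: m n => // m IH n /=; exists (fun x => - n%:R * theta n.+1 x + theta n.+2 x).
  exact: is_derive_theta.
by apply: CnD => //; exact: CnZ.
Qed.

(** As k grows these functions, with values in [0, 1], tend to the indicator of ]a, b[. The
    arguments of [theta] are written in the shape of [Cn_affine]. *)
Definition bump a b k x : R :=
  1 - expR (- k * (theta 0 (1 * x + (- a)) * theta 0 (-1 * x + b))).

Lemma Cn_bump n a b k : Cn n (bump a b k).
Proof.
apply: CnD; first exact: Cn_cst.
rewrite (_ : (fun x => - _) = (fun x => -1 * expR (- k * (theta 0 (1 * x + (- a)) * theta 0 (-1 * x + b))))); last first.
  by apply/funext => x; rewrite [RHS]mulN1r.
apply: CnZ; apply: Cn_expR; apply: CnZ; apply: CnM; apply: Cn_affine; exact: Cn_theta.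
Qed.

Lemma bump_out a b k x : x <= a \/ b <= x -> bump a b k x = 0.
Proof.
rewrite /bump => -[xa|bx].
  by rewrite {1}/theta ltNge (_ : _ <= 0)/= ?mul0r ?mulr0 ?expR0 ?subrr//; lra.
by rewrite {2}/theta ltNge (_ : _ <= 0)/= ?mul0r ?mulr0 ?expR0 ?subrr//; lra.
Qed.

Lemma bump_bound a b k x : 0 <= k -> 0 <= bump a b k x <= 1.
Proof.
move=> k0; rewrite /bump; set t := theta 0 _ * _.
have t0 : 0 <= k * t by rewrite mulr_ge0// mulr_ge0 ?theta_ge0.
rewrite mulNr; apply/andP; split; last by rewrite lerBlDr lerDl expR_ge0.
by rewrite subr_ge0 expR_le1 oppr_le0.
Qed.

Lemma theta_gt0 n x : 0 < x -> 0 < theta n x.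
Proof. by move=> x0; rewrite /theta x0 mulr_gt0 ?expR_gt0// exprn_gt0 ?invr_gt0. Qed.

Lemma cvg_bump a b x : bump a b n%:R x @[n --> \oo] --> (\1_(`]a, b[) x : R).
Proof.
rewrite indicE mem_setE in_itv/=.
have [xa|ax] := leP x a.
  by apply: cvg_near_cst; near=> n; rewrite bump_out//; left.
have [bx|xb] := leP b x.
  by apply: cvg_near_cst; near=> n; rewrite bump_out//; right.
rewrite /= /bump; set t := theta 0 _ * _.
have t0 : 0 < t by rewrite mulr_gt0 ?theta_gt0//; lra.
rewrite -[X in _ --> X]subr0; apply: cvgB; first exact: cvg_cst.
have h : (expR (- 1 * t)) ^+ n @[n --> \oo] --> 0.
  by apply: cvg_expr; rewrite ger0_norm ?expR_ge0// expR_lt1 mulN1r oppr_lt0.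
apply: cvg_trans h; apply: near_eq_cvg; near=> n.
by rewrite -expRM_natl; congr expR; ring.
Unshelve. all: by end_near. Qed.
End smooth_functions.

Import HBNNSimple.

(** * Fundamental lemma and density of test functions in L^2 *)

Section test_functions.
Context {R : realType}.
Notation mu := (@lebesgue_measure R).
Implicit Types (f g h phi : R -> R) (a b c k M x e : R).

Lemma test_functionP phi : test_function phi <->
  (forall n, Cn n phi) /\ (exists M, forall x, M < `|x| -> phi x = 0).
Proof. by split=> -[/smoothP]. Qed.

Lemma Cn_continuous f : Cn 1 f -> continuous f.
Proof.
move=> [f' df _] x; apply/differentiable_continuous/derivable1_diffP.
by case: (df x).
Qed.

Lemma test_continuous phi : test_function phi -> continuous phi.
Proof. by move=> /test_functionP[Cp _]; exact: Cn_continuous. Qed.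

Lemma test_measurable phi : test_function phi -> measurable_fun setT phi.
Proof. by move=> /test_continuous; exact: continuous_measurable_fun. Qed.

Lemma test_is_derive phi : test_function phi ->
  forall x : R, is_derive x (1 : R) phi (derive1n 1 phi x).
Proof.
move=> [Cp _] x; apply: DeriveDef; first exact: (Cp 0%N).
by rewrite derive1n1 derive1E.
Qed.

Lemma test_derive phi : test_function phi -> test_function (derive1n 1 phi).
Proof.
move=> tp; have [Cp [M pM]] := tp; split.
  by move=> n x; rewrite derive1n1 -derive1Sn.
exists M => x Mx; have [_] := test_is_derive tp x; rewrite derive1n1 derive1E => _.
have dc : is_derive x (1 : R) (cst (0 : R)) (0 : R) by exact: is_derive_cst.
have [_ <-] : is_derive x (1 : R) phi 0.
  apply: near_eq_is_derive dc.
  have : \forall y \near x, M < `|y|.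
    exact: (@cvgr_gt R R (nbhs x) _ (fun y => `|y|) `|x| (@norm_continuous R R x) M Mx).
  by apply: filterS => y /pM.
by [].
Qed.

Lemma test_deriven n phi : test_function phi -> test_function (derive1n n phi).
Proof.
elim: n phi => // n IH phi tp; rewrite derive1Sn -derive1n1; apply: IH.
exact: test_derive.
Qed.

Lemma test_bounded phi : test_function phi ->
  exists M K, [/\ 0 <= M, 0 <= K & forall x, `|phi x| <= K * \1_(`[- M, M]) x].
Proof.
move=> tp; have [_ [M pM]] := tp.
have [K hK] := continuous_bounded_itv (- `|M|) `|M| (test_continuous tp).
have K0 : 0 <= K by apply: le_trans (hK 0 _); rewrite // oppr_le0 normr_ge0.
exists `|M|, K; split => // x; rewrite indicE mem_setE in_itv/= -ler_norml.
have [xM|Mx] := leP `|x| `|M|.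
  by rewrite mulr1 hK// -ler_norml.
by rewrite pM ?normr0 ?mulr0// (le_lt_trans (ler_norm _) Mx).
Qed.

Lemma integrable_mul_test f phi : loc_integrable f -> test_function phi ->
  integrable_on setT (fun x => f x * phi x).
Proof.
move=> lf tp; have [M [K [M0 K0 hK]]] := test_bounded tp.
apply: (@integrable_setT_le _ (fun x => K * (\1_(`[- M, M]) x * `|f x|))).
- by apply: measurable_funM; [exact: loc_integrableM|exact: test_measurable].
- apply: integrable_onZ => //; apply: (proj1 (integrable_on_restrict _ (measurable_itv _))).
  exact: integrable_on_norm.
- by move=> x; rewrite normrM mulrC mulrA; apply: ler_wpM2r.
Qed.

Lemma test_L2 phi : test_function phi -> L2 phi.
Proof.
move=> tp; split; first exact: test_measurable.
rewrite (_ : (fun x => _) = fun x => phi x * phi x); last by apply/funext => x; rewrite expr2.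
by apply: integrable_mul_test => //; apply: continuous_loc; exact: test_continuous.
Qed.

Lemma test_integrable phi : test_function phi -> integrable_on setT phi.
Proof.
move=> tp; rewrite (_ : phi = fun x => 1 * phi x); last by apply/funext => x; rewrite mul1r.
by apply: integrable_mul_test => //; apply: continuous_loc; exact: cst_continuous.
Qed.

Lemma testD phi psi : test_function phi -> test_function psi ->
  test_function (fun x => phi x + psi x).
Proof.
move=> /test_functionP[C1 [M1 h1]] /test_functionP[C2 [M2 h2]]; apply/test_functionP.
split; first by move=> n; exact: CnD.
exists (Num.max M1 M2) => x; rewrite gt_max => /andP[? ?].
by rewrite h1// h2// addr0.
Qed.

Lemma testZ k phi : test_function phi -> test_function (fun x => k * phi x).
Proof.
move=> /test_functionP[C1 [M1 h1]]; apply/test_functionP.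
split; first by move=> n; exact: CnZ.
by exists M1 => x /h1 ->; rewrite mulr0.
Qed.

Lemma test_bump a b k : test_function (bump a b k).
Proof.
apply/test_functionP; split; first by move=> n; exact: Cn_bump.
exists (`|a| + `|b|) => x; have [x0|x0] := leP 0 x; [rewrite (ger0_norm x0)|rewrite (ltr0_norm x0)] => xM; apply: bump_out.
  by right; have := ler_norm b; have := normr_ge0 a; lra.
by left; have := ler_norm (- a); rewrite normrN; have := normr_ge0 b; lra.
Qed.

Lemma indic_itvoo_cc f a b : loc_integrable f ->
  \int[mu]_x (\1_(`]a, b[) x * f x) = \int[mu]_(x in `[a, b]) f x.
Proof.
move=> lf; have iab : integrable_on `[a, b] f by exact: lf.
rewrite -(Rintegral_indic `]a, b[) Rintegral_itv_obnd_cbnd; last first.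
  by apply: integrable_onS iab => //; exact: subset_itv_oo_cc.
rewrite Rintegral_itv_bndo_bndc//.
by apply: integrable_onS iab => //; exact: subset_itv_co_cc.
Qed.

(** Bumps tending to the indicator of ]a, b[ show that all interval integrals of [g] vanish. At a
    Lebesgue point, [g] is the derivative of such an integral in its upper end. *)
Lemma fundamental_lemma g : loc_integrable g ->
  (forall phi, test_function phi -> \int[mu]_x (g x * phi x) = 0) ->
  {ae mu, forall x, g x = 0}.
Proof.
move=> lg h.
have g0 a b : \int[mu]_(x in `[a, b]) g x = 0.
  rewrite -indic_itvoo_cc//.
  have := @dominated_Rintegral R setT (fun n x => g x * bump a b n%:R x)
    (fun x => \1_(`]a, b[) x * g x) (fun x => \1_(`[a, b]) x * `|g x|).
  case=> //.
  - by move=> n; apply: measurable_funM; [exact: loc_integrableM|apply: test_measurable; exact: test_bump].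
  - by move=> x _; rewrite mulrC; apply: cvgM; [exact: cvg_cst|exact: cvg_bump].
  - apply: (proj1 (integrable_on_restrict _ (measurable_itv _))); exact: integrable_on_norm.
  - move=> n x _; rewrite normrM mulrC ler_wpM2r// indicE mem_setE in_itv/=.
    have [xa|ax] := leP x a; first by rewrite bump_out ?normr0; [case: (_ && _)|left].
    have [bx|xb] := leP b x; first by rewrite bump_out ?normr0; [case: (_ && _)|right].
    rewrite (ltW ax) (ltW xb)/= ger0_norm; by have /andP[] := @bump_bound R a b n%:R x (ler0n _ _).
  move=> _; rewrite (_ : (fun n => _) = fun=> 0) => [hcv|].
    by apply/esym; exact: (cvg_unique (@Rhausdorff R) (cvg_cst 0) hcv).
  by apply/funext => n; rewrite h//; exact: test_bump.
have /lebesgue_differentiation := proj1 (loc_integrableP _) lg.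
apply: ae_imp => x hx.
have [] := @FTC1_lebesgue_pt R g (BLeft (x - 1)) x (x + 1) _ _ _ hx.
- lra.
- exact: lg.
- by rewrite lte_fin; lra.
move=> _ <-; rewrite derive1E (_ : (fun y => _) = cst 0); last by apply/funext => y; exact: g0.
exact: derive_cst.
Qed.

(** Stable under linear combinations and dominated limits, so that density climbs from open
    intervals to bounded Borel sets, simple functions and nonnegative functions. *)
Definition test_approx f := L2 f /\
  forall e : R, 0 < e -> exists2 phi, test_function phi & nsq (fun x => f x - phi x) < e.

Lemma test_approx_test phi : test_function phi -> test_approx phi.
Proof.
move=> tp; split; first exact: test_L2.
move=> e e0; exists phi => //; rewrite (_ : nsq _ = 0)//.
by rewrite -[RHS](@Rintegral_set0 _ _ _ mu (fun=> 0)) Rintegral_indic; apply: eq_Rintegral => x _; rewrite subrr expr0n mulr0.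
Qed.

Lemma test_approxD f g : test_approx f -> test_approx g -> test_approx (fun x => f x + g x).
Proof.
move=> [Lf af] [Lg ag]; split; first exact: L2D.
move=> e e0; have e4 : 0 < e / 4 by lra.
have [p tp hp] := af _ e4; have [q tq hq] := ag _ e4.
exists (fun x => p x + q x); first exact: testD.
rewrite (_ : (fun x => _) = (fun x => (f x - p x) + (g x - q x))); last first.
  by apply/funext => x; ring.
apply: (@le_lt_trans _ _ (2 * nsq (fun x => f x - p x) + 2 * nsq (fun x => g x - q x))).
  by apply: nsqD; apply: L2B => //; exact: test_L2.
lra.
Qed.

Lemma test_approxZ k f : test_approx f -> test_approx (fun x => k * f x).
Proof.
move=> [Lf af]; split; first exact: L2Z.
move=> e e0; have k0 : 0 < k ^+ 2 + 1 by rewrite ltr_wpDl ?sqr_ge0.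
have ek : 0 < e / (k ^+ 2 + 1) by exact: divr_gt0.
have [p tp hp] := af _ ek; exists (fun x => k * p x); first exact: testZ.
rewrite (_ : (fun x => _) = (fun x => k * (f x - p x))); last first.
  by apply/funext => x; ring.
rewrite nsqZ; last by apply: L2B => //; exact: test_L2.
rewrite ltr_pdivlMr// in hp; apply: le_lt_trans hp.
by rewrite mulrC ler_wpM2l ?nsq_ge0// lerDl.
Qed.

Lemma test_approx_lim (u : nat -> R -> R) f : (forall n, test_approx (u n)) -> L2 f ->
  nsq (fun x => u n x - f x) @[n --> \oo] --> 0 -> test_approx f.
Proof.
move=> au Lf cu; split => // e e0; have e4 : 0 < e / 4 by lra.
have /cvgrPdist_lt/(_ _ e4)[N _ /(_ N (leqnn _))] := cu.
rewrite /= sub0r normrN ger0_norm ?nsq_ge0// => hN.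
have [LN /(_ _ e4)[p tp hp]] := au N; exists p => //.
rewrite (_ : (fun x => _) = (fun x => (u N x - p x) - (u N x - f x))); last first.
  by apply/funext => x; ring.
apply: (@le_lt_trans _ _ (2 * nsq (fun x => u N x - p x) + 2 * nsq (fun x => u N x - f x))).
  by apply: nsqB; apply: L2B => //; exact: test_L2.
lra.
Qed.

Lemma test_approx_dom (u : nat -> R -> R) f g : (forall n, test_approx (u n)) ->
  measurable_fun setT f -> L2 g ->
  (forall x, u n x @[n --> \oo] --> f x) ->
  (forall n x, `|u n x| <= `|g x|) -> test_approx f.
Proof.
move=> au mf Lg uf ug.
have fg x : `|f x| <= `|g x|.
  have h : `|u n x| @[n --> \oo] --> `|f x| by exact: cvg_norm.
  rewrite -(cvg_lim _ h)//; apply: limr_le; first by apply/cvg_ex; exists `|f x|.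
  by near=> n.
have Lf : L2 f by apply: L2_le fg.
apply: (test_approx_lim au Lf); apply: (@dominated_nsq _ u f (fun x => 2 * g x)) => //.
- by move=> n; have [[]] := au n.
- exact: L2Z.
- move=> n x; rewrite normrM ger0_norm// (le_trans (ler_normB _ _))//.
  by have := ug n x; have := fg x; lra.
Unshelve. all: by end_near. Qed.

Lemma L2_indic_itv a b : L2 (\1_(`[a, b])).
Proof.
split; first exact: measurable_indic.
rewrite (_ : (fun x => _) = (fun x => \1_(`[a, b]) x * 1)); last first.
  by apply/funext => x; rewrite indicE mulr1; case: (_ \in _); rewrite /= ?expr1n ?expr0n.
apply: (proj1 (integrable_on_restrict _ (measurable_itv _))).
by apply: integrable_on_continuous; exact: cst_continuous.
Qed.

Lemma test_approx_itvoo a b : test_approx (\1_(`]a, b[)).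
Proof.
apply: (@test_approx_dom (fun n => bump a b n%:R) _ (\1_(`[a, b]))).
- by move=> n; apply: test_approx_test; exact: test_bump.
- exact: measurable_indic.
- exact: L2_indic_itv.
- by move=> x; exact: cvg_bump.
- move=> n x; have /andP[h0 h1] := @bump_bound R a b n%:R x (ler0n _ _).
  rewrite ger0_norm// indicE mem_setE in_itv/=.
  have [xa|ax] := leP x a; first by rewrite bump_out//; left.
  have [bx|xb] := leP b x; first by rewrite bump_out//; right.
  by rewrite (ltW ax) (ltW xb)/= normr1.
Qed.

Lemma test_approx_itvoc a b : test_approx (\1_(`]a, b])).
Proof.
apply: (@test_approx_dom (fun n => \1_(`]a, b + n.+1%:R^-1[)) _ (\1_(`[a, b + 1]))).
- by move=> n; exact: test_approx_itvoo.
- exact: measurable_indic.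
- exact: L2_indic_itv.
- move=> x; have [xb|bx] := leP x b.
    apply: cvg_near_cst; near=> n; rewrite !indicE !mem_setE !in_itv/= xb.
    by rewrite (le_lt_trans xb)// ltrDl invr_gt0.
  have h : 0 < x - b by rewrite subr_gt0.
  apply: cvg_near_cst; near=> n; rewrite !indicE !mem_setE !in_itv/= (leNgt x b) bx/=.
  rewrite (_ : x < _ = false)//; apply/negbTE; rewrite -leNgt -lerBrDl.
  by apply: ltW; near: n; exact: (near_infty_natSinv_lt (PosNum h)).
- move=> n x; rewrite !indicE !mem_setE !in_itv/=.
  have [xa|ax] := leP x a; first by rewrite normr0.
  have [xb|xb] := ltP x (b + n.+1%:R^-1); last by rewrite normr0.
  rewrite (ltW ax) (_ : x <= b + 1)//=; apply: le_trans (ltW xb) _.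
  by rewrite lerD2l invf_le1 ?ler1n.
Unshelve. all: by end_near. Qed.

(** For a fixed window the sets with this property form a lambda-system containing the half-open
    intervals, which are stable under intersection. The window supplies a dominating function for
    increasing unions. *)
Lemma test_approx_indic (A : set R) c : measurable A -> test_approx (\1_(A `&` `]- c, c])).
Proof.
move=> mA.
pose H := [set A : set R | measurable A /\ test_approx (\1_(A `&` `]- c, c]))].
suff : (R.-ocitv.-measurable).-sigma.-measurable `<=` H by move=> /(_ _ mA)[].
have dom (B : set R) x : `|\1_(B `&` `]- c, c]) x| <= `|\1_(`[- c, c]) x| :> R.
  rewrite !indicE in_setI !mem_setE !in_itv/=.
  case: (_ \in _); rewrite /= ?normr0//; have [h1|h1] := ltP (- c) x; rewrite /= ?normr0//.
  by rewrite (ltW h1).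
apply: lambda_system_subset => //.
- exact: ocitvI.
- split => //.
  + by split => //; rewrite setTI; exact: test_approx_itvoc.
  + move=> A1 A2 A21 [mA1 h1] [mA2 h2]; split; first exact: measurableD.
    rewrite (_ : \1_ _ = (fun x => \1_(A1 `&` `]- c, c]) x + (-1) * \1_(A2 `&` `]- c, c]) x)).
      by apply: test_approxD => //; exact: test_approxZ.
    apply/funext => x; rewrite !indicE.
    have E1 : (x \in (A1 `\` A2) `&` `]- c, c]) = [&& x \in A1, x \notin A2 & x \in `]- c, c]%classic].
      apply/idP/idP => [/set_mem[[a1 a2] i]|/and3P[/set_mem a1 /negP a2 /set_mem i]].
        by rewrite (mem_set a1) (mem_set i) (memNset a2).
      by rewrite mem_set//; split => //; split => // /mem_set.
    have E2 (B : set R) : (x \in B `&` `]- c, c]) = (x \in B) && (x \in `]- c, c]%classic).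
      exact: in_setI.
    rewrite E1 !E2; have [a2|a2] := boolP (x \in A2); rewrite /= ?andbF/=.
      by rewrite (mem_set (A21 _ (set_mem a2)))/= mulN1r subrr.
    by rewrite mulr0 addr0.
  + move=> F ndF HF; split; first by apply: bigcup_measurable => k _; case: (HF k).
    apply: (@test_approx_dom (fun n => \1_(F n `&` `]- c, c])) _ (\1_(`[- c, c]))).
    * by move=> n; case: (HF n).
    * apply: measurable_indic; apply: measurableI => //.
      by apply: bigcup_measurable => k _; case: (HF k).
    * exact: L2_indic_itv.
    * move=> x; have [[k _ Fk]|nF] := pselect ((\bigcup_n F n) x).
        apply: cvg_near_cst; exists k => // n /= kn.
        rewrite !indicE !in_setI (_ : (x \in F n) = (x \in \bigcup_n F n))//.
        by rewrite !mem_set//; [exists k|exact: (subsetPset _ _ (ndF _ _ kn))].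
      apply: cvg_near_cst; near=> n.
      rewrite !indicE !in_setI (_ : (x \in F n) = (x \in \bigcup_n F n))//.
      by rewrite !memNset// => Fn; apply: nF; exists n.
    * by move=> n x; exact: dom.
- move=> B oB; split; first exact: sub_sigma_algebra.
  case: oB => -[a b] _ <-.
  rewrite (_ : _ `&` _ = `](Num.max a (- c)), (Num.min b c)]%classic); first exact: test_approx_itvoc.
  apply/seteqP; split => x /=; rewrite !in_itv/= gt_max le_min.
    by move=> [/andP[-> ->] /andP[-> ->]].
  by move=> /andP[/andP[-> ->] /andP[-> ->]].
Unshelve. all: by end_near. Qed.

Lemma test_approx_sum (I : Type) (s : seq I) (F : I -> R -> R) :
  (forall i, test_approx (F i)) -> test_approx (fun x => \sum_(i <- s) F i x).
Proof.
move=> tF; elim: s => [|i s IH].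
  rewrite (_ : (fun x => _) = (fun x => 0 * \1_(`]0, 1[) x)); last first.
    by apply/funext => x; rewrite big_nil mul0r.
  by apply: test_approxZ; exact: test_approx_itvoo.
by under eq_fun do rewrite big_cons; exact: test_approxD.
Qed.

(** The simple approximations from below are cut to ]-n, n], because [test_approx_indic] only covers
    level sets inside a window; [f] itself dominates. *)
Lemma test_approx_ge0 f : L2 f -> (forall x, 0 <= f x) -> test_approx f.
Proof.
move=> Lf f0; have [mf f2] := Lf.
have mEf : measurable_fun setT (EFin \o f) by exact/measurable_EFinP.
pose u (n : nat) := nnsfun_approx measurableT mEf n.
have u0 n x : 0 <= u n x by [].
have uf n x : u n x <= f x.
  by rewrite -lee_fin /u nnsfun_approxE; apply: le_approx => // y _; rewrite lee_fin.
have cu x : u n x @[n --> \oo] --> f x.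
  have := @cvg_nnsfun_approx _ _ _ _ measurableT _ mEf (fun y _ => _) x I.
  case/(_ _)/fine_cvgP; first by move=> y; rewrite lee_fin.
  by [].
apply: (@test_approx_dom (fun n x => \1_(`]- n%:R, n%:R]) x * u n x) _ f) => //.
- move=> n.
  rewrite (_ : (fun x => _) = (fun x => \sum_(y <- finmap.enum_fset (fset_set (range (u n))))
      y * \1_((u n @^-1` [set y]) `&` `]- n%:R, n%:R]) x)); last first.
    apply/funext => x.
    have -> : u n x = \sum_(y <- finmap.enum_fset (fset_set (range (u n)))) y * \1_(u n @^-1` [set y]) x.
      by rewrite fimfunE fsbig_finite//.
    rewrite mulr_sumr.
    by apply: eq_bigr => y _; rewrite indicI mulrCA; congr (_ * _); rewrite mulrC.
  apply: test_approx_sum => y; apply: test_approxZ; apply: test_approx_indic.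
  exact: measurable_funPTI.
- move=> x; have [N Nx] : exists N : nat, `|x| < N%:R.
    by exists (Num.truncn `|x|).+1; rewrite truncnS_gt.
  apply: cvg_trans (cu x); apply: near_eq_cvg; exists N => // n /= Nn.
  have xn : `|x| < n%:R by rewrite (lt_le_trans Nx)// ler_nat.
  rewrite ltr_norml in xn; case/andP: xn => x1 x2.
  by rewrite indicE mem_set ?mul1r//= in_itv/= x1 ltW.
- move=> n x; rewrite normrM (ger0_norm (f0 x)) (ger0_norm (u0 n x)).
  have /andP[i0 i1] := @indic_le1 R `]- n%:R, n%:R] x.
  by rewrite ger0_norm//; apply: le_trans (uf n x); exact: ler_piMl.
Qed.

Lemma L2_test_approx f : L2 f -> test_approx f.
Proof.
move=> Lf; have [mf _] := Lf.
have Lp : L2 (fun x => Num.max (f x) 0).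
  apply: L2_le Lf _; first exact: measurable_maxr.
  by move=> x; have [h|h] := leP (f x) 0; rewrite ?normr0.
have Ln : L2 (fun x => Num.max (- f x) 0).
  apply: L2_le Lf _; first by apply: measurable_maxr => //; exact: measurable_funN.
  by move=> x; have [h|h] := leP (- f x) 0; rewrite ?normr0 ?normrN.
rewrite (_ : f = fun x => Num.max (f x) 0 + -1 * Num.max (- f x) 0); last first.
  apply/funext => x; have [h1|h1] := leP (f x) 0; have [h2|h2] := leP (- f x) 0; lra.
apply: test_approxD; first by apply: test_approx_ge0 => // x; rewrite le_max lexx orbT.
by apply: test_approxZ; apply: test_approx_ge0 => // x; rewrite le_max lexx orbT.
Qed.

Lemma L2_test_dense f e : L2 f -> 0 < e ->
  exists2 phi, test_function phi & nsq (fun x => f x - phi x) < e.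
Proof. by move=> /L2_test_approx[_]; apply. Qed.
End test_functions.

(** * Weak derivatives and Sobolev norms *)

Section weak_derivatives.
Context {R : realType}.
Notation mu := (@lebesgue_measure R).
Implicit Types (f g h phi : R -> R) (a b c k M x e : R).

Lemma eq_RintegralT g f : (forall x, f x = g x) -> \int[mu]_x f x = \int[mu]_x g x.
Proof. by move=> fg; apply: eq_Rintegral => x _; exact: fg. Qed.

Lemma primitive_is_derive F f : primitive_of F f -> continuous f ->
  forall x : R, is_derive x (1 : R) F (f x).
Proof.
move=> [lf Ff] cf x.
have [] := @continuous_FTC1_closed R f (x - 1) x (x + 1) _ (lf _ _) _ (cf x); [lra|lra|].
move=> dG Gx.
have dGx : is_derive x (1 : R) (fun y => \int[mu]_(t in `[x - 1, y]) f t) (f x).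
  by split; [exact: dG|rewrite -derive1E; exact: Gx].
have dFc : is_derive x (1 : R) (cst (F (x - 1)) + (fun y => \int[mu]_(t in `[x - 1, y]) f t)) (0 + f x).
  by apply: is_deriveD.
rewrite add0r in dFc; apply: near_eq_is_derive dFc.
have : \forall y \near x, x - 1 < y by apply: lt_nbhsr; lra.
by apply: filterS => y xy /=; rewrite !fctE -Ff; [lra|exact: ltW].
Qed.

Lemma primitive_test F g phi : primitive_of F g -> test_function phi ->
  \int[mu]_x (F x * derive1n 1 phi x) = - \int[mu]_x (g x * phi x).
Proof.
move=> pF tp; have td := test_derive tp.
have pp : primitive_of phi (derive1n 1 phi).
  by apply: primitive_of_derivable; [exact: test_continuous|exact: test_is_derive].
have lF := continuous_loc (primitive_of_continuous pF).
have i1 := integrable_mul_test (proj1 pF) tp.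
have i2 := integrable_mul_test lF td.
have := primitive_integral0 (primitive_mul pF pp) (integrable_mul_test lF tp) (integrable_onD measurableT i1 i2).
by rewrite RintegralD_on// addrC => /eqP; rewrite addr_eq0 => /eqP.
Qed.

(** The primitive based at -N, left of the support, is 0 on the left; on the right it equals the
    total integral, which is 0 as well. *)
Lemma test_primitive psi : test_function psi -> \int[mu]_x psi x = 0 ->
  exists2 phi, test_function phi & derive1n 1 phi = psi.
Proof.
move=> tp p0; have [Cp [M hM]] := proj1 (test_functionP psi) tp.
have cp := test_continuous tp; have lp := continuous_loc cp.
have [_ Fp] := sprim_primitive lp.
pose N := `|M| + 1; pose phi x := sprim psi x - sprim psi (- N).
have N0 : 0 < N by rewrite ltr_wpDl.
have MN : M < N by rewrite (le_lt_trans (ler_norm M))// ltrDl.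
have dphi x : is_derive x (1 : R) phi (psi x).
  rewrite -[X in is_derive _ _ _ X]subr0; apply: is_deriveB.
  exact: primitive_is_derive (sprim_primitive lp) cp x.
exists phi; last by rewrite derive1n1; exact: is_derive_derive1.
apply/test_functionP; split; first by case=> // n; exists psi.
exists N => x Nx; rewrite /phi; have [x0|x0] := leP 0 x.
  rewrite (ger0_norm x0) in Nx; rewrite Fp; last by lra.
  rewrite -[RHS]p0 Rintegral_indic; apply: eq_Rintegral => y _.
  rewrite indicE mem_setE in_itv/=.
  have [_|/negP h] := boolP (- N <= y <= x); rewrite /= ?mul1r// mul0r hM//.
  apply: (lt_trans MN); rewrite ltNge; apply/negP => yN; apply: h.
  by move: yN; rewrite ler_norml => /andP[-> yN]/=; lra.
rewrite (ltr0_norm x0) in Nx; rewrite -opprB Fp; last by lra.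
rewrite Rintegral_indic (@eq_RintegralT (fun=> 0 * 0)); first by rewrite Rintegral_cst// !mul0r oppr0.
move=> y; rewrite indicE mem_setE in_itv/=.
have [/andP[_ yN]|_] := boolP (x <= y <= _); rewrite /= ?mul0r//; rewrite hM ?mulr0//.
by rewrite ltr0_norm; lra.
Qed.

(** Normalise a bump: its integral is nonzero, as it is positive on ]0, 1[, a set of measure 1. *)
Lemma test_unit_mass : exists2 rho : R -> R, test_function rho & \int[mu]_x rho x = 1.
Proof.
pose b := bump 0 1 (1 : R) : R -> R.
have tb : test_function b by exact: test_bump.
have b0 x : 0 <= b x by have /andP[] := @bump_bound R 0 1 1 x ler01.
have key (y : R) : 0 < y -> y < 1 -> 0 < b y.
  move=> y0 y1; rewrite /b /bump subr_gt0 expR_lt1 nmulr_rlt0 ?oppr_lt0//.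
  by apply: mulr_gt0; apply: theta_gt0; lra.
have b1 : \int[mu]_x b x != 0.
  apply/eqP => /(Rintegral_eq0_ae (test_integrable tb) b0) [A [mA A0 hA]].
  have : (mu `]0%R, 1%R[ <= mu A)%E.
    apply: le_measure; rewrite ?inE//= => x; rewrite /= in_itv/= => /andP[x0 x1].
    by apply: hA => /=; apply/eqP; rewrite gt_eqF//; exact: key.
  by rewrite A0 lebesgue_measure_itv/= lte_fin ltr01 oppr0 adde0 lee_fin ler10.
exists (fun x => (\int[mu]_x b x)^-1 * b x); first exact: testZ.
by rewrite RintegralZ_on// ?mulVf//; exact: test_integrable.
Qed.

(** Take c to be the integral of h rho, with rho of unit mass. Any test function minus its mass
    times rho has zero integral, hence is a derivative and is annihilated by [h]; that is, h - c
    annihilates every test function. *)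
Lemma du_bois_reymond h : loc_integrable h ->
  (forall phi, test_function phi -> \int[mu]_x (h x * derive1n 1 phi x) = 0) ->
  exists c, {ae mu, forall x, h x = c}.
Proof.
move=> lh hp; have [rho tr r1] := test_unit_mass.
pose c := \int[mu]_x (h x * rho x); exists c.
suff : {ae mu, forall x, h x - c = 0} by apply: ae_imp => x /eqP; rewrite subr_eq0 => /eqP.
have lc : loc_integrable (fun=> c : R) by apply: continuous_loc; exact: cst_continuous.
apply: fundamental_lemma; first exact: loc_integrableB.
move=> eta te; pose psi x := eta x + (- \int[mu]_y eta y) * rho x.
have tpsi : test_function psi by apply: testD => //; exact: testZ.
have [] := test_primitive tpsi.
  rewrite RintegralD_on//; [|exact: test_integrable|exact/test_integrable/testZ].
  by rewrite RintegralZ_on// ?r1 ?mulr1 ?subrr//; exact: test_integrable.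
move=> phi tphi phiE; have := hp _ tphi; rewrite phiE.
rewrite (@eq_RintegralT (fun x => h x * eta x + (- \int[mu]_y eta y) * (h x * rho x))); last first.
  by move=> x; rewrite /psi; ring.
have ihe := integrable_mul_test lh te; have ihr := integrable_mul_test lh tr.
rewrite RintegralD_on//; last exact: integrable_onZ.
rewrite RintegralZ_on// -/c => h0.
rewrite (@eq_RintegralT (fun x => h x * eta x - c * eta x)); last by move=> x; ring.
rewrite RintegralB_on//; last by apply: integrable_onZ => //; exact: test_integrable.
rewrite RintegralZ_on//; last exact: test_integrable.
by rewrite -[RHS]h0; ring.
Qed.

Lemma primitive_of_ae F f g : measurable_fun setT g -> {ae mu, forall x, f x = g x} ->
  primitive_of F f -> primitive_of F g.
Proof.
move=> mg fg [lf Ff]; split; first exact: ae_loc_integrable fg lf.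
move=> a b ab; rewrite Ff//; apply: ae_Rintegral => //.
- by apply: measurable_funTS; exact: loc_integrableM.
- exact: measurable_funTS.
- by apply: ae_imp fg.
Qed.

(** The difference between [f] and a primitive of [g] has zero weak derivative, so it is constant by
    [du_bois_reymond]. *)
Lemma weak_derivative1_primitive f g : is_weak_derivative 1 f g ->
  exists2 F, primitive_of F g & {ae mu, forall x, f x = F x}.
Proof.
move=> [/loc_integrableP lf /loc_integrableP lg fg].
have pG := sprim_primitive lg; set G := sprim g in pG.
have lG := continuous_loc (primitive_of_continuous pG).
have [] := @du_bois_reymond (fun x => f x - G x).
- exact: loc_integrableB.
- move=> phi tp; have td := test_derive tp.
  rewrite (@eq_RintegralT (fun x => f x * derive1n 1 phi x - G x * derive1n 1 phi x)); last first.
    by move=> x; ring.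
  rewrite RintegralB_on//; [|exact: integrable_mul_test..].
  by rewrite fg// (primitive_test pG tp) expr1 mulN1r subrr.
move=> c hc; exists (fun x => G x + c).
  by split => // a b ab; rewrite -(proj2 pG)//; ring.
by apply: ae_imp hc => x <-; rewrite addrC subrK.
Qed.

Lemma weak_derivative_unique (k : nat) f g1 g2 : is_weak_derivative k f g1 ->
  is_weak_derivative k f g2 -> {ae mu, forall x, g1 x = g2 x}.
Proof.
move=> [_ /loc_integrableP l1 h1] [_ /loc_integrableP l2 h2].
suff : {ae mu, forall x, g1 x - g2 x = 0} by apply: ae_imp => x /eqP; rewrite subr_eq0 => /eqP.
apply: fundamental_lemma; first exact: loc_integrableB.
move=> phi tp.
rewrite (@eq_RintegralT (fun x => g1 x * phi x - g2 x * phi x)); last by move=> x; ring.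
rewrite RintegralB_on//; [|exact: integrable_mul_test..].
have := h1 _ tp; rewrite (h2 _ tp) => /(congr1 (fun y => (-1) ^+ k * y)).
by rewrite !mulrA -expr2 sqrr_sign !mul1r => ->; rewrite subrr.
Qed.

End weak_derivatives.

(** * Sobolev spaces through chains of representatives *)

Section sobolev.
Context {R : realType}.
Notation mu := (@lebesgue_measure R).
Implicit Types (f g h phi : R -> R) (a b c k M x e : R) (F G : nat -> R -> R).

Lemma LfunP2 f : f \in Lfun mu 2%:E <-> L2 f.
Proof.
split=> [f2|[mf f2]].
  by split; [move: f2; rewrite inE => /andP[/[!inE]]|exact: Lfun2_integrable_sqr].
rewrite inE; apply/andP; rewrite !inE; split => //=.
rewrite /finite_norm unlock poweR_lty//.
under eq_integral do rewrite /= powR_mulrn// -normrX ger0_norm ?sqr_ge0//.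
exact: integrable_lty.
Qed.

Lemma Lnorm2_sqr f : L2 f -> ('N[mu]_2%:E[EFin \o f] ^+ 2 = (nsq f)%:E)%E.
Proof.
move=> /[dup] Lf /LfunP2; rewrite inE => /andP[_ /[!inE]/= fN].
have Nfin : 'N[mu]_2%:E[EFin \o f]%E \is a fin_num.
  by rewrite ge0_fin_numE// Lnorm_ge0.
have N0 : 0 <= fine ('N[mu]_2%:E[EFin \o f])%E by apply: fine_ge0; exact: Lnorm_ge0.
have n2 : (2 : R) != 0 by rewrite pnatr_eq0.
have := poweR_Lnorm mu (EFin \o f) n2.
rewrite -(fineK Nfin); set r := fine _ => h.
rewrite -[LHS]/(r%:E * r%:E)%E -EFinM -expr2 -powR_mulrn// -poweR_EFin h.
have [mf f2] := Lf; rewrite fineK; last exact: integrable_fin_num.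
apply: eq_integral => x _ /=; rewrite powR_mulrn//.
by rewrite real_normK ?num_real.
Qed.

(* [F j] is a representative of the [j]-th derivative of [F 0], absolutely
   continuous for [j < n]. *)
Definition sobolev_chain (n : nat) F :=
  (forall j, (j < n)%N -> primitive_of (F j) (F j.+1)) /\ (forall j, (j <= n)%N -> L2 (F j)).

Lemma signK (m : nat) a : (-1) ^+ m * ((-1) ^+ m * a) = a.
Proof. by rewrite mulrA -expr2 sqrr_sign mul1r. Qed.

Lemma sign_swap (m : nat) a b : (-1) ^+ m.+1 * a = (-1) ^+ m * b -> b = - a.
Proof. by rewrite exprS mulN1r mulNr => h; rewrite -(signK m b) -h mulrN signK. Qed.

(** The definition gives each weak derivative of [f] separately. Testing against phi' shows that the
    one of order j + 1 is the weak derivative of the one of order j, which therefore has an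
    absolutely continuous representative. *)
Lemma in_sobolev_chain n f : in_sobolev n f ->
  exists2 F, sobolev_chain n F & {ae mu, forall x, f x = F 0%N x}.
Proof.
move=> [/LfunP2 Lf hf].
have {hf} [g hg] : exists g : nat -> R -> R, forall j, (1 <= j <= n)%N ->
    is_weak_derivative j f (g j) /\ L2 (g j).
  have /choice[g hg] : forall j, exists gj : R -> R, (1 <= j <= n)%N ->
      is_weak_derivative j f gj /\ L2 gj.
    move=> j; have [jn|jn] := boolP (1 <= j <= n)%N; last by exists (fun=> 0).
    by have [gj h1 /LfunP2 h2] := hf _ jn; exists gj.
  by exists g.
pose G j := if j is 0%N then f else g j.
have LG j : (j <= n)%N -> L2 (G j).
  by case: j => // j jn; case: (hg j.+1).
have wG j : (j < n)%N -> is_weak_derivative 1 (G j) (G j.+1).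
  case: j => [|j] jn; first by have [] := hg 1%N jn.
  have [[_ l1 h1] L1] := hg j.+1 (ltnW jn); have [[_ l2 h2] L2'] := hg j.+2 jn.
  split => // phi tp; have td := test_derive tp.
  have := h1 _ td; rewrite derive1n1 -derive1Sn h2// => /sign_swap h.
  by rewrite expr1 mulN1r -h.
have /choice[F hF] : forall j, exists Fj : R -> R,
    ((j < n)%N -> primitive_of Fj (G j.+1)) /\ ((j <= n)%N -> measurable_fun setT Fj /\ {ae mu, forall x, G j x = Fj x}).
  move=> j; have [jn|jn] := ltnP j n.
    have [Fj h1 h2] := weak_derivative1_primitive (wG _ jn); exists Fj; split => // _; split => //.
    by apply: continuous_measurable_fun; exact: primitive_of_continuous h1.
  (* The top derivative is only in L^2 and keeps its given representative. *)
  exists (G j); split => // jn2; split; last exact: ae_all.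
  by case: (LG _ jn2).
exists F; last by have [_ /(_ (leq0n _))[_]] := hF 0%N.
split=> j jn.
  have [/(_ jn) h1 _] := hF j; have [_ /(_ jn) [m2 h2]] := hF j.+1.
  exact: primitive_of_ae h1.
have [_ /(_ jn) [m1 h1]] := hF j; exact: L2_ae h1 (LG _ jn).
Qed.

Lemma ae_sym f g : {ae mu, forall x, f x = g x} -> {ae mu, forall x, g x = f x}.
Proof. by apply: ae_imp. Qed.

Lemma ae_trans f g h : {ae mu, forall x, f x = g x} -> {ae mu, forall x, g x = h x} ->
  {ae mu, forall x, f x = h x}.
Proof. by apply: ae_imp2 => x -> ->. Qed.

Lemma chain_weak_derivative n F f j : sobolev_chain n F -> measurable_fun setT f ->
  {ae mu, forall x, f x = F 0%N x} -> (j <= n)%N -> is_weak_derivative j f (F j).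
Proof.
move=> [pF LF] mf fF jn.
have l0 := L2_loc (LF 0%N (leq0n _)).
have lf : loc_integrable f by apply: ae_loc_integrable l0 => //; exact: ae_sym.
split; [exact/loc_integrableP|exact/loc_integrableP/L2_loc/LF|move=> phi tp].
have tj := test_deriven j tp.
rewrite (@ae_Rintegral _ _ _ (fun x => F 0%N x * derive1n j phi x))//; last first.
- by apply: ae_imp fF => x -> .
- by apply: measurable_funM; [exact: loc_integrableM|exact: test_measurable].
- by apply: measurable_funM => //; exact: test_measurable.
elim: j jn phi tp {tj} => [|j IH] jn phi tp; first by rewrite derive1n0 expr0 mul1r.
rewrite derive1Sn -derive1n1 IH//; [|exact: ltnW|exact: test_derive].
by rewrite (primitive_test (pF _ jn) tp) exprS mulrN mulN1r mulNr.
Qed.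

Lemma chain_in_sobolev n F f : sobolev_chain n F -> measurable_fun setT f ->
  {ae mu, forall x, f x = F 0%N x} -> in_sobolev n f.
Proof.
move=> cF mf fF; have [_ LF] := cF; split.
  by apply/LfunP2; apply: L2_ae (LF 0%N _) => //; exact: ae_sym.
move=> j /andP[_ jn]; exists (F j); first exact: chain_weak_derivative cF mf fF jn.
exact/LfunP2/LF.
Qed.

Lemma weak_derivativeE (k : nat) f g : is_weak_derivative k f g ->
  is_weak_derivative k f (weak_derivative k f) /\
  {ae mu, forall x, weak_derivative k f x = g x}.
Proof.
move=> fg; have h : is_weak_derivative k f (weak_derivative k f).
  exact: xgetI fg.
by split => //; exact: weak_derivative_unique h fg.
Qed.

Lemma chain_weak_derivativeE n F f j : sobolev_chain n F -> measurable_fun setT f ->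
  {ae mu, forall x, f x = F 0%N x} -> (j <= n)%N ->
  L2 (weak_derivative j f) /\ {ae mu, forall x, weak_derivative j f x = F j x}.
Proof.
move=> cF mf fF jn; have [w1 w2] := weak_derivativeE (chain_weak_derivative cF mf fF jn).
split => //; apply: L2_ae (proj2 cF _ jn); last exact: ae_sym.
by have [_ /loc_integrableP/loc_integrableM] := w1.
Qed.

Lemma sobolev_normE n F f : sobolev_chain n F -> measurable_fun setT f ->
  {ae mu, forall x, f x = F 0%N x} ->
  sobolev_norm n f = (Num.sqrt (\sum_(j < n.+1) nsq (F j)))%:E.
Proof.
move=> cF mf fF; rewrite /sobolev_norm.
rewrite (eq_bigr (fun j : 'I_n.+1 => (nsq (F j))%:E)); last first.
  move=> j _; have [L1 w1] := chain_weak_derivativeE cF mf fF (ltn_ord j).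
  rewrite Lnorm2_sqr//; congr EFin; apply: nsq_ae w1; first by case: L1.
  by case: (proj2 cF _ (ltn_ord j)).
by rewrite sumEFin /= -powR12_sqrt// sumr_ge0// => j _; exact: nsq_ge0.
Qed.

Lemma cvg_sum0 (T : Type) (A : set_system T) {FA : Filter A} (n : nat) (u : nat -> T -> R) :
  (forall j, (j < n)%N -> u j s @[s --> A] --> 0) -> \sum_(j < n) u j s @[s --> A] --> 0.
Proof.
elim: n => [|n IH] hu.
  by under eq_fun do rewrite big_ord0; exact: cvg_cst.
rewrite (_ : (fun s => _) = (fun s => \sum_(j < n) u j s + u n s)); last first.
  by apply/funext => s; rewrite big_ord_recr.
have h1 : \sum_(j < n) u j s @[s --> A] --> 0.
  by apply: IH => j jn; apply: hu; exact: ltnW.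
have := cvgD h1 (hu n (ltnSn n)); rewrite addr0; exact.
Qed.

(** Reduces convergence in H^n to that of the squared L^2 norm of each derivative. The chains are
    required only eventually in s, because nothing is known of a solution outside its time
    interval. *)
Lemma cvg_sobolev_norm (T : Type) (A : set_system T) {FA : Filter A} (n : nat)
    (F : T -> nat -> R -> R) (f : T -> R -> R) :
  (\forall s \near A, [/\ sobolev_chain n (F s), measurable_fun setT (f s) &
     {ae mu, forall x, f s x = F s 0%N x}]) ->
  sobolev_norm n (f s) @[s --> A] --> 0%E <->
  forall j, (j <= n)%N -> nsq (F s j) @[s --> A] --> 0.
Proof.
move=> h.
have E : \forall s \near A, sobolev_norm n (f s) = (Num.sqrt (\sum_(j < n.+1) nsq (F s j)))%:E.
  by apply: filterS h => s [*]; exact: sobolev_normE.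
have -> : sobolev_norm n (f s) @[s --> A] --> 0%E <->
    (Num.sqrt (\sum_(j < n.+1) nsq (F s j)))%:E @[s --> A] --> 0%E.
  split=> hh; apply: cvg_trans hh; apply: near_eq_cvg => //.
  by apply: filterS E => s ->.
have S0 s : 0 <= \sum_(j < n.+1) nsq (F s j) by apply: sumr_ge0 => j _; exact: nsq_ge0.
split=> [hh j jn|hh].
  have {}hh : Num.sqrt (\sum_(j < n.+1) nsq (F s j)) @[s --> A] --> 0.
    by move/fine_cvgP : hh => [_].
  have h2 : \sum_(j < n.+1) nsq (F s j) @[s --> A] --> 0.
    have E2 : (fun s => \sum_(j < n.+1) nsq (F s j)) =
        (fun s => Num.sqrt (\sum_(j < n.+1) nsq (F s j)) ^+ 2).
      by apply/funext => s; rewrite sqr_sqrtr.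
    rewrite E2 -[X in _ --> X](expr0n R 2); under eq_fun do rewrite expr2.
    by rewrite expr2; exact: cvgM.
  apply: (squeeze_cvgr _ (cvg_cst 0) h2); near=> s; rewrite nsq_ge0/=.
  rewrite (bigD1 (Ordinal (jn : (j < n.+1)%N)))//= lerDl; apply: sumr_ge0 => i _; exact: nsq_ge0.
apply: cvg_EFin; first exact: nearW.
have h0 : \sum_(j < n.+1) nsq (F s j) @[s --> A] --> 0.
  by apply: (@cvg_sum0 _ A FA n.+1 (fun j s => nsq (F s j))) => j; exact: hh.
have s0 : Num.sqrt x @[x --> (0 : R)] --> (0 : R).
  by have := @sqrt_continuous R 0; rewrite /continuous_at sqrtr0.
exact: (cvg_comp _ _ h0 s0).
Unshelve. all: by end_near. Qed.

Lemma chainD n F G : sobolev_chain n F -> sobolev_chain n G ->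
  sobolev_chain n (fun j x => F j x + G j x).
Proof.
move=> [pF LF] [pG LG]; split=> j jn; last by apply: L2D; [exact: LF|exact: LG].
have [l1 h1] := pF _ jn; have [l2 h2] := pG _ jn.
split; first exact: loc_integrableD.
by move=> a b ab; rewrite RintegralD_on// -h1// -h2//; ring.
Qed.

Lemma chainZ n k F : sobolev_chain n F -> sobolev_chain n (fun j x => k * F j x).
Proof.
move=> [pF LF]; split=> j jn; last by apply: L2Z; exact: LF.
have [l1 h1] := pF _ jn; split; first exact: loc_integrableZ.
by move=> a b ab; rewrite RintegralZ_on// -h1//; ring.
Qed.

Lemma chainB n F G : sobolev_chain n F -> sobolev_chain n G ->
  sobolev_chain n (fun j x => F j x - G j x).
Proof.
move=> cF cG; have := chainD cF (chainZ (-1) cG).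
by rewrite (_ : (fun j x => _) = (fun j x => F j x - G j x))//; apply/funext => j; apply/funext => x; rewrite mulN1r.
Qed.

End sobolev.

(** * Energy estimates and uniqueness *)

Section energy.
Context {R : realType}.
Notation mu := (@lebesgue_measure R).
Implicit Types (f g h F G : R -> R) (a b c k M x e : R).

Lemma sqr_bounds x M : 0 <= M -> x ^+ 2 <= M ^+ 2 -> `|x| <= M.
Proof.
move=> M0; rewrite -[X in X <= _ -> _]real_normK ?num_real// ler_pXn2r//.
Qed.

(** F(x)^2 - F(y)^2 is the integral of 2 F g over [y, x], and 2 F g <= F^2 + g^2; y is taken far to
    the left, where F^2 is small. *)
Lemma sobolev_sup F g x : primitive_of F g -> L2 F -> L2 g -> F x ^+ 2 <= nsq F + nsq g.
Proof.
move=> pF LF Lg; have pFF := primitive_mul pF pF.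
have [mF F2] := LF; have [mg g2] := Lg.
have iFg := L2_mul LF Lg.
apply/ler_addgt0Pl => e e0.
have [_ [y yx Fy]] := exists_small_itv x F2 e0.
rewrite ger0_norm ?sqr_ge0// in Fy.
have := proj2 pFF y x (ltW yx); rewrite -!expr2 => h.
have h2 : \int[mu]_(z in `[y, x]) (g z * F z + F z * g z) <= nsq F + nsq g.
  rewrite -RintegralD_on//.
  apply: (@le_trans _ _ (\int[mu]_(z in `[y, x]) (F z ^+ 2 + g z ^+ 2))).
    apply: le_Rintegral_on => //.
    - exact: (proj1 pFF).
    - by apply: integrable_onS (integrable_onD measurableT F2 g2).
    - move=> z _; rewrite -subr_ge0 (_ : _ - _ = (F z - g z) ^+ 2) ?sqr_ge0//; ring.
  apply: le_Rintegral_sub => //; first exact: integrable_onD.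
  by move=> z; rewrite addr_ge0 ?sqr_ge0.
rewrite -h in h2; lra.
Qed.

(** By parts, the pairing of W with W - W_xx is nsq W + nsq W_x. Cauchy-Schwarz bounds the square of
    this sum by the sum times the right-hand side. *)
Lemma elliptic_bound (W : nat -> R -> R) : sobolev_chain 2 W ->
  nsq (W 0%N) + nsq (W 1%N) <= nsq (fun x => W 0%N x - W 2%N x).
Proof.
move=> [pW LW]; have L0 := LW 0%N isT; have L1 := LW 1%N isT; have L2' := LW 2%N isT.
have p0 := pW 0%N isT; have p1 := pW 1%N isT.
have Ln := L2B L0 L2'.
have h : \int[mu]_x (W 0%N x * (W 0%N x - W 2%N x)) = nsq (W 0%N) + nsq (W 1%N).
  have := primitive_integral0 (primitive_mul p0 p1) (L2_mul L0 L1).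
  have i1 := L2_mul L1 L1; have i2 := L2_mul L0 L2'; have i3 := L2_mul L0 L0.
  move=> /(_ (integrable_onD measurableT i1 i2)); rewrite RintegralD_on// => h0.
  rewrite (@eq_RintegralT _ (fun x => W 0%N x * W 0%N x - W 0%N x * W 2%N x)); last by move=> x; ring.
  rewrite RintegralB_on// /nsq.
  rewrite (@eq_RintegralT _ (fun x => W 0%N x * W 0%N x) (fun x => W 0%N x ^+ 2)); last by move=> x; rewrite expr2.
  rewrite (@eq_RintegralT _ (fun x => W 1%N x * W 1%N x) (fun x => W 1%N x ^+ 2)); last by move=> x; rewrite expr2.
  lra.
have := cauchy_schwarz L0 Ln; rewrite h.
have a0 := nsq_ge0 (W 0%N); have b0 := nsq_ge0 (W 1%N); have c0 := nsq_ge0 (fun x => W 0%N x - W 2%N x).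
set a := nsq (W 0%N) in a0 *; set b := nsq (W 1%N) in b0 *; set c := nsq _ in c0 *.
have [ab0|ab0] := eqVneq (a + b) 0; first by rewrite ab0.
have ab : 0 < a + b by rewrite lt_def ab0 addr_ge0.
move=> hh; rewrite -(ler_pM2l ab) -expr2; apply: le_trans hh _.
by rewrite ler_wpM2r// lerDl.
Qed.

(** The derivative of v n^2 has zero integral. This moves the derivative off n, so that transport
    costs only the sup norm of v'. *)
Lemma transport_energy v v' n n' : primitive_of v v' -> L2 v -> L2 v' ->
  (exists M, forall x, `|v' x| <= M) ->
  primitive_of n n' -> L2 n -> L2 n' ->
  2 * \int[mu]_x (v x * n' x * n x) = - \int[mu]_x (v' x * n x ^+ 2).
Proof.
move=> pv Lv Lv' [M' vM'] pn Ln Ln'.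
have [M vM] : exists M, forall x, `|v x| <= M.
  exists (1 + (nsq v + nsq v')) => x; have := sobolev_sup x pv Lv Lv'.
  have := nsq_ge0 v; have := nsq_ge0 v' => h1 h2 h3.
  apply: sqr_bounds; first by rewrite !addr_ge0.
  apply: le_trans h3 _; set s := _ + _; have s0 : 0 <= s by rewrite addr_ge0.
  rewrite (_ : (1 + s) ^+ 2 = 1 + s + s + s ^+ 2); last by ring.
  by have := sqr_ge0 s; lra.
have mv := loc_integrableM (continuous_loc (primitive_of_continuous pv)).
have [mn n2] := Ln.
have nn := L2_mul Ln Ln; have nn' := L2_mul Ln Ln'; have n'n := L2_mul Ln' Ln.
have i1 : integrable_on setT (fun x => v' x * (n x * n x)).
  by apply: (@integrable_on_bounded _ _ M') => //; case: Lv'.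
have i2 : integrable_on setT (fun x => v x * (n' x * n x + n x * n' x)).
  by apply: (@integrable_on_bounded _ _ M) => //; exact: integrable_onD.
have i3 : integrable_on setT (fun x => v x * (n x * n x)).
  exact: (@integrable_on_bounded _ _ M).
have := primitive_integral0 (primitive_mul pv (primitive_mul pn pn)) i3 (integrable_onD measurableT i1 i2).
rewrite RintegralD_on// addrC => /eqP; rewrite addr_eq0 => /eqP h.
rewrite (@eq_RintegralT _ (fun x => v' x * (n x * n x)) (fun x => v' x * n x ^+ 2)); last by move=> x; rewrite expr2.
rewrite -h -RintegralZ_on//; first by apply: eq_RintegralT => x; ring.
rewrite (_ : (fun x => _) = (fun x => v x * (n' x * n x))); last by apply/funext => x; rewrite mulrA.
exact: (@integrable_on_bounded _ _ M).
Qed.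

(** * Passage to the limit in squared norms and pairings *)

Section convergence.
Context {T : Type} (A : set_system T) {FA : Filter A}.
Implicit Types (u w : T -> R -> R).

Lemma cvg_nsq0Z k u : (\forall s \near A, L2 (u s)) ->
  nsq (u s) @[s --> A] --> 0 -> nsq (fun x => k * u s x) @[s --> A] --> 0.
Proof.
move=> L hu; have h : k ^+ 2 * nsq (u s) @[s --> A] --> k ^+ 2 * (0 : R).
  by apply: cvgM => //; exact: cvg_cst.
rewrite mulr0 in h; apply: cvg_trans h; apply: near_eq_cvg.
by apply: filterS L => s L1; rewrite nsqZ.
Qed.

Lemma cvg_nsq0B u w : (\forall s \near A, L2 (u s) /\ L2 (w s)) ->
  nsq (u s) @[s --> A] --> 0 -> nsq (w s) @[s --> A] --> 0 ->
  nsq (fun x => u s x - w s x) @[s --> A] --> 0.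
Proof.
move=> L hu hw.
have h : 2 * nsq (u s) + 2 * nsq (w s) @[s --> A] --> 2 * 0 + 2 * (0 : R).
  by apply: cvgD; apply: cvgM => //; exact: cvg_cst.
rewrite !mulr0 addr0 in h; apply: (squeeze_cvgr _ (cvg_cst 0) h).
by apply: filterS L => s [L1 L2']; rewrite nsq_ge0/=; exact: nsqB.
Qed.

Lemma cvg_sqr0 (r : T -> R) : r s ^+ 2 @[s --> A] --> 0 -> r s @[s --> A] --> 0.
Proof.
move=> h; apply/cvgrPdist_le => e e0.
have e2 : 0 < e ^+ 2 by rewrite exprn_gt0.
move/cvgrPdist_le : h => /(_ _ e2); apply: filterS => s.
rewrite !sub0r !normrN => h; apply: sqr_bounds (ltW e0) _.
by rewrite -(ger0_norm (sqr_ge0 (r s))).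
Qed.

Lemma cvg_ip0 u w M : (\forall s \near A, [/\ L2 (u s), L2 (w s) & nsq (w s) <= M]) ->
  nsq (u s) @[s --> A] --> 0 -> \int[mu]_x (u s x * w s x) @[s --> A] --> 0.
Proof.
move=> L hu; apply: cvg_sqr0.
have h : nsq (u s) * M @[s --> A] --> 0 * M by apply: cvgM => //; exact: cvg_cst.
rewrite mul0r in h; apply: (squeeze_cvgr _ (cvg_cst 0) h).
apply: filterS L => s [L1 L2' hM]; rewrite sqr_ge0/=.
by apply: le_trans (cauchy_schwarz L1 L2') _; rewrite ler_wpM2l ?nsq_ge0.
Qed.

Lemma nsq_near_bound w g : (\forall s \near A, L2 (w s)) -> L2 g ->
  nsq (fun x => w s x - g x) @[s --> A] --> 0 ->
  \forall s \near A, nsq (w s) <= 2 + 2 * nsq g.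
Proof.
move=> L Lg /cvgrPdist_le/(_ 1 ltr01); apply: filterS2 L => s Lw.
rewrite sub0r normrN ger0_norm ?nsq_ge0// => h.
have := nsqD (L2B Lw Lg) Lg; rewrite (_ : (fun x => _ + _) = w s); first by lra.
by apply/funext => x; rewrite subrK.
Qed.

Lemma cvg_ip u w f g : (\forall s \near A, L2 (u s) /\ L2 (w s)) -> L2 f -> L2 g ->
  nsq (fun x => u s x - f x) @[s --> A] --> 0 ->
  nsq (fun x => w s x - g x) @[s --> A] --> 0 ->
  \int[mu]_x (u s x * w s x) @[s --> A] --> \int[mu]_x (f x * g x).
Proof.
move=> L Lf Lg hu hw.
have Lu : \forall s \near A, L2 (u s) by apply: filterS L => s [].
have Lw : \forall s \near A, L2 (w s) by apply: filterS L => s [].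
have h1 : \int[mu]_x ((u s x - f x) * w s x) @[s --> A] --> 0.
  apply: (@cvg_ip0 (fun s x => u s x - f x) w (2 + 2 * nsq g)) => //.
  have := nsq_near_bound Lw Lg hw; apply: filterS2 L => s [L1 L2'] h.
  by split => //; exact: L2B.
have h2 : \int[mu]_x ((w s x - g x) * f x) @[s --> A] --> 0.
  apply: (@cvg_ip0 (fun s x => w s x - g x) (fun=> f) (nsq f)) => //.
  by apply: filterS Lw => s L1; split => //; exact: L2B.
have h3 : \int[mu]_x ((u s x - f x) * w s x) + \int[mu]_x ((w s x - g x) * f x) + \int[mu]_x (f x * g x) @[s --> A] --> 0 + 0 + \int[mu]_x (f x * g x).
  by apply: cvgD; [exact: cvgD|exact: cvg_cst].
rewrite !add0r in h3; apply: cvg_trans h3; apply: near_eq_cvg.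
apply: filterS L => s [L1 L2'].
rewrite -!RintegralD_on//.
- by apply: eq_RintegralT => x; ring.
- by apply: integrable_onD => //; apply: L2_mul => //; exact: L2B.
- exact: L2_mul.
- by apply: L2_mul => //; exact: L2B.
- by apply: L2_mul => //; exact: L2B.
Qed.

Lemma cvg_nsq w g : (\forall s \near A, L2 (w s)) -> L2 g ->
  nsq (fun x => w s x - g x) @[s --> A] --> 0 -> nsq (w s) @[s --> A] --> nsq g.
Proof.
move=> L Lg hw; have := @cvg_ip w w g g _ Lg Lg hw hw.
rewrite (_ : \int[mu]_x (g x * g x) = nsq g); last by apply: eq_RintegralT => x; rewrite expr2.
rewrite (_ : (fun s => _) = (fun s => nsq (w s))).
  by apply; apply: filterS L.
by apply/funext => s; apply: eq_RintegralT => x; rewrite expr2.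
Qed.
End convergence.

Lemma gronwall0 (E dE : R -> R) (C t0 : R) : 0 < t0 -> (forall t : R, 0 <= E t) -> E 0 = 0 ->
  {within `[0, t0], continuous E} ->
  (forall t : R, 0 < t < t0 -> is_derive t (1 : R) E (dE t)) ->
  (forall t : R, 0 < t < t0 -> dE t <= C * E t) -> E t0 = 0.
Proof.
move=> t00 E0 E00 cE dEE dEC.
pose h (t : R) : R := expR ((- C) * t + 0) * E t.
have dexp (t : R) : is_derive t (1 : R) (fun s => expR ((- C) * s + 0)) (expR ((- C) * t + 0) * - C).
  by apply: is_derive_comp1; exact: is_derive_affine.
have dh (t : R) : t \in `]0, t0[ -> is_derive t (1 : R) h (expR ((- C) * t + 0) * dE t + E t * (expR ((- C) * t + 0) * - C)).
  rewrite in_itv/= => tI; exact: is_deriveM (dexp t) (dEE t tI).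
have ch : {within `[0, t0], continuous h}.
  have c1 : {within `[0, t0], continuous (fun s => expR ((- C) * s + 0))}.
    apply: continuous_subspaceT => y; apply/differentiable_continuous/derivable1_diffP.
    by case: (dexp y).
  by move=> t; exact: (continuousM (c1 t) (cE t)).
have [c] := MVT t00 dh ch; rewrite in_itv/= => cI.
rewrite /h E00 mulr0 !subr0 => hE.
have : expR (- C * t0 + 0) * E t0 <= 0.
  rewrite hE; apply: mulr_le0_ge0 (ltW t00).
  rewrite (_ : _ + _ = expR (- C * c + 0) * (dE c - C * E c)); last by ring.
  by apply: mulr_ge0_le0; rewrite ?expR_ge0// subr_le0 dEC.
rewrite pmulr_rle0 ?expR_gt0// => Et0.
by apply/eqP; rewrite eq_le Et0 E0.
Qed.
End energy.

(** * Solutions as chains, and their uniqueness *)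

Section solutions.
Context {R : realType}.
Notation mu := (@lebesgue_measure R).
Implicit Types (f g h : R -> R) (I : set R) (u v : R -> R -> R) (U V Ut Vt : R -> nat -> R -> R).

(** The equation of [is_solution] with explicit derivatives: [U t j] represents the j-th space
    derivative at time t, and Sobolev norms are split into squared L^2 norms. The initial value is
    left to the statements that use it. *)
Definition chain_solution I U Ut := [/\
  forall t, I t -> sobolev_chain 3 (U t) /\ sobolev_chain 2 (Ut t),
  forall t, I t -> forall j, (j <= 3)%N ->
    nsq (fun x => U s j x - U t j x) @[s --> within I (nbhs t)] --> 0,
  forall t, I t -> forall j, (j <= 2)%N ->
    nsq (fun x => (s - t)^-1 * (U s j x - U t j x) - Ut t j x) @[s --> within I t^'] --> 0 &
  forall t, I t -> {ae mu, forall x, Ut t 0%N x - Ut t 2%N x +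
    U t 0%N x * U t 1%N x - U t 0%N x * U t 3%N x = 0}].

(** With [sqr_bounds], F^2 <= s yields |F| <= 1 + s: cruder than a root, but polynomial in the
    squared norms. *)
Lemma le_sqr1D (x : R) : 0 <= x -> x <= (1 + x) ^+ 2.
Proof.
move=> x0; rewrite (_ : (1 + x) ^+ 2 = x + (1 + x + x ^+ 2)); last by ring.
by rewrite lerDl !addr_ge0// sqr_ge0.
Qed.

Lemma nsq0 : nsq (fun=> 0 : R) = 0.
Proof. by rewrite /nsq expr0n Rintegral_cst// mul0r. Qed.

Lemma near_withinI I (F : set_system R) {FF : Filter F} : \forall s \near within I F, I s.
Proof. by rewrite near_withinE; apply: filterE. Qed.

Lemma is_solution_chain I (u0 : R -> R) u : is_solution I u0 u ->
  exists U Ut, chain_solution I U Ut /\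
    forall t, I t -> {ae mu, forall x, u t x = U t 0%N x}.
Proof.
move=> [[u3 cu] [ut [[ut2 cut] dut eqn _]]].
have /choice[U hU] : forall t, exists Ut : nat -> R -> R, I t ->
    [/\ sobolev_chain 3 Ut, {ae mu, forall x, u t x = Ut 0%N x} & measurable_fun setT (u t)].
  move=> t; have [It|nIt] := pselect (I t); last by exists (fun _ _ => 0).
  have [F cF uF] := in_sobolev_chain (u3 _ It); exists F => _; split => //.
  by have [/LfunP2[]] := u3 _ It.
have /choice[Ut hUt] : forall t, exists Vt : nat -> R -> R, I t ->
    [/\ sobolev_chain 2 Vt, {ae mu, forall x, ut t x = Vt 0%N x} & measurable_fun setT (ut t)].
  move=> t; have [It|nIt] := pselect (I t); last by exists (fun _ _ => 0).
  have [F cF uF] := in_sobolev_chain (ut2 _ It); exists F => _; split => //.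
  by have [/LfunP2[]] := ut2 _ It.
exists U, Ut; split; last by move=> t /hU[].
split.
- by move=> t It; have [? _ _] := hU _ It; have [? _ _] := hUt _ It.
- move=> t It; have [c1 a1 m1] := hU _ It.
  apply: (proj1 (cvg_sobolev_norm (F := fun s j x => U s j x - U t j x) (f := fun s => u s \- u t) _)); last exact: cu.
  have NI : \forall s \near within I (nbhs t), I s by exact: near_withinI.
  move: NI; apply: filterS => s Is; have [c2 a2 m2] := hU _ Is; split.
  + exact: chainB.
  + exact: measurable_funB.
  + by apply: ae_imp2 a1 a2 => x /= -> ->.
- move=> t It; have [c1 a1 m1] := hU _ It; have [c3 a3 m3] := hUt _ It.
  apply: (proj1 (cvg_sobolev_norm (F := fun s j x => (s - t)^-1 * (U s j x - U t j x) - Ut t j x)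
    (f := fun s x => (u s x - u t x) / (s - t) - ut t x) _)); last exact: dut.
  have NI : \forall s \near within I t^', I s by exact: near_withinI.
  move: NI; apply: filterS => s Is; have [c2 a2 m2] := hU _ Is; split.
  + apply: chainB => //; apply: chainZ; have c4 := chainB c2 c1.
    by split=> j jn; [apply: (proj1 c4); exact: (leq_trans jn)|apply: (proj2 c4); exact: (leq_trans jn)].
  + by apply: measurable_funB => //; apply: measurable_funM => //; exact: measurable_funB.
  + have a4 : {ae mu, forall x, u s x - u t x = U s 0%N x - U t 0%N x}.
      by apply: ae_imp2 a1 a2 => x /= -> ->.
    by apply: ae_imp2 a3 a4 => x /= -> ->; rewrite mulrC.
- move=> t It; have [c1 a1 m1] := hU _ It; have [c3 a3 m3] := hUt _ It.
  have [_ w1] := chain_weak_derivativeE c1 m1 a1 (isT : (1 <= 3)%N).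
  have [_ w3] := chain_weak_derivativeE c1 m1 a1 (isT : (3 <= 3)%N).
  have [_ w2] := chain_weak_derivativeE c3 m3 a3 (isT : (2 <= 2)%N).
  have h1 : {ae mu, forall x, [/\ u t x = U t 0%N x, weak_derivative 1 (u t) x = U t 1%N x & weak_derivative 3 (u t) x = U t 3%N x]}.
    apply: (ae_imp2 _ a1 (ae_imp2 (fun x a b => conj a b) w1 w3)) => x -> [-> ->]; by split.
  have h2 : {ae mu, forall x, ut t x = Ut t 0%N x /\ weak_derivative 2 (ut t) x = Ut t 2%N x}.
    by apply: (ae_imp2 _ a3 w2) => x -> ->.
  apply: (ae_imp2 _ (eqn _ It) (ae_imp2 (fun x a b => conj a b) h1 h2)) => x.
  by move=> + [[e1 e2 e3] [e4 e5]]; rewrite e1 e2 e3 e4 e5.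
Qed.

Lemma cvg_dnbhs_shift (f : R -> R) (t l : R) : f s @[s --> t^'] --> l ->
  f (h + t) @[h --> 0^'] --> l.
Proof.
move=> fl; suff hs : h + t @[h --> 0^'] --> t^' by move=> P /fl /hs.
move=> P; change (nbhs t [set s | s != t -> P s] -> nbhs (0 : R) [set h | h != 0 -> P (h + t)]) => hP.
have h0 : h + t @[h --> (0 : R)] --> t.
  by rewrite -[X in _ --> X]add0r; apply: cvgD => //; exact: cvg_cst.
have h1 : \forall h \near (0 : R), h + t != t -> P (h + t) := h0 _ hP.
apply: filterS h1 => h /= hPt h00; apply: hPt.
by rewrite -subr_eq0 addrK.
Qed.

Lemma chain_zero n (W : nat -> R -> R) j : sobolev_chain n W -> {ae mu, forall x, W 0%N x = 0} ->
  (j <= n)%N -> {ae mu, forall x, W j x = 0}.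
Proof.
move=> cW W0 jn; have mz : measurable_fun setT (fun _ : R => 0 : R) by [].
have cz : sobolev_chain n (fun _ _ => 0 : R).
  by have := chainZ 0 cW; rewrite (_ : (fun _ _ => _) = (fun _ _ => 0))//; apply/funext => i; apply/funext => x; rewrite mul0r.
have h1 := chain_weak_derivative cW mz (ae_sym W0) jn.
have h2 := chain_weak_derivative cz mz (ae_all (fun=> erefl)) jn.
exact: weak_derivative_unique h1 h2.
Qed.

(** [E] is the energy of the difference [n] of the momenta and [D] is its time derivative. The
    transport part of [D] is handled by [transport_energy], the rest by the sup norm of [W].
    Gronwall gives E = 0, and [elliptic_bound] then W = 0. *)
Lemma chain_solution_unique T U V Ut Vt : chain_solution `[0, T[ U Ut ->
  chain_solution `[0, T[ V Vt -> {ae mu, forall x, V 0 0%N x = U 0 0%N x} ->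
  forall t, 0 <= t < T -> {ae mu, forall x, V t 0%N x = U t 0%N x}.
Proof.
move=> [cU contU dU eU] [cV contV dV eV] UV0 t1 /andP[t10 t1T].
set I := `[0, T[%classic.
have It t : 0 <= t -> t <= t1 -> I t.
  by move=> t0 tt; rewrite /I /= in_itv/= t0 (le_lt_trans tt).
pose W t j x := V t j x - U t j x.
pose n t x := W t 0%N x - W t 2%N x.
pose n' t x := W t 1%N x - W t 3%N x.
pose D t x := (Vt t 0%N x - Ut t 0%N x) - (Vt t 2%N x - Ut t 2%N x).
pose E t := nsq (n t).
have cW t : I t -> sobolev_chain 3 (W t).
  by move=> tI; apply: chainB; [case: (cV _ tI)|case: (cU _ tI)].
have LU t j : I t -> (j <= 3)%N -> L2 (U t j) by move=> tI jn; have [[_ h] _] := cU _ tI; exact: h.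
have LV t j : I t -> (j <= 3)%N -> L2 (V t j) by move=> tI jn; have [[_ h] _] := cV _ tI; exact: h.
have LW t j : I t -> (j <= 3)%N -> L2 (W t j) by move=> tI jn; have [_ h] := cW _ tI; exact: h.
have Ln t : I t -> L2 (n t) by move=> tI; apply: L2B; exact: LW.
have Ln' t : I t -> L2 (n' t) by move=> tI; apply: L2B; exact: LW.
have LD t : I t -> L2 (D t).
  move=> tI; have [_ [_ L1]] := cU _ tI; have [_ [_ L2']] := cV _ tI.
  by apply: L2B; apply: L2B; first [exact: L1|exact: L2'].
have pn t : I t -> primitive_of (n t) (n' t).
  move=> tI; have [pW _] := cW _ tI; have [l1 h1] := pW 0%N isT; have [l2 h2] := pW 2%N isT.
  split; first exact: loc_integrableB.
  by move=> a b ab; rewrite RintegralB_on// -h1// -h2// /n; ring.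
have In t : I t -> \forall s \near within I (nbhs t), I s by move=> _; exact: near_withinI.
have In' t : I t -> \forall s \near within I t^', I s by move=> _; exact: near_withinI.
have contW t j : I t -> (j <= 3)%N ->
    nsq (fun x => W s j x - W t j x) @[s --> within I (nbhs t)] --> 0.
  move=> tI j3.
  rewrite (_ : (fun s => _) = (fun s => nsq (fun x => (V s j x - V t j x) - (U s j x - U t j x)))); last first.
    by apply/funext => s; congr nsq; apply/funext => x; rewrite /W; ring.
  apply: cvg_nsq0B; [|exact: contV|exact: contU].
  by apply: filterS (In _ tI) => s sI; split; apply: L2B; first [exact: LU|exact: LV].
have contn t : I t -> nsq (fun x => n s x - n t x) @[s --> within I (nbhs t)] --> 0.
  move=> tI.
  rewrite (_ : (fun s => _) = (fun s => nsq (fun x => (W s 0%N x - W t 0%N x) - (W s 2%N x - W t 2%N x)))); last first.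
    by apply/funext => s; congr nsq; apply/funext => x; rewrite /n; ring.
  apply: cvg_nsq0B; [|exact: contW|exact: contW].
  by apply: filterS (In _ tI) => s sI; split; apply: L2B; exact: LW.
have derW t j : I t -> (j <= 2)%N ->
    nsq (fun x => (s - t)^-1 * (W s j x - W t j x) - (Vt t j x - Ut t j x)) @[s --> within I t^'] --> 0.
  move=> tI j2.
  rewrite (_ : (fun s => _) = (fun s => nsq (fun x => ((s - t)^-1 * (V s j x - V t j x) - Vt t j x)
      - ((s - t)^-1 * (U s j x - U t j x) - Ut t j x)))); last first.
    by apply/funext => s; congr nsq; apply/funext => x; rewrite /W; ring.
  have j3 : (j <= 3)%N by exact: leq_trans j2 _.
  apply: cvg_nsq0B; [|exact: dV|exact: dU].
  have [_ [_ L1]] := cU _ tI; have [_ [_ L2']] := cV _ tI.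
  apply: filterS (In' _ tI) => s sI; split; apply: L2B; try (apply: L2Z; apply: L2B);
    by [exact: L1|exact: L2'|exact: LU|exact: LV].
have dern t : I t -> nsq (fun x => (s - t)^-1 * (n s x - n t x) - D t x) @[s --> within I t^'] --> 0.
  move=> tI.
  rewrite (_ : (fun s => _) = (fun s => nsq (fun x =>
      ((s - t)^-1 * (W s 0%N x - W t 0%N x) - (Vt t 0%N x - Ut t 0%N x))
      - ((s - t)^-1 * (W s 2%N x - W t 2%N x) - (Vt t 2%N x - Ut t 2%N x))))); last first.
    by apply/funext => s; congr nsq; apply/funext => x; rewrite /n /D; ring.
  apply: cvg_nsq0B; [|exact: derW|exact: derW].
  have [_ [_ L1]] := cU _ tI; have [_ [_ L2']] := cV _ tI.
  apply: filterS (In' _ tI) => s sI; split; apply: L2B; try (by apply: L2Z; apply: L2B; exact: LW);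
    by apply: L2B; first [exact: L1|exact: L2'].
have dE t : 0 < t < t1 -> is_derive t (1 : R) E (2 * \int[mu]_x (D t x * n t x)).
  move=> /andP[t0 tt1]; have tI : I t by apply: It; exact: ltW.
  have nI : \forall s \near t, I s.
    have : \forall s \near t, s \in `]0, T[.
      by apply: near_in_itvoo; rewrite in_itv/= t0 (lt_trans tt1).
    by apply: filterS => s; rewrite /I /= !in_itv/= => /andP[/ltW -> ->].
  (* At an interior time the restriction to [I] is invisible, and the limits are two-sided. *)
  have FE : within I t^' = t^'.
    have nI' : \forall s \near t^', I s by exact: cvg_within nI.
    apply/seteqP; split => P hP; last by move: hP; apply: filterS.
    by apply: filterS2 (hP : t^' [set s | I s -> P s]) nI' => s; apply.
  have FE2 : within I (nbhs t) = nbhs t.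
    apply/seteqP; split => P hP; last by move: hP; apply: filterS.
    by apply: filterS2 (hP : nbhs t [set s | I s -> P s]) nI => s; apply.
  have nI' : \forall s \near t^', I s by exact: cvg_within nI.
  (* As n(s)^2 - n(t)^2 factors, the difference quotient of the energy is a pairing of two families
     that converge in L^2. *)
  have h : \int[mu]_x (((s - t)^-1 * (n s x - n t x)) * (n s x + n t x)) @[s --> t^'] -->
      \int[mu]_x (D t x * (n t x + n t x)).
    apply: cvg_ip.
    - apply: filterS nI' => s sI; split; first by apply: L2Z; apply: L2B; exact: Ln.
      by apply: L2D; exact: Ln.
    - exact: LD.
    - by apply: L2D; exact: Ln.
    - by have := dern _ tI; rewrite FE.
    - have := contn _ tI; rewrite FE2.
      rewrite (_ : (fun s => _) = (fun s => nsq (fun x => n s x - n t x))).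
        by exact: cvg_within_filter.
      by apply/funext => s; congr nsq; apply/funext => x; ring.
  have dEh : h0^-1 *: (E (h0 *: 1 + t) - E t) @[h0 --> 0^'] --> \int[mu]_x (D t x * (n t x + n t x)).
    have h2 : (s - t)^-1 * (E s - E t) @[s --> t^'] --> \int[mu]_x (D t x * (n t x + n t x)).
      apply: cvg_trans h; apply: near_eq_cvg; apply: filterS nI' => s sI.
      rewrite /E /nsq -RintegralB_on//; [|by case: (Ln _ sI)|by case: (Ln _ tI)].
      rewrite -RintegralZ_on//; last by apply: integrable_onB => //; [case: (Ln _ sI)|case: (Ln _ tI)].
      by apply: eq_RintegralT => x; ring.
    have := cvg_dnbhs_shift h2; apply: cvg_trans; apply: near_eq_cvg.
    by apply: filterE => h0; rewrite addrK /GRing.scale/= mulr1.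
  have -> : 2 * \int[mu]_x (D t x * n t x) = \int[mu]_x (D t x * (n t x + n t x)).
    rewrite -RintegralZ_on//; last by apply: L2_mul; [exact: LD|exact: Ln].
    by apply: eq_RintegralT => x; ring.
  split; first by apply/cvg_ex; eexists; exact: dEh.
  by apply: cvg_lim => //; exact: dEh.
(* The first two terms control the sup norm of V_x, the last two the L^2 norm of U_x - U_xxx. *)
pose B t := nsq (V t 1%N) + nsq (V t 2%N) + nsq (U t 1%N) + nsq (U t 3%N).
have energy t : I t -> 2 * \int[mu]_x (D t x * n t x) <= (2 + 2 * B t) * E t.
  move=> tI.
  have [[pV LV'] _] := cV _ tI; have [[pU LU'] _] := cU _ tI; have [pW LW'] := cW _ tI.
  have [n1 n2 n3 n4] := And4 (nsq_ge0 (V t 1%N)) (nsq_ge0 (V t 2%N)) (nsq_ge0 (U t 1%N)) (nsq_ge0 (U t 3%N)).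
  have E0 : 0 <= E t := nsq_ge0 _.
  have supV1 x : `|V t 1%N x| <= 1 + (nsq (V t 1%N) + nsq (V t 2%N)).
    apply: sqr_bounds; first lra.
    apply: le_trans (sobolev_sup x (pV 1%N isT) (LV' 1%N isT) (LV' 2%N isT)) _.
    by apply: le_sqr1D; rewrite ?addr_ge0.
  have ell : nsq (W t 0%N) + nsq (W t 1%N) <= E t.
    apply: elliptic_bound; split=> j jn; [apply: pW|apply: LW'];
    by apply: leq_trans jn _.
  (* The embedding into bounded functions followed by [elliptic_bound]: this lets [W] multiply a
     factor that is only in L^2. *)
  have supW0 x : W t 0%N x ^+ 2 <= E t.
    exact: le_trans (sobolev_sup x (pW 0%N isT) (LW' 0%N isT) (LW' 1%N isT)) ell.
  pose g x := U t 1%N x - U t 3%N x.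
  have Lg : L2 g by apply: L2B; exact: LU.
  have gB : nsq g <= 2 * nsq (U t 1%N) + 2 * nsq (U t 3%N) by apply: nsqB; exact: LU.
  have Dae : {ae mu, forall x, D t x = - (V t 0%N x * n' t x) - W t 0%N x * g x}.
    by apply: (ae_imp2 _ (eU _ tI) (eV _ tI)) => x h1 h2; rewrite /D /n' /W /g; lra.
  have LWg : L2 (fun x => W t 0%N x * g x).
    apply: (@L2_bounded _ (1 + E t)) => //; first by case: (LW' 0%N isT).
    by move=> x; apply: sqr_bounds; [lra|apply: le_trans (supW0 x) _; exact: le_sqr1D].
  have LVn : L2 (fun x => V t 0%N x * n' t x).
    apply: (@L2_bounded _ (1 + (nsq (V t 0%N) + nsq (V t 1%N)))).
    - by case: (LV' 0%N isT).
    - move=> x; have n0 := nsq_ge0 (V t 0%N); apply: sqr_bounds; first lra.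
      apply: le_trans (sobolev_sup x (pV 0%N isT) (LV' 0%N isT) (LV' 1%N isT)) _.
      by apply: le_sqr1D; rewrite ?addr_ge0.
    - exact: Ln'.
  have i1 := L2_mul LVn (Ln _ tI); have i2 := L2_mul LWg (Ln _ tI).
  have -> : \int[mu]_x (D t x * n t x) =
      (- (\int[mu]_x (V t 0%N x * n' t x * n t x))) - (\int[mu]_x (W t 0%N x * g x * n t x)).
    rewrite -RintegralN_on// -RintegralB_on//; last exact: integrable_onN.
    apply: ae_Rintegral => //.
    - exact: integrable_onM (L2_mul (LD _ tI) (Ln _ tI)).
    - by apply: integrable_onM; apply: integrable_onB i2 => //; exact: integrable_onN.
    - by apply: ae_imp Dae => x -> _; ring.
  rewrite mulrBr mulrN (transport_energy (pV 0%N isT) (LV' 0%N isT) (LV' 1%N isT) _ (pn _ tI) (Ln _ tI) (Ln' _ tI)); last by exists (1 + (nsq (V t 1%N) + nsq (V t 2%N))).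
  rewrite opprK.
  have b1 : \int[mu]_x (V t 1%N x * n t x ^+ 2) <= (1 + (nsq (V t 1%N) + nsq (V t 2%N))) * E t.
    rewrite /E /nsq -RintegralZ_on//; last by case: (Ln _ tI).
    apply: le_Rintegral_on => //.
    - apply: (@integrable_on_bounded _ _ (1 + (nsq (V t 1%N) + nsq (V t 2%N)))) => //.
        by case: (LV' 1%N isT).
      by case: (Ln _ tI).
    - by apply: integrable_onZ => //; case: (Ln _ tI).
    - move=> x _; apply: ler_wpM2r; first exact: sqr_ge0.
      exact: le_trans (ler_norm _) (supV1 x).
  (* From the nonnegativity of nsq (W g + n), then the pointwise bound on W^2. *)
  have b2 : - (2 * \int[mu]_x (W t 0%N x * g x * n t x)) <= E t * nsq g + E t.
    apply: (@le_trans _ _ (nsq (fun x => W t 0%N x * g x) + E t)).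
      have := nsq_ge0 (fun x => W t 0%N x * g x + n t x).
      rewrite nsqD_expand//; last exact: Ln.
      rewrite -/(E t); lra.
    rewrite lerD2r /nsq -RintegralZ_on//; last by case: Lg.
    apply: le_Rintegral_on => //; first by case: LWg.
    - by apply: integrable_onZ => //; case: Lg.
    - by move=> x _; rewrite exprMn ler_wpM2r ?sqr_ge0.
  rewrite -mulNr in b2; rewrite -mulNr.
  have b3 : E t * nsq g <= E t * (2 * nsq (U t 1%N) + 2 * nsq (U t 3%N)) by rewrite ler_wpM2l.
  have b4 : (1 + (nsq (V t 1%N) + nsq (V t 2%N))) * E t + (E t * (2 * nsq (U t 1%N) + 2 * nsq (U t 3%N)) + E t) <= (2 + 2 * B t) * E t.
    rewrite -subr_ge0 /B (_ : _ - _ = (nsq (V t 1%N) + nsq (V t 2%N)) * E t); last by ring.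
    by rewrite mulr_ge0// addr_ge0.
  lra.
have contB t : I t -> B s @[s --> within I (nbhs t)] --> B t.
  move=> tI.
  have cVj j : (j <= 3)%N -> nsq (V s j) @[s --> within I (nbhs t)] --> nsq (V t j).
    move=> j3; apply: cvg_nsq; [|exact: LV|exact: contV].
    by apply: filterS (In _ tI) => s sI; exact: LV.
  have cUj j : (j <= 3)%N -> nsq (U s j) @[s --> within I (nbhs t)] --> nsq (U t j).
    move=> j3; apply: cvg_nsq; [|exact: LU|exact: contU].
    by apply: filterS (In _ tI) => s sI; exact: LU.
  exact: cvgD (cvgD (cvgD (cVj 1%N isT) (cVj 2%N isT)) (cUj 1%N isT)) (cUj 3%N isT).
have contE t : I t -> E s @[s --> within I (nbhs t)] --> E t.
  move=> tI; apply: cvg_nsq; [|exact: Ln|exact: contn].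
  by apply: filterS (In _ tI) => s sI; exact: Ln.
have sub01 : `[0, t1] `<=` I by move=> s; rewrite /= in_itv/= => /andP[? ?]; exact: It.
have within01 (f : R -> R) : (forall t, I t -> f s @[s --> within I (nbhs t)] --> f t) ->
    {within `[0, t1], continuous f}.
  move=> h; apply: continuous_subspaceW sub01 _.
  by apply/subspace_continuousP => t tI; exact: h.
have UV1 : nsq (n t1) = 0 -> {ae mu, forall x, V t1 0%N x = U t1 0%N x}.
  move=> n0; have tI := It _ t10 (lexx _); have [pW LW'] := cW _ tI.
  have : nsq (W t1 0%N) = 0.
    apply/eqP; rewrite eq_le nsq_ge0 andbT.
    apply: (@le_trans _ _ (nsq (W t1 0%N) + nsq (W t1 1%N))); first by rewrite lerDl nsq_ge0.
    rewrite -n0; apply: elliptic_bound; split=> j jn; [apply: pW|apply: LW'];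
    by apply: leq_trans jn _.
  move=> /(nsq_eq0 (LW' 0%N isT)); apply: ae_imp => x /eqP.
  by rewrite subr_eq0 => /eqP.
apply: UV1.
have E00 : E 0 = 0.
  have I0 := It _ (lexx 0) t10.
  have W0 : {ae mu, forall x, W 0 0%N x = 0} by apply: ae_imp UV0 => x; rewrite /W => ->; rewrite subrr.
  have W2 := chain_zero (cW _ I0) W0 (isT : (2 <= 3)%N).
  rewrite /E (@nsq_ae _ _ (fun=> 0)) ?nsq0//; first by case: (Ln _ I0).
  by apply: ae_imp2 W0 W2 => x; rewrite /n => -> ->; rewrite subrr.
have [t1E|t1P] := eqVneq t1 0; first by rewrite t1E.
have t1_gt0 : 0 < t1 by rewrite lt_def t1P.
(* Gronwall is applied with a constant rate, obtained from the maximum of [B] over [0, t1]. *)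
have [c c01 hc] := EVT_max t10 (within01 _ contB).
apply: (@gronwall0 _ E (fun t => 2 * \int[mu]_x (D t x * n t x)) (2 + 2 * B c)) => //.
- by move=> t; exact: nsq_ge0.
- exact: within01.
- move=> t /andP[t0 tt]; have tI := It _ (ltW t0) (ltW tt).
  apply: le_trans (energy _ tI) _; apply: ler_wpM2r; first exact: nsq_ge0.
  have : B t <= B c by apply: hc; rewrite in_itv/= (ltW t0) (ltW tt).
  by lra.
Qed.

Lemma solution_unique T (u0 : R -> R) u v : is_solution `[0, T[ u0 u -> is_solution `[0, T[ u0 v ->
  forall t, 0 <= t < T -> {ae mu, forall x, v t x = u t x}.
Proof.
move=> su sv t tT.
have [U [Ut [cU aU]]] := is_solution_chain su; have [V [Vt [cV aV]]] := is_solution_chain sv.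
have I0 : `[0, T[%classic 0 by move: tT => /andP[? ?]; rewrite /= in_itv/= lexx (le_lt_trans _ (_ : t < T)).
have It : `[0, T[%classic t by rewrite /= in_itv.
have [_ [ut [_ _ _ u00]]] := su; have [_ [vt [_ _ _ v00]]] := sv.
have UV0 : {ae mu, forall x, V 0 0%N x = U 0 0%N x}.
  apply: ae_trans (ae_sym (aV _ I0)) _; apply: ae_trans v00 _.
  by apply: ae_trans (ae_sym u00) _; exact: aU.
have h := chain_solution_unique cU cV UV0 tT.
apply: ae_trans (aV _ It) _; apply: ae_trans h _; exact: ae_sym (aU _ It).
Qed.
End solutions.

(** * The Green kernel of the Helmholtz operator *)

Section one_sided_kernel.
Context {R : realType}.
Notation mu := (@lebesgue_measure R).
Implicit Types (f g h Phi q : R -> R) (a b c k M x y e : R) (s : bool).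

Definition half s x : set R := if s then `]-oo, x]%classic else `[x, +oo[%classic.

Lemma measurable_half s x : measurable (half s x).
Proof. by case: s; exact: measurable_itv. Qed.

(** Twice the Green kernel of 1 - d_x^2, seen through [Phi] and cut at the diagonal, so that each
    half satisfies a first-order equation. Eulerian coordinates are [Phi = id]; Lagrangian ones take
    [Phi] to be the flow up to a constant. *)
Definition kernel s Phi x y : R := \1_(half s x) y * expR (- `|Phi x - Phi y|).

Definition kint s Phi f x : R := \int[mu]_y (kernel s Phi x y * f y).

Lemma kernel_bound s Phi x y : 0 <= kernel s Phi x y <= 1.
Proof.
have /andP[i0 i1] := indic_le1 (half s x) y.
rewrite /kernel mulr_ge0 ?expR_ge0//= mulr_ile1 ?expR_ge0//.
Qed.

Lemma measurable_kernel s Phi x : measurable_fun setT Phi ->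
  measurable_fun setT (kernel s Phi x).
Proof.
move=> mP; apply: measurable_funM; first by apply: measurable_indic; exact: measurable_half.
apply: measurableT_comp => //; apply: measurable_funN; apply: measurableT_comp => //.
exact: measurable_funB.
Qed.

Lemma integrable_kernel s Phi f x : measurable_fun setT Phi -> integrable_on setT f ->
  integrable_on setT (fun y => kernel s Phi x y * f y).
Proof.
move=> mP intf; apply: (@integrable_on_bounded _ _ 1) => //; first exact: measurable_kernel.
by move=> y _; have /andP[? ?] := kernel_bound s Phi x y; rewrite ger0_norm.
Qed.

Lemma kint_bound s Phi f x : measurable_fun setT Phi -> integrable_on setT f ->
  `|kint s Phi f x| <= \int[mu]_y `|f y|.
Proof.
move=> mP intf; apply: le_Rintegral_dom => //.
- exact: integrable_onM (integrable_kernel s x mP intf).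
- exact: integrable_on_norm.
- move=> y _; rewrite normrM; apply: ler_piMl => //.
  by have /andP[? ?] := kernel_bound s Phi x y; rewrite ger0_norm.
Qed.

Lemma kint_ge0 s Phi f x : (forall y, 0 <= f y) -> 0 <= kint s Phi f x.
Proof.
move=> f0; apply: Rintegral_ge0 => y _; apply: mulr_ge0 => //.
by case/andP: (kernel_bound s Phi x y).
Qed.

Lemma kint_norm s Phi f x : measurable_fun setT Phi -> integrable_on setT f ->
  `|kint s Phi f x| <= kint s Phi (fun y => `|f y|) x.
Proof.
move=> mP intf; apply: le_Rintegral_dom => //.
- exact: integrable_onM (integrable_kernel s x mP intf).
- apply: integrable_kernel => //; exact: integrable_on_norm.
- move=> y _; rewrite normrM ler_wpM2r//.
  by have /andP[? ?] := kernel_bound s Phi x y; rewrite ger0_norm.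
Qed.

Lemma kintB s Phi f g x : measurable_fun setT Phi -> integrable_on setT f ->
  integrable_on setT g ->
  kint s Phi (fun y => f y - g y) x = kint s Phi f x - kint s Phi g x.
Proof.
move=> mP intf intg; rewrite -RintegralB_on//; [|exact: integrable_kernel..].
by apply: eq_RintegralT => y; ring.
Qed.

Lemma kintZ s Phi k f x : measurable_fun setT Phi -> integrable_on setT f ->
  kint s Phi (fun y => k * f y) x = k * kint s Phi f x.
Proof.
move=> mP intf; rewrite -RintegralZ_on//; last exact: integrable_kernel.
by apply: eq_RintegralT => y; ring.
Qed.

Definition sgs s : R := if s then 1 else -1.

Lemma sgsM s : sgs s * sgs s = 1.
Proof. by case: s; rewrite /sgs ?mulr1// mulrNN mulr1. Qed.

(** On each half-line monotonicity fixes the sign of Phi x - Phi y, so the exponential splits into a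
    factor in x and a factor in y. *)
Lemma kernelE s Phi x y : {homo Phi : x y / x <= y} ->
  kernel s Phi x y = expR (- (sgs s * Phi x)) * (\1_(half s x) y * expR (sgs s * Phi y)).
Proof.
move=> nd; rewrite /kernel mulrCA -expRD indicE.
have [h|_] := boolP (y \in half s x); last by rewrite !mul0r.
rewrite !mul1r; congr expR; move: h; rewrite in_setE; case: s => /=; rewrite in_itv/= ?andbT => /nd h.
  by rewrite ger0_norm ?subr_ge0//; ring.
by rewrite ler0_norm ?subr_le0//; ring.
Qed.

Lemma primitive_le Phi q x y : primitive_of Phi q -> (forall x, 0 <= q x) -> x <= y -> Phi x <= Phi y.
Proof.
by move=> [_ h] q0 xy; rewrite -subr_ge0 h//; exact: Rintegral_ge0.
Qed.

Lemma primitive_expR k Phi q : primitive_of Phi q -> continuous q ->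
  primitive_of (fun x => expR (k * Phi x)) (fun x => k * q x * expR (k * Phi x)).
Proof.
move=> pP cq; have cP := primitive_of_continuous pP.
have dE (x : R) : is_derive x (1 : R) (fun y => expR (k * Phi y)) (k * q x * expR (k * Phi x)).
  rewrite mulrC; apply: is_derive_comp1.
  exact: is_deriveZ (primitive_is_derive pP cq x).
apply: primitive_of_derivable => //.
have cE : continuous (fun x => expR (k * Phi x)).
  move=> x; apply/differentiable_continuous/derivable1_diffP.
  by case: (dE x).
move=> x; apply: cvgM; last exact: cE.
by apply: cvgM; [exact: cvg_cst|exact: cq].
Qed.

(** By [kernelE] the integral is an exponential in x times an integral [K] with moving endpoint, to
    which the product rule applies. *)
Lemma kint_primitive s Phi q f : primitive_of Phi q -> continuous q -> (forall x, 0 <= q x) ->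
  integrable_on setT f ->
  primitive_of (kint s Phi f) (fun x => sgs s * (f x - q x * kint s Phi f x)).
Proof.
move=> pP cq q0 intf.
have nd : {homo Phi : x y / x <= y} by move=> x y; exact: primitive_le pP q0.
have cP := primitive_of_continuous pP.
have mP : measurable_fun setT Phi by exact: continuous_measurable_fun.
have pE k := primitive_expR k pP cq.
have cE k := primitive_of_continuous (pE k).
have mE k : measurable_fun setT (fun x => expR (k * Phi x)) by exact: continuous_measurable_fun.
pose w y := expR (sgs s * Phi y) * f y.
have lw : loc_integrable w by apply: loc_integrableMc => //; exact: integrable_loc.
pose K x := \int[mu]_y (\1_(half s x) y * w y).
have KE x : kint s Phi f x = expR (- sgs s * Phi x) * K x.
  rewrite /K -RintegralZ_on//.
    by apply: eq_RintegralT => y; rewrite kernelE// /w mulNr; ring.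
  have := @integrable_onZ _ setT (expR (sgs s * Phi x)) _ measurableT (integrable_kernel s x mP intf).
  rewrite (_ : (fun y => _) = (fun y => \1_(half s x) y * w y))//.
  by apply/funext => y; rewrite kernelE// /w !mulrA -expRD subrr expR0 mul1r.
have iw x : integrable_on setT (fun y => \1_(half s x) y * w y).
  have := @integrable_onZ _ setT (expR (sgs s * Phi x)) _ measurableT (integrable_kernel s x mP intf).
  rewrite (_ : (fun y => _) = (fun y => \1_(half s x) y * w y))//.
  by apply/funext => y; rewrite kernelE// /w !mulrA -expRD subrr expR0 mul1r.
have pK : primitive_of K (fun x => sgs s * w x).
  split; first exact: loc_integrableZ.
  move=> a b ab; rewrite RintegralZ_on// /K -RintegralB_on//.
  have iab : integrable_on `[a, b] w by exact: lw.
  case: (boolP s) => sE.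
    rewrite /sgs mul1r -Rintegral_itv_obnd_cbnd; last first.
      by apply: integrable_onS iab => //; exact: subset_itv_oc_cc.
    rewrite [RHS]Rintegral_indic; apply: eq_RintegralT => y.
    rewrite -mulrBl /half !indicE !mem_setE !in_itv/=; congr (_ * _).
    by have [ya|ya] := leP y a; have [yb|yb] := leP y b; rewrite /= ?subr0 ?subrr//; lra.
  rewrite /sgs mulN1r -Rintegral_itv_bndo_bndc; last first.
    by apply: integrable_onS iab => //; exact: subset_itv_co_cc.
  rewrite -RintegralN_on//; last first.
    by apply: integrable_onS iab => //; exact: subset_itv_co_cc.
  rewrite [RHS]Rintegral_indic; apply: eq_RintegralT => y.
  have -> : \1_(`[a, b[) y * - w y = (- \1_(`[a, b[) y) * w y by ring.
  rewrite -mulrBl /half !indicE !mem_setE !in_itv/= !andbT; congr (_ * _).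
  by have [ya|ya] := leP a y; have [yb|yb] := leP b y; rewrite /= ?subr0 ?subrr ?sub0r ?oppr0//; lra.
have := primitive_mul (pE (- sgs s)) pK.
rewrite (_ : (fun x => expR (- sgs s * Phi x) * K x) = kint s Phi f); last by apply/funext => x; rewrite KE.
rewrite (_ : (fun x => _ + _) = (fun x => sgs s * (f x - q x * kint s Phi f x)))//.
apply/funext => x; rewrite KE /w.
have e1 : expR (- sgs s * Phi x) * expR (sgs s * Phi x) = 1 by rewrite -expRD mulNr addrC subrr expR0.
rewrite -[f x in RHS]mul1r -e1; ring.
Qed.

Lemma Rintegral_le_lim f C : integrable_on setT f ->
  (forall n : nat, \int[mu]_(x in `[- n%:R, n%:R]) f x <= C) -> \int[mu]_x f x <= C.
Proof.
move=> intf h; have c := cvg_Rintegral_itv intf.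
rewrite -(cvg_lim _ c)//; apply: limr_le; first by apply/cvg_ex; eexists; exact: c.
by near=> n.
Unshelve. all: by end_near. Qed.

(* The kernel integrates to at most 1 against [q = Phi'], whatever [Phi] is: this
   makes the Lagrangian vector field bounded and the solution global. *)
Lemma kint_sup_bound s Phi q f x M : primitive_of Phi q -> continuous q -> (forall x, 0 <= q x) ->
  integrable_on setT f -> 0 <= M -> (forall y, `|f y| <= M * q y) -> `|kint s Phi f x| <= M.
Proof.
move=> pP cq q0 intf M0 fM.
have nd : {homo Phi : x y / x <= y} by move=> ? ?; exact: primitive_le pP q0.
have cP := primitive_of_continuous pP.
have mP : measurable_fun setT Phi by exact: continuous_measurable_fun.
apply: le_trans (kint_norm s x mP intf) _.
have inf : integrable_on setT (fun y => `|f y|) by exact: integrable_on_norm.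
apply: Rintegral_le_lim; first exact: integrable_kernel.
move=> n.
have pE := primitive_expR (sgs s) pP cq.
pose w y := q y * expR (sgs s * Phi y).
have w0 y : 0 <= w y by rewrite mulr_ge0 ?expR_ge0.
have cE := primitive_of_continuous pE.
have cw : continuous w by move=> y; apply: cvgM; [exact: cq|exact: cE].
have lw := continuous_loc cw.
have mw := loc_integrableM lw.
pose J := if s then `[- n%:R, x]%classic else `[x, n%:R]%classic.
have mJ : measurable J by rewrite /J; case: (s); exact: measurable_itv.
have iJ : integrable_on J w by rewrite /J; case: (s); exact: lw.
have wJ : \int[mu]_(y in J) w y <= expR (sgs s * Phi x).
  have h a b : a <= b -> \int[mu]_(y in `[a, b]) w y = sgs s * (expR (sgs s * Phi b) - expR (sgs s * Phi a)).
    move=> ab; rewrite (proj2 pE)// -RintegralZ_on//; last first.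
      by apply: continuous_loc => y; apply: cvgM; [apply: cvgM; [exact: cvg_cst|exact: cq]|exact: cE].
    by apply: eq_Rintegral => y _; rewrite !mulrA sgsM mul1r.
  rewrite /J; case: (boolP s) => sE.
    have [nx|xn] := leP (- n%:R) x; last by rewrite Rintegral_itv_gt ?expR_ge0.
    rewrite h// /sgs sE !mul1r; have := expR_ge0 (Phi (- n%:R)); lra.
  have [nx|xn] := leP x n%:R; last by rewrite Rintegral_itv_gt ?expR_ge0.
  rewrite h// /sgs (negbTE sE) !mulN1r; have := expR_ge0 (- (Phi n%:R)); lra.
pose c := expR (- (sgs s * Phi x)).
have c0 : 0 <= c by exact: expR_ge0.
apply: (@le_trans _ _ (\int[mu]_(y in J) (M * c * w y))); last first.
  rewrite RintegralZ_on// -mulrA -[leRHS]mulr1 ler_wpM2l//.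
  have -> : 1 = c * expR (sgs s * Phi x) by rewrite -expRD addrC subrr expR0.
  by rewrite ler_wpM2l.
rewrite Rintegral_indic [leRHS]Rintegral_indic; apply: le_Rintegral_on => //.
- apply: integrable_on_indic => //; exact: integrable_kernel.
- by apply: (proj1 (integrable_on_restrict _ mJ)); exact: integrable_onZ.
move=> y _; rewrite kernelE// -/c.
have h1 : `|f y| <= M * q y := fM y.
have h2 : \1_(`[- n%:R, n%:R]) y * \1_(half s x) y <= \1_J y :> R.
  rewrite /half /J; case: (s); rewrite !indicE !mem_setE !in_itv/= ?andbT.
    by have [?|?] := leP (- n%:R) y; have [?|?] := leP y n%:R; have [?|?] := leP y x;
      rewrite /= ?mulr1 ?mulr0 ?mul0r ?ler01.
  by have [?|?] := leP (- n%:R) y; have [?|?] := leP y n%:R; have [?|?] := leP x y;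
    rewrite /= ?mulr1 ?mulr0 ?mul0r ?ler01.
apply: (@le_trans _ _ ((\1_(`[- n%:R, n%:R]) y * \1_(half s x) y) * (c * expR (sgs s * Phi y) * (M * q y)))).
  rewrite [leLHS](_ : _ = (\1_(`[- n%:R, n%:R]) y * \1_(half s x) y) * (c * expR (sgs s * Phi y) * `|f y|)); last by ring.
  apply: ler_wpM2l.
    exact: mulr_ge0.
  by apply: ler_wpM2l => //; rewrite mulr_ge0// expR_ge0.
rewrite [leRHS](_ : _ = \1_J y * (c * expR (sgs s * Phi y) * (M * q y))); last by rewrite /w; ring.
by apply: ler_wpM2r => //; rewrite !mulr_ge0// expR_ge0.
Qed.

End one_sided_kernel.

(** * The inverse of the Helmholtz operator *)

Section green_operator.
Context {R : realType}.
Notation mu := (@lebesgue_measure R).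
Implicit Types (f g h : R -> R) (a b c k M x y e : R) (s : bool).

Lemma primitive_id : primitive_of (@id R) (fun=> 1).
Proof.
by apply: primitive_of_derivable; first [exact: cst_continuous|move=> x; exact: is_derive_id].
Qed.

Lemma primitiveD F G f g : primitive_of F f -> primitive_of G g ->
  primitive_of (fun x : R => F x + G x) (fun x => f x + g x).
Proof.
move=> [l1 h1] [l2 h2]; split; first exact: loc_integrableD.
by move=> a b ab; rewrite RintegralD_on// -h1// -h2//; ring.
Qed.

Lemma primitiveZ k F f : primitive_of F f -> primitive_of (fun x : R => k * F x) (fun x => k * f x).
Proof.
move=> [l1 h1]; split; first exact: loc_integrableZ.
by move=> a b ab; rewrite RintegralZ_on// -h1//; ring.
Qed.

Lemma primitiveB F G f g : primitive_of F f -> primitive_of G g ->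
  primitive_of (fun x : R => F x - G x) (fun x => f x - g x).
Proof.
move=> [l1 h1] [l2 h2]; split; first exact: loc_integrableB.
by move=> a b ab; rewrite RintegralB_on// -h1// -h2//; ring.
Qed.

Lemma primitive_eq F G f g : primitive_of F f -> F =1 G -> f =1 g -> primitive_of G g.
Proof. by move=> h /funext <- /funext <-. Qed.

Lemma integrable_nonneg_bounded F C : loc_integrable F -> (forall x : R, 0 <= F x) ->
  (forall n : nat, \int[mu]_(x in `[- n%:R, n%:R]) F x <= C) -> integrable_on setT F.
Proof.
move=> lF F0 hC; have mF := loc_integrableM lF.
apply/integrable_onP => //; split => //.
pose D (n : nat) : set R := `[- n%:R, n%:R]%classic.
have cv : (\int[mu]_(x in D n) (F x)%:E)%E @[n --> \oo] -->
    (\int[mu]_(x in \bigcup_n D n) (F x)%:E)%E.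
  apply: ge0_nondecreasing_set_cvg_integral => //.
  - apply/nondecreasing_seqP => n; rewrite subsetEset => x; rewrite /D /= !in_itv/= => /andP[x1 x2].
    rewrite -natr1; apply/andP; split; lra.
  - by move=> n; exact: measurable_itv.
  - by move=> n; apply/measurable_EFinP; exact: measurable_funTS.
  - by move=> n x _; rewrite lee_fin.
have U : \bigcup_n D n = [set: R].
  apply/seteqP; split => // x _; exists (Num.truncn `|x|).+1 => //=.
  by rewrite /D /= in_itv/= -ler_norml ltW// truncnS_gt.
rewrite U in cv.
apply: (@le_lt_trans _ _ C%:E); last exact: ltry.
have -> : (\int[mu]_x `|(EFin \o F) x| = \int[mu]_x (F x)%:E)%E.
  by apply: eq_integral => x _; rewrite gee0_abs ?lee_fin.
rewrite -(cvg_lim _ cv)//; apply: lime_le; first by apply/cvg_ex; eexists; exact: cv.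
apply: nearW => n; rewrite -(@fineK _ (\int[mu]_(x in _) _)%E); first by rewrite lee_fin; exact: hC.
have iD : integrable_on (D n) F by exact: lF.
exact: (@integrable_fin_num _ _ _ mu (D n) (measurable_itv _) _ iD).
Qed.

(** For [A], the integral of |f|, the equation A' = +-(|f| - A) bounds the integral of [A] over
    [-n, n] by that of |f| plus boundary terms, hence by 2 C. Being also bounded, the function is in
    L^2. *)
Lemma kint_id_integrable s f : integrable_on setT f ->
  integrable_on setT (kint s id f) /\ L2 (kint s id f).
Proof.
move=> intf; have mid : measurable_fun setT (@id R) by [].
have inf : integrable_on setT (fun y => `|f y|) by exact: integrable_on_norm.
have pr g : integrable_on setT g -> primitive_of (kint s id g) (fun x => sgs s * (g x - 1 * kint s id g x)).
  by move=> ig; apply: kint_primitive primitive_id _ _ ig => //; exact: cst_continuous.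
have mk g : integrable_on setT g -> measurable_fun setT (kint s id g).
  by move=> ig; apply: continuous_measurable_fun; exact: primitive_of_continuous (pr _ ig).
pose C := \int[mu]_y `|f y|.
have C0 : 0 <= C by apply: Rintegral_ge0.
pose A := kint s id (fun y => `|f y|).
have A0 x : 0 <= A x by apply: kint_ge0.
have AC x : A x <= C.
  have := kint_bound s x mid inf; rewrite ger0_norm//.
  by rewrite (@eq_RintegralT _ (fun y => `|f y|)) // => y; rewrite normr_id.
have lA := continuous_loc (primitive_of_continuous (pr _ inf)).
have iA : integrable_on setT A.
  apply: (@integrable_nonneg_bounded _ (C + C)) => // n.
  have nn : - n%:R <= (n%:R : R) by rewrite (@le_trans _ _ 0)// ?oppr_le0.
  have := proj2 (pr _ inf) _ _ nn; rewrite RintegralZ_on//; last first.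
    by apply: loc_integrableB; [exact: integrable_loc|exact: loc_integrableZ].
  rewrite RintegralB_on//; [|exact: integrable_loc|exact: loc_integrableZ].
  rewrite (_ : \int[mu]_(x in _) (1 * _) = \int[mu]_(x in `[- n%:R, n%:R]) A x); last first.
    by apply: eq_Rintegral => x _; rewrite mul1r.
  rewrite -/A => h.
  have fC : \int[mu]_(y in `[- n%:R, n%:R]) `|f y| <= C by exact: le_Rintegral_sub.
  have := A0 (- n%:R); have := A0 n%:R; have := AC (- n%:R); have := AC n%:R.
  by move: h; rewrite /sgs; case: (s); lra.
have i1 : integrable_on setT (kint s id f).
  apply: (@integrable_setT_le _ A) => //; first exact: mk.
  by move=> x; exact: kint_norm.
split => //; split; first exact: mk.
rewrite (_ : (fun x => _) = (fun x => kint s id f x * kint s id f x)); last by apply/funext => x; rewrite expr2.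
apply: (@integrable_on_bounded _ _ C) => //; first exact: mk.
by move=> x _; exact: kint_bound.
Qed.

(** Convolution with exp(-|x|)/2, that is (1 - d_x^2)^{-1} f; [green'] is its derivative. *)
Definition green f x : R := 2^-1 * (kint true id f x + kint false id f x).
Definition green' f x : R := 2^-1 * (kint false id f x - kint true id f x).

Definition helmholtz_chain h (j : nat) : R -> R :=
  match j with 0%N => green h | 1%N => green' h | _ => fun x => green h x - h x end.

Lemma green_chain2 f : integrable_on setT f -> L2 f ->
  sobolev_chain 2 (helmholtz_chain f).
Proof.
move=> intf Lf.
have [it Lt] := kint_id_integrable true intf; have [iF LF] := kint_id_integrable false intf.
have pr s : primitive_of (kint s id f) (fun x => sgs s * (f x - 1 * kint s id f x)).
  by apply: kint_primitive primitive_id _ _ intf => //; exact: cst_continuous.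
have L0 : L2 (green f) by apply: L2Z; exact: L2D.
split; last by case=> [|[|[|//]]] _ //; [apply: L2Z; exact: L2B|exact: L2B].
case=> [|[|//]] _.
  apply: primitive_eq (primitiveZ 2^-1 (primitiveD (pr true) (pr false))) _ _ => // x.
  by rewrite /helmholtz_chain /green' /sgs; field.
apply: primitive_eq (primitiveZ 2^-1 (primitiveB (pr false) (pr true))) _ _ => // x.
by rewrite /helmholtz_chain /green /sgs; field.
Qed.

(** Extends [helmholtz_chain] by a third derivative when [f] has the derivative [f']. *)
Definition green_chain f f' (j : nat) : R -> R :=
  match j with
  | 0%N => green f
  | 1%N => green' f
  | 2%N => fun x => green f x - f x
  | _ => fun x => green' f x - f' x
  end.

Lemma green_chain3 f f' : integrable_on setT f -> L2 f -> primitive_of f f' -> L2 f' ->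
  sobolev_chain 3 (green_chain f f').
Proof.
move=> intf Lf pf Lf'; have [p2 L2'] := green_chain2 intf Lf; split.
  case=> [|[|[|//]]] _; [exact: (p2 0%N)|exact: (p2 1%N)|].
  apply: primitiveB => //; exact: (p2 0%N).
by case=> [|[|[|[|//]]]] _; [exact: (L2' 0%N)|exact: (L2' 1%N)|exact: (L2' 2%N)|apply: L2B => //; exact: (L2' 1%N)].
Qed.

Lemma greenB f g x : integrable_on setT f -> integrable_on setT g ->
  green (fun y => f y - g y) x = green f x - green g x /\
  green' (fun y => f y - g y) x = green' f x - green' g x.
Proof. by move=> i1 i2; rewrite /green /green' !kintB//; split; ring. Qed.

Lemma greenZ k f x : integrable_on setT f ->
  green (fun y => k * f y) x = k * green f x /\
  green' (fun y => k * f y) x = k * green' f x.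
Proof. by move=> i1; rewrite /green /green' !kintZ//; split; ring. Qed.

(** [elliptic_bound] for the chain of [green f], whose Helmholtz image is [f]; the second derivative
    costs the factor 4 of the crude triangle inequality. *)
Lemma green_nsq f : integrable_on setT f -> L2 f ->
  [/\ nsq (green f) <= nsq f, nsq (green' f) <= nsq f & nsq (fun x => green f x - f x) <= 4 * nsq f].
Proof.
move=> intf Lf; have cG := green_chain2 intf Lf.
have := elliptic_bound cG; rewrite (_ : (fun x => _) = f); last by apply/funext => x; rewrite /helmholtz_chain; ring.
have L0 := proj2 cG 0%N isT.
have := nsq_ge0 (green f); have := nsq_ge0 (green' f) => h1 h2 h3.
split; [lra|lra|].
have := nsqB L0 Lf; lra.
Qed.
End green_operator.

(** * Picard iteration *)

Section picard.
Context {R : realType}.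
Notation mu := (@lebesgue_measure R).

(** [e k] is the tail of the geometric series: u k - e k increases, u k + e k decreases, and the
    limit is the supremum of the lower ends of these nested intervals. *)
Lemma geometric_lim (u : nat -> R) (C : R) :
  (forall k, `|u k.+1 - u k| <= C * 2^-1 ^+ k) ->
  forall k, `|u k - limn u| <= 2 * C * 2^-1 ^+ k.
Proof.
move=> hu; pose e k : R := 2 * C * 2^-1 ^+ k.
have C0 : 0 <= C by have := hu 0%N; rewrite expr0 mulr1; apply: le_trans.
have e0 k : 0 <= e k by rewrite /e !mulr_ge0// exprn_ge0// invr_ge0.
have eS k : e k = e k.+1 + C * 2^-1 ^+ k by rewrite /e exprS; field.
have lo k n : u k - e k <= u (n + k)%N - e (n + k)%N.
  elim: n => [//|n IH]; apply: le_trans IH _; rewrite addSn.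
  have := hu (n + k)%N; rewrite ler_norml => /andP[h _]; rewrite (eS (n + k)%N); lra.
have up k n : u (n + k)%N + e (n + k)%N <= u k + e k.
  elim: n => [//|n IH]; apply: le_trans IH; rewrite addSn.
  have := hu (n + k)%N; rewrite ler_norml => /andP[_ h]; rewrite (eS (n + k)%N); lra.
have lu j k : u j - e j <= u k + e k.
  have := lo j k; have := up k j; rewrite addnC; have := e0 (k + j)%N; lra.
pose S := range (fun k => u k - e k).
have Sub k : ubound S (u k + e k) by move=> _ [j _ <-].
have S0 : S !=set0 by exists (u 0%N - e 0%N); exists 0%N.
have hl k : `|u k - sup S| <= e k.
  have h1 : sup S <= u k + e k by apply: ge_sup.
  have h2 : u k - e k <= sup S by apply: ub_le_sup; [exists (u 0%N + e 0%N)|exists k].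
  by rewrite ler_norml; apply/andP; split; lra.
suff -> : limn u = sup S by exact: hl.
apply/cvg_lim => //; apply/cvgrPdistC_le => d d0.
have ce : e k @[k --> \oo] --> 0.
  rewrite -(mulr0 (2 * C)); apply: cvgM; first exact: cvg_cst.
  by apply: cvg_expr; rewrite ger0_norm ?invr_ge0// invf_lt1// ltr1n.
move/cvgrPdistC_le : ce => /(_ d d0); apply: filterS => k; rewrite subr0 ger0_norm// => ek.
exact: le_trans (hl k) ek.
Qed.

Lemma near_dist_le (t d : R) : 0 < d -> \forall s \near t, `|s - t| <= d.
Proof. by move=> d0; exists d => //= s /= ts; rewrite distrC ltW. Qed.

Definition admissible (M : R) (p : R -> R) := continuous p /\ forall x, `|p x| <= M.

(** The vector field [P] acts on functions of x. Its bound [K] is the same on all balls, which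
    excludes blow-up; its Lipschitz constants, in x and in sup distance, may depend on the radius
    M. *)
Variables (P : (R -> R) -> R -> R) (K : R) (Lx Lp : R -> R).
Hypothesis Lx0 : forall M, 0 <= Lx M.
Hypothesis Lp0 : forall M, 0 <= Lp M.
Hypothesis P_bound : forall M p, admissible M p -> forall x, `|P p x| <= K.
Hypothesis P_lip_x : forall M p, admissible M p -> forall x y, `|P p x - P p y| <= Lx M * `|x - y|.
Hypothesis P_lip_p : forall (M : R) (p r : R -> R) (d : R), admissible M p -> admissible M r ->
  (forall x, `|p x - r x| <= d) -> forall x, `|P p x - P r x| <= Lp M * d.

(** Bounds preserved by the Picard step and by pointwise limits. The first confines p(t) to the ball
    of radius K |t|, on which the Lipschitz constants are known; the third gives continuity in x. *)
Definition regular (p : R -> R -> R) := [/\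
  forall t x, `|p t x| <= K * `|t|,
  forall s t x, `|p s x - p t x| <= K * `|s - t| &
  forall t x y, `|p t x - p t y| <= `|t| * Lx (K * `|t|) * `|x - y|].

Let K0 : 0 <= K.
Proof.
apply: le_trans (P_bound (_ : admissible 0 (fun=> 0)) 0) => //.
by split; [exact: cst_continuous|move=> x; rewrite normr0].
Qed.

Lemma lipschitz_continuous (f : R -> R) (C : R) :
  (forall x y, `|f x - f y| <= C * `|x - y|) -> continuous f.
Proof.
move=> hf x; apply/cvgrPdistC_le => e e0.
have C0 : 0 < `|C| + 1 by rewrite ltr_wpDl.
near=> y; apply: (le_trans (hf y x)); apply: (@le_trans _ _ ((`|C| + 1) * `|y - x|)).
  by rewrite ler_wpM2r//; have := ler_norm C; lra.
rewrite -ler_pdivlMl// mulrC; near: y.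
by apply: near_dist_le; rewrite divr_gt0.
Unshelve. all: by end_near. Qed.

Lemma local_lipschitz_continuous (f : R -> R) (C : R -> R) :
  (forall T s t, `|s| <= T -> `|t| <= T -> `|f s - f t| <= C T * `|s - t|) -> continuous f.
Proof.
move=> hf t; apply/cvgrPdistC_le => e e0; pose T := `|t| + 1.
have C0 : 0 < `|C T| + 1 by rewrite ltr_wpDl.
near=> s.
have sT : `|s| <= T.
  rewrite /T -lerBlDl; apply: le_trans (lerB_dist _ _) _.
  near: s; exact: near_dist_le ltr01.
have tT : `|t| <= T by rewrite /T lerDl.
apply: (le_trans (hf T s t sT tT)); apply: (@le_trans _ _ ((`|C T| + 1) * `|s - t|)).
  by rewrite ler_wpM2r//; have := ler_norm (C T); lra.
rewrite -ler_pdivlMl// mulrC; near: s.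
by apply: near_dist_le; rewrite divr_gt0.
Unshelve. all: by end_near. Qed.

Lemma Rintegral_itv_norm_le (f : R -> R) (a b C : R) : a <= b -> loc_integrable f ->
  (forall x, a <= x <= b -> `|f x| <= C) -> `|\int[mu]_(x in `[a, b]) f x| <= C * (b - a).
Proof.
move=> ab lf fC; rewrite -Rintegral_cst_itv//; apply: le_Rintegral_dom => //.
- by apply: measurable_funTS; exact: loc_integrableM.
- by apply: integrable_on_continuous; exact: cst_continuous.
Qed.

Lemma Rintegral_itv0_lipschitz (f : R -> R) (C s t : R) : loc_integrable f -> (forall x, `|f x| <= C) ->
  `|\int[mu]_(x in `[0, s]) f x - \int[mu]_(x in `[0, t]) f x| <= C * `|s - t|.
Proof.
move=> lf fC; have C0 : 0 <= C by exact: le_trans (fC 0).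
wlog st : s t / s <= t.
  by move=> h; have [st|/ltW ts] := leP s t; [exact: h|rewrite distrC (distrC s); exact: h].
rewrite (distrC s) (ger0_norm (_ : 0 <= t - s)) ?subr_ge0//.
have [s0|s0] := ltP s 0.
  rewrite (Rintegral_itv_gt _ s0) sub0r normrN; have [t0|t0] := ltP t 0.
    by rewrite (Rintegral_itv_gt _ t0) normr0 mulr_ge0// subr_ge0.
  apply: le_trans (Rintegral_itv_norm_le (C := C) t0 lf _) _ => //.
  by apply: ler_wpM2l => //; lra.
rewrite (Rintegral_itvD s0 st lf) opprD addNKr normrN.
exact: Rintegral_itv_norm_le.
Qed.

Lemma regular_admissible p t T : regular p -> `|t| <= T -> admissible (K * T) (p t).
Proof.
move=> [pb _ px] tT; split; first exact: lipschitz_continuous (px t).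
by move=> x; apply: le_trans (pb t x) _; rewrite ler_wpM2l.
Qed.

Lemma regular_continuous p x : regular p -> continuous (fun t => P (p t) x).
Proof.
move=> rp; have [_ pt _] := rp.
apply: (@local_lipschitz_continuous _ (fun T => Lp (K * T) * K)) => T s t sT tT; rewrite -mulrA.
exact: P_lip_p (regular_admissible rp sT) (regular_admissible rp tT) (pt s t) x.
Qed.

(* The integral over [0, t] vanishes for t < 0: everything is frozen at negative
   times, so that only derivatives at positive times are meaningful. *)
Definition picard_step (p : R -> R -> R) t x : R := \int[mu]_(s in `[0, t]) P (p s) x.

Lemma picard_step_regular p : regular p -> regular (picard_step p).
Proof.
move=> rp; have cP x := continuous_loc (regular_continuous (x := x) rp).
have bP s x : `|P (p s) x| <= K by exact: P_bound (regular_admissible rp (lexx `|s|)) x.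
have neg t x : t < 0 -> picard_step p t x = 0 by move=> t0; rewrite /picard_step Rintegral_itv_gt.
split.
- move=> t x; have [t0|t0] := ltP t 0; first by rewrite neg// normr0 mulr_ge0.
  by rewrite (ger0_norm t0) -[t in leRHS]subr0; exact: Rintegral_itv_norm_le.
- by move=> s t x; exact: Rintegral_itv0_lipschitz.
- move=> t x y; have [t0|t0] := ltP t 0; first by rewrite !neg// subrr normr0 !mulr_ge0.
  rewrite (ger0_norm t0) /picard_step -RintegralB_on//; [|exact: cP..].
  rewrite [leRHS](_ : _ = (Lx (K * t) * `|x - y|) * (t - 0)); last by ring.
  apply: Rintegral_itv_norm_le => //; first exact: loc_integrableB.
  move=> s /andP[s0 st]; apply: P_lip_x.
  by apply: regular_admissible => //; rewrite ger0_norm.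
Qed.

(* The weight exp (2 L t) turns the Lipschitz constant [L] into the contraction factor 1/2. *)
Lemma picard_step_contract p r T C : regular p -> regular r -> 0 <= C ->
  let L := Lp (K * T) in
  (forall s x, 0 <= s <= T -> `|p s x - r s x| <= C * expR (2 * L * s)) ->
  forall t x, 0 <= t <= T ->
    `|picard_step p t x - picard_step r t x| <= C * 2^-1 * expR (2 * L * t).
Proof.
move=> rp rr C0 L h t x /andP[t0 tT].
have cP q : regular q -> loc_integrable (fun t => P (q t) x).
  by move=> rq; exact: continuous_loc (regular_continuous rq).
rewrite /picard_step -RintegralB_on//; [|exact: cP..].
have pE : primitive_of (fun s => (C * 2^-1) * expR (2 * L * s)) (fun s => (C * 2^-1) * (2 * L * 1 * expR (2 * L * s))).
  apply: primitiveZ; apply: primitive_expR; first exact: primitive_id.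
  exact: cst_continuous.
have lE := proj1 pE.
apply: (@le_trans _ _ (\int[mu]_(s in `[0, t]) ((C * 2^-1) * (2 * L * 1 * expR (2 * L * s))))).
  apply: le_Rintegral_dom => //.
    by apply: measurable_funTS; apply: loc_integrableM; apply: loc_integrableB; exact: cP.
  move=> s; rewrite /= in_itv/= => /andP[s0 st]; have sT := le_trans st tT.
  have aS q : regular q -> admissible (K * T) (q s).
    by move=> rq; apply: regular_admissible => //; rewrite ger0_norm.
  apply: le_trans (P_lip_p (aS _ rp) (aS _ rr) _ x) _.
    by move=> y; apply: h; rewrite s0 sT.
  by rewrite -/L le_eqVlt; apply/orP; left; apply/eqP; field.
rewrite -(proj2 pE)//; have : 0 <= C * 2^-1 * expR (2 * L * 0) by rewrite !mulr_ge0 ?invr_ge0// expR_ge0.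
lra.
Qed.

Fixpoint picard_iter n : R -> R -> R := if n is m.+1 then picard_step (picard_iter m) else fun _ _ => 0.

Lemma picard_iter_regular n : regular (picard_iter n).
Proof.
elim: n => [|n IH]; last exact: picard_step_regular.
by split => *; rewrite /= ?subrr normr0 ?mulr_ge0.
Qed.

(** The first increment is at most K T and each step halves it in the weighted norm; the weight is
    finally bounded by its value at T. *)
Lemma picard_iter_cauchy n T t x : 0 <= T -> t <= T ->
  `|picard_iter n.+1 t x - picard_iter n t x| <= K * T * expR (2 * Lp (K * T) * T) * 2^-1 ^+ n.
Proof.
move=> T0 tT; have L0 := Lp0 (K * T).
have h2 m : 0 <= 2^-1 ^+ m :> R by rewrite exprn_ge0// invr_ge0.
have [t0|t0] := ltP t 0.
  rewrite [picard_iter n.+1 t x](_ : _ = 0); last by rewrite /= /picard_step Rintegral_itv_gt.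
  rewrite [picard_iter n t x](_ : _ = 0); last by case: n => // n; rewrite /= /picard_step Rintegral_itv_gt.
  by rewrite subrr normr0 !mulr_ge0// expR_ge0.
apply: (@le_trans _ _ (K * T * 2^-1 ^+ n * expR (2 * Lp (K * T) * t))); last first.
  rewrite [leRHS](_ : _ = K * T * 2^-1 ^+ n * expR (2 * Lp (K * T) * T)); last by ring.
  by rewrite ler_wpM2l ?mulr_ge0// ler_expR ler_wpM2l// mulr_ge0.
have {t0 tT} : 0 <= t <= T by rewrite t0.
elim: n t x => [|n IH] t x tT; last first.
  rewrite exprS (_ : K * T * _ = K * T * 2^-1 ^+ n * 2^-1); last by ring.
  apply: picard_step_contract => //; [exact: (picard_iter_regular n.+1)|exact: picard_iter_regular|].
  by rewrite !mulr_ge0.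
case/andP: tT => t0 tT; rewrite [picard_iter 0 t x]/= subr0 expr0 mulr1.
have [h _ _] := picard_iter_regular 1; apply: (le_trans (h t x)); rewrite ger0_norm//.
apply: (@le_trans _ _ (K * T)); first exact: ler_wpM2l.
rewrite ler_peMr ?mulr_ge0//; apply: le_trans (expR_ge1Dx _).
by rewrite lerDl !mulr_ge0.
Qed.

Definition picard_sol t x : R := limn (fun n => picard_iter n t x).

Lemma picard_sol_dist n T t x : 0 <= T -> t <= T ->
  `|picard_iter n t x - picard_sol t x| <= 2 * (K * T * expR (2 * Lp (K * T) * T)) * 2^-1 ^+ n.
Proof.
move=> T0 tT.
apply: (@geometric_lim (fun n => picard_iter n t x)) => k.
exact: picard_iter_cauchy.
Qed.

Lemma cvg_half_pow (C : R) : C * 2^-1 ^+ n @[n --> \oo] --> 0.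
Proof.
rewrite -(mulr0 C); apply: cvgM; first exact: cvg_cst.
by apply: cvg_expr; rewrite ger0_norm ?invr_ge0// invf_lt1// ltr1n.
Qed.

Lemma picard_cvg t x : picard_iter n t x @[n --> \oo] --> picard_sol t x.
Proof.
apply/cvgrPdistC_le => d d0.
have /cvgrPdistC_le/(_ d d0) := cvg_half_pow (2 * (K * `|t| * expR (2 * Lp (K * `|t|) * `|t|))).
apply: filterS => n; rewrite subr0; apply: le_trans; rewrite [leRHS]ger0_norm; last first.
  by rewrite !mulr_ge0// ?expR_ge0// exprn_ge0// invr_ge0.
by apply: picard_sol_dist => //; exact: ler_norm.
Qed.

Lemma cvg_norm_le (u : nat -> R) (l C : R) : u n @[n --> \oo] --> l ->
  (forall n, `|u n| <= C) -> `|l| <= C.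
Proof.
move=> ul uC; have cn : `|u n| @[n --> \oo] --> `|l| by exact: cvg_norm.
rewrite -(cvg_lim _ cn)//; apply: limr_le; first by apply/cvg_ex; eexists; exact: cn.
exact: nearW.
Qed.

Lemma picard_sol_regular : regular picard_sol.
Proof.
split.
- move=> t x; apply: (cvg_norm_le (@picard_cvg t x)) => n.
  by have [h _ _] := picard_iter_regular n.
- move=> s t x; apply: (cvg_norm_le (cvgB (@picard_cvg s x) (@picard_cvg t x))) => n.
  by have [_ h _] := picard_iter_regular n; exact: h.
- move=> t x y; apply: (cvg_norm_le (cvgB (@picard_cvg t x) (@picard_cvg t y))) => n.
  by have [_ _ h] := picard_iter_regular n; exact: h.
Qed.

(** By contraction the iterates also converge to the image of their limit under the Picard step. *)
Lemma picard_solE t x : picard_sol t x = \int[mu]_(s in `[0, t]) P (picard_sol s) x.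
Proof.
rewrite -/(picard_step picard_sol t x).
have rs := picard_sol_regular.
have rst := picard_step_regular rs.
have [t0|t0] := ltP t 0.
  have [h _ _] := rs.
  rewrite /picard_step Rintegral_itv_gt//; apply/cvg_lim => //.
  rewrite (_ : (fun n => _) = fun=> 0); first exact: cvg_cst.
  by apply/funext => -[//|n]; rewrite /= /picard_step Rintegral_itv_gt.
pose L := Lp (K * t); pose D n := 2 * (K * t * expR (2 * L * t)) * 2^-1 ^+ n.
have D0 n : 0 <= D n by rewrite !mulr_ge0// ?expR_ge0// exprn_ge0// invr_ge0.
have h n : `|picard_iter n.+1 t x - picard_step picard_sol t x| <= D n * 2^-1 * expR (2 * L * t).
  apply: (@picard_step_contract _ _ t) => //; first exact: picard_iter_regular.
    move=> s y /andP[s0 st]; apply: (@le_trans _ _ (D n)); first exact: picard_sol_dist.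
    rewrite ler_peMr//; apply: le_trans (expR_ge1Dx _).
    by rewrite lerDl !mulr_ge0.
  by rewrite t0 lexx.
have c : picard_iter n.+1 t x @[n --> \oo] --> picard_sol t x.
  by move: (@picard_cvg t x); rewrite -(cvg_shiftS (fun n => picard_iter n t x)).
apply/esym/(cvg_unique _ _ c) => //; apply/cvgrPdistC_le => d d0.
have /cvgrPdistC_le/(_ d d0) := cvg_half_pow (2 * (K * t * expR (2 * L * t)) * 2^-1 * expR (2 * L * t)).
apply: filterS => n; rewrite subr0; apply: le_trans; rewrite [leRHS]ger0_norm; last first.
  by rewrite !mulr_ge0// ?expR_ge0// ?exprn_ge0// ?invr_ge0// mulr_ge0// mulr_ge0.
apply: le_trans (h n) _; rewrite le_eqVlt; apply/orP; left; apply/eqP; rewrite /D; ring.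
Qed.

End picard.

(** * Change of variables *)

Section change_of_variables.
Context {R : realType}.
Notation mu := (@lebesgue_measure R).
Variables (phi psi q : R -> R).
Hypothesis phi_primitive : primitive_of phi q.
Hypothesis q_ge0 : forall x, 0 <= q x.
Hypothesis phiK : cancel phi psi.
Hypothesis psiK : cancel psi phi.

Let phi_mono : {homo phi : x y / x < y}.
Proof.
move=> x y xy; rewrite lt_neqAle (primitive_le phi_primitive q_ge0 (ltW xy)) andbT.
by apply/eqP => /(can_inj phiK) xyE; rewrite xyE ltxx in xy.
Qed.

Let le_phi x y : (phi x <= phi y) = (x <= y).
Proof.
have [xy|yx] := leP x y; first exact: primitive_le phi_primitive q_ge0 xy.
by apply/negbTE; rewrite -ltNge; exact: phi_mono.
Qed.

Let lt_phi x y : (phi x < phi y) = (x < y).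
Proof. by rewrite !ltNge le_phi. Qed.

Let mphi : measurable_fun setT phi.
Proof. exact: continuous_measurable_fun (primitive_of_continuous phi_primitive). Qed.

Let mq : measurable_fun setT q.
Proof. exact: loc_integrableM (proj1 phi_primitive). Qed.

Let mpsi : measurable_fun setT psi.
Proof.
by apply: nondecreasing_measurable => //= x y xy; rewrite -le_phi !psiK.
Qed.

(** The image under [phi] of the measure of density [q]. As [phi] is merely absolutely continuous,
    the substitution rule is drawn from the uniqueness of Lebesgue measure. *)
Definition image_measure (A : set (measurableTypeR R)) : \bar R := (\int[mu]_(x in phi @^-1` A) (q x)%:E)%E.

Let image_measure0 : image_measure set0 = 0%E.
Proof. by rewrite /image_measure preimage_set0 integral_set0. Qed.

Let image_measure_ge0 A : (0 <= image_measure A)%E.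
Proof. by apply: integral_ge0 => x _; rewrite lee_fin. Qed.

Let measurable_preimage (A : set R) : measurable A -> measurable (phi @^-1` A).
Proof. by move=> mA; rewrite -[X in measurable X]setTI; exact: mphi. Qed.

Let image_measure_sigma_additive : semi_sigma_additive image_measure.
Proof.
move=> A mA tA mUA; rewrite /image_measure preimage_bigcup ge0_integral_bigcup//=.
- apply: is_cvg_ereal_nneg_natsum_cond => n _ _.
  by apply: integral_ge0 => x _; rewrite lee_fin.
- move=> n; exact (measurable_preimage (mA n)).
- by apply/measurable_EFinP; exact: measurable_funTS.
- by move=> x _; rewrite lee_fin.
- by apply/trivIsetP => i j _ _ ij; rewrite -preimage_setI; move/trivIsetP : tA => ->//; rewrite preimage_set0.
Qed.

HB.instance Definition _ := isMeasure.Build _ _ _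
  image_measure image_measure0 image_measure_ge0 image_measure_sigma_additive.

Import HBNNSimple.

(** It suffices to treat ]a, b]: its preimage is ]psi a, psi b], whose mass is phi (psi b) - phi
    (psi a) = b - a. *)
Lemma image_measureE (A : set R) : measurable A -> mu A = image_measure A.
Proof.
move=> mA; refine (@lebesgue_measure_unique R image_measure _ A mA) => _ [[a b] _ <-] /=.
have E : phi @^-1` `]a, b] = `]psi a, psi b]%classic.
  by apply/seteqP; split => x; rewrite /= !in_itv/= -(lt_phi _ x) -(le_phi x) !psiK.
rewrite /image_measure E lebesgue_measure_itv/= lte_fin.
have [ab|ba] := ltP a b; last first.
  rewrite set_itv_ge ?integral_set0// bnd_simp -leNgt.
  by rewrite -le_phi !psiK.
have pab : psi a <= psi b by rewrite -le_phi !psiK ltW.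
rewrite integral_itv_obnd_cbnd; last by apply/measurable_EFinP; exact: measurable_funTS.
have iq : mu.-integrable `[psi a, psi b] (EFin \o q) by exact: (proj1 phi_primitive).
rewrite -EFinB -[in LHS](psiK b) -[in LHS](psiK a) (proj2 phi_primitive)// fineK//.
exact: (@integrable_fin_num _ _ _ mu _ (measurable_itv _) _ iq).
Qed.

Lemma integral_change_nnsfun (h : {nnsfun R >-> R}) :
  (\int[mu]_x (h (phi x) * q x)%:E = \int[mu]_x (h x)%:E)%E.
Proof.
have mhp r : measurable ((h \o phi) @^-1` [set r]).
  by rewrite comp_preimage; exact: measurable_preimage.
transitivity (\int[mu]_x (\sum_(r \in range h) (r * (\1_((h \o phi) @^-1` [set r]) x * q x))%:E))%E.
  apply: eq_integral => x _; rewrite fimfunE fsumEFin//; congr EFin.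
  rewrite fsbig_finite// mulr_suml -fsbig_finite//.
  by apply: eq_fsbigr => r _; rewrite mulrA.
have term0 r x : 0 <= r * (\1_((h \o phi) @^-1` [set r]) x * q x).
  rewrite mulrA; apply: mulr_ge0 => //.
  by have := @nnfun_muleindic_ge0 _ _ _ h r (phi x); rewrite -EFinM lee_fin.
rewrite ge0_integral_fsum//; last 2 first.
- move=> r; apply/measurable_EFinP; apply: measurable_funM => //.
  apply: measurable_funM => //; exact (measurable_indic (mhp r)).
- by move=> r x _; rewrite lee_fin.
transitivity (\int[mu]_x (\sum_(r \in range h) (r * \1_(h @^-1` [set r]) x)%:E))%E; last first.
  by apply: eq_integral => x _; rewrite /= fimfunE -fsumEFin.
rewrite ge0_integral_fsum//; last 2 first.
- move=> r; apply/measurable_EFinP; apply: measurable_funM => //.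
  exact (measurable_indic (@measurable_funPTI _ _ _ _ h _ (measurable_set1 r))).
- by move=> r x _; rewrite EFinM; exact: nnfun_muleindic_ge0.
apply: eq_fsbigr => r rh.
have r0 : 0 <= r by move: rh; rewrite inE => -[x _ <-].
have mh : measurable (h @^-1` [set r]) by exact: (@measurable_funPTI _ _ _ _ h _ (measurable_set1 r)).
transitivity (r%:E * \int[mu]_x (\1_(h @^-1` [set r]) x)%:E)%E; last first.
  under [RHS]eq_integral do rewrite EFinM.
  by rewrite ge0_integralZl//; apply/measurable_EFinP; exact (measurable_indic mh).
under eq_integral do rewrite EFinM.
rewrite ge0_integralZl//; last 2 first.
- apply/measurable_EFinP; apply: measurable_funM => //; exact (measurable_indic (mhp r)).
- by move=> x _; rewrite lee_fin mulr_ge0.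
have -> : (\int[mu]_x (\1_(h @^-1` [set r]) x)%:E = image_measure (h @^-1` [set r]))%E.
  by rewrite -image_measureE// integral_indic// setIT.
congr (_ * _)%E; rewrite /image_measure [RHS]integral_mkcond.
apply: eq_integral => x _; rewrite patchE indicE.
by rewrite (_ : (x \in _) = (x \in (h \o phi) @^-1` [set r]))//; case: (x \in _); rewrite ?mul1r ?mul0r.
Qed.

Lemma ge0_integral_change (G : R -> R) : measurable_fun setT G -> (forall x, 0 <= G x) ->
  (\int[mu]_x (G (phi x) * q x)%:E = \int[mu]_x (G x)%:E)%E.
Proof.
move=> mG G0.
have mEG : measurable_fun setT (EFin \o G) by exact/measurable_EFinP.
pose h n := nnsfun_approx measurableT mEG n.
have ch x : (h n x)%:E @[n --> \oo] --> (G x)%:E.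
  by apply: (@cvg_nnsfun_approx _ _ _ _ measurableT _ mEG _ x) => // y _; rewrite lee_fin.
have ndh x : {homo (fun n => (h n x)%:E) : m n / (m <= n)%N >-> (m <= n)%E}.
  by move=> m n mn; rewrite lee_fin; exact/lefP/nd_nnsfun_approx.
have c1 : (\int[mu]_x (h n x)%:E)%E @[n --> \oo] --> (\int[mu]_x (G x)%:E)%E.
  have -> : (\int[mu]_x (G x)%:E = \int[mu]_x limn (fun n => (h n x)%:E))%E.
    by apply: eq_integral => x _; apply/esym/cvg_lim.
  apply: cvg_monotone_convergence => //.
  - move=> n; apply/measurable_EFinP; exact (@measurable_funPT _ _ _ _ (h n)).
  - by move=> n x _; rewrite lee_fin.
have c2 : (\int[mu]_x (h n (phi x) * q x)%:E)%E @[n --> \oo] --> (\int[mu]_x (G (phi x) * q x)%:E)%E.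
  have -> : (\int[mu]_x (G (phi x) * q x)%:E = \int[mu]_x limn (fun n => (h n (phi x) * q x)%:E))%E.
    apply: eq_integral => x _; apply/esym/cvg_lim => //.
    by rewrite EFinM; under eq_fun do rewrite EFinM; apply: cvgeZr.
  apply: cvg_monotone_convergence => //.
  - move=> n; apply/measurable_EFinP; apply: measurable_funM => //.
    exact (measurableT_comp (@measurable_funPT _ _ _ _ (h n)) mphi).
  - by move=> n x _; rewrite lee_fin mulr_ge0.
  - move=> x _ m n mn; rewrite lee_fin ler_wpM2r//; have := ndh (phi x) m n mn.
    by rewrite lee_fin.
have e n : (\int[mu]_x (h n (phi x) * q x)%:E = \int[mu]_x (h n x)%:E)%E by exact: integral_change_nnsfun.
by apply: (cvg_unique _ _ c1) => //; move: c2; under eq_fun do rewrite e.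
Qed.

Lemma measurable_inverse : measurable_fun setT psi.
Proof. exact: mpsi. Qed.

Lemma integral_change (F : R -> R) : measurable_fun setT F ->
  integrable_on setT (fun x => F x * q x) ->
  integrable_on setT (fun y => F (psi y)) /\ \int[mu]_y F (psi y) = \int[mu]_x (F x * q x).
Proof.
move=> mF iF.
have key (H : R -> R) : measurable_fun setT H -> (forall x, 0 <= H x) -> integrable_on setT (fun x => H x * q x) ->
    integrable_on setT (fun y => H (psi y)) /\ \int[mu]_y H (psi y) = \int[mu]_x (H x * q x).
  move=> mH H0 iH; have mHp : measurable_fun setT (fun y => H (psi y)) by exact: (measurableT_comp mH mpsi).
  have := @ge0_integral_change (fun y => H (psi y)) mHp (fun y => H0 _).
  have -> : (\int[mu]_x (H (psi (phi x)) * q x)%:E = \int[mu]_x (H x * q x)%:E)%E.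
    by apply: eq_integral => x _; rewrite phiK.
  move=> E; split; last by rewrite /Rintegral E.
  apply/integrable_onP => //; split => //.
  have -> : (\int[mu]_y `|(H (psi y))%:E| = \int[mu]_y (H (psi y))%:E)%E.
    by apply: eq_integral => x _; rewrite gee0_abs// lee_fin.
  rewrite -E; have /(integrable_onP _ measurableT)[_] := iH; apply: le_lt_trans.
  rewrite le_eqVlt; apply/orP; left; apply/eqP; apply: eq_integral => x _.
  by rewrite gee0_abs// lee_fin mulr_ge0.
have iaF : integrable_on setT (fun x => `|F x| * q x).
  apply: (@integrable_setT_le _ (fun x => `|F x * q x|)).
  - by apply: measurable_funM => //; exact: measurableT_comp.
  - exact: integrable_on_norm.
  - by move=> x; rewrite normrM normr_id -normrM.
have [i1 e1] := key (fun x => `|F x|) (measurableT_comp (@normr_measurable _ _) mF) (fun x => normr_ge0 _) iaF.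
(* [F] is the difference of the nonnegative functions F + |F| and |F|. *)
have [|||i2 e2] := key (fun x => F x + `|F x|).
- by apply: measurable_funD => //; exact: measurableT_comp.
- by move=> x; have := lerNnormlW (lexx `|F x|); lra.
- rewrite (_ : (fun x => _) = (fun x => F x * q x + `|F x| * q x)); first exact: integrable_onD.
  by apply/funext => x; rewrite mulrDl.
have E : (fun y => F (psi y)) = (fun y => (F (psi y) + `|F (psi y)|) - `|F (psi y)|).
  by apply/funext => y; rewrite addrK.
rewrite E; split; first exact: integrable_onB.
rewrite RintegralB_on// e1 e2 -RintegralB_on//.
  by apply: eq_RintegralT => x; ring.
rewrite (_ : (fun x => _) = (fun x => F x * q x + `|F x| * q x)); first exact: integrable_onD.
by apply/funext => x; rewrite mulrDl.
Qed.

End change_of_variables.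

(** * The Lagrangian system *)

Section lagrangian_operators.
Context {R : realType}.
Notation mu := (@lebesgue_measure R).
Implicit Types (p r f : R -> R) (M d x y : R) (s : bool).

Lemma expR_lipschitz M x y : x <= M -> y <= M -> `|expR x - expR y| <= expR M * `|x - y|.
Proof.
move=> xM yM; wlog xy : x y xM yM / y <= x.
  by move=> h; have [?|/ltW ?] := leP y x; [exact: h|rewrite distrC (distrC x); exact: h].
rewrite !ger0_norm ?subr_ge0 ?ler_expR//.
apply: (@le_trans _ _ (expR x * (x - y))); last by rewrite ler_wpM2r ?subr_ge0// ler_expR.
have -> : expR x - expR y = expR x * (1 - expR (y - x)).
  by rewrite mulrBr mulr1 -expRD; congr (_ - expR _); ring.
by rewrite ler_wpM2l ?expR_ge0//; have := expR_ge1Dx (y - x); lra.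
Qed.

(** For a <= b the difference is at most exp(-a) (b - a) <= c a exp(-a), and a exp(-a) <= 1:
    relative closeness suffices, however large a and b are. *)
Lemma expRN_relative_lipschitz (a b c : R) : 0 <= a -> 0 <= b -> 0 <= c ->
  a <= (1 + c) * b -> b <= (1 + c) * a -> `|expR (- a) - expR (- b)| <= c.
Proof.
wlog ab : a b / a <= b.
  by move=> h; have [?|/ltW ?] := leP a b; [exact: h|rewrite distrC => *; exact: h].
move=> a0 b0 c0 _ bc; rewrite ger0_norm ?subr_ge0 ?ler_expR ?lerN2//.
have -> : expR (- a) - expR (- b) = expR (- a) * (1 - expR (a - b)).
  by rewrite mulrBr mulr1 -expRD; congr (_ - expR _); ring.
apply: (@le_trans _ _ (expR (- a) * (c * a))).
  rewrite ler_wpM2l ?expR_ge0//; have := expR_ge1Dx (a - b); lra.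
have ea : a * expR (- a) <= 1.
  by rewrite expRN -ler_pdivlMr ?invr_gt0 ?expR_gt0// invrK mul1r; have := expR_ge1Dx a; lra.
rewrite [leLHS](_ : _ = c * (a * expR (- a))); last by ring.
by rewrite -[leRHS]mulr1 ler_wpM2l.
Qed.

Lemma primitive_lipschitz (F f : R -> R) (C : R) : primitive_of F f -> (forall x, `|f x| <= C) ->
  forall x y, `|F x - F y| <= C * `|x - y|.
Proof.
move=> pF fC x y; wlog xy : x y / y <= x.
  by move=> h; have [?|/ltW ?] := leP y x; [exact: h|rewrite distrC (distrC x); exact: h].
rewrite (proj2 pF)// (ger0_norm (_ : 0 <= x - y)) ?subr_ge0//.
by apply: Rintegral_itv_norm_le => //; exact: (proj1 pF).
Qed.

Lemma mean_norm_le (a b C : R) : `|a| <= C -> `|b| <= C -> `|2^-1 * (a + b)| <= C.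
Proof. rewrite !ler_norml => /andP[? ?] /andP[? ?]; apply/andP; split; lra. Qed.

Lemma admissible_expR M p x : admissible M p -> expR (- M) <= expR (p x) <= expR M.
Proof.
by move=> [_ /(_ x)]; rewrite ler_norml !ler_expR.
Qed.

Lemma admissible_expR_continuous M p : admissible M p -> continuous (fun x => expR (p x)).
Proof.
by move=> [cp _] x; apply: continuous_comp; [exact: cp|exact: continuous_expR].
Qed.

Variables (m0 : R -> R) (K : R).
Hypothesis m0_integrable : integrable_on setT m0.
Hypothesis m0_bound : forall x, `|m0 x| <= K.

Let K0 : 0 <= K. Proof. exact: le_trans (m0_bound 0). Qed.

(** The flow up to a constant in x: only its differences enter the kernel, so it is normalised to
    vanish at 0. *)
Definition label p := sprim (fun x => expR (p x)).
Definition density p x := m0 x * expR (p x).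
Definition side s p := kint s (label p) (density p).
(** [velocity] and [strain] are u and u_x read along the flow with log-Jacobian [p]. *)
Definition velocity p x : R := 2^-1 * (side true p x + side false p x).
Definition strain p x : R := 2^-1 * (side false p x - side true p x).
Definition mass : R := \int[mu]_x `|m0 x|.

Lemma mass_ge0 : 0 <= mass.
Proof. by apply: Rintegral_ge0. Qed.

Lemma label_primitive M p : admissible M p -> primitive_of (label p) (fun x => expR (p x)).
Proof. by move=> ap; apply: sprim_primitive; apply: continuous_loc; exact: admissible_expR_continuous ap. Qed.

Lemma label_measurable M p : admissible M p -> measurable_fun setT (label p).
Proof.
by move=> ap; apply: continuous_measurable_fun; exact: primitive_of_continuous (label_primitive ap).
Qed.

Lemma density_integrable M p : admissible M p -> integrable_on setT (density p).
Proof.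
move=> ap; rewrite /density; under eq_fun do rewrite mulrC.
apply: (@integrable_on_bounded _ _ (expR M)) => //.
  exact: continuous_measurable_fun (admissible_expR_continuous ap).
by move=> x _; rewrite ger0_norm ?expR_ge0//; case/andP: (admissible_expR x ap).
Qed.

Lemma density_bound p x : `|density p x| <= K * expR (p x).
Proof. by rewrite normrM [`|expR _|]ger0_norm ?expR_ge0// ler_wpM2r ?expR_ge0. Qed.

Lemma side_bound M p : admissible M p -> forall s x, `|side s p x| <= K.
Proof.
move=> ap s x; apply: (kint_sup_bound s x (label_primitive ap)) => //.
- exact: admissible_expR_continuous ap.
- exact: density_integrable ap.
- by move=> y; exact: density_bound.
Qed.

Lemma velocity_bound M p : admissible M p -> forall x, `|velocity p x| <= K.
Proof.
by move=> ap x; apply: mean_norm_le; exact: side_bound ap _ x.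
Qed.

Lemma strain_bound M p : admissible M p -> forall x, `|strain p x| <= K.
Proof.
by move=> ap x; apply: mean_norm_le; rewrite ?normrN; exact: side_bound ap _ x.
Qed.

Lemma side_primitive M p s : admissible M p ->
  primitive_of (side s p) (fun x => sgs s * (density p x - expR (p x) * side s p x)).
Proof.
move=> ap; apply: kint_primitive (label_primitive ap) _ _ (density_integrable ap).
- exact: admissible_expR_continuous ap.
- by move=> y; exact: expR_ge0.
Qed.

Lemma velocity_primitive M p : admissible M p ->
  primitive_of (velocity p) (fun x => expR (p x) * strain p x).
Proof.
move=> ap; have pr s := side_primitive s ap.
apply: primitive_eq (primitiveZ 2^-1 (primitiveD (pr true) (pr false))) _ _ => // x.
by rewrite /strain /sgs; field.
Qed.

Lemma strain_primitive M p : admissible M p ->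
  primitive_of (strain p) (fun x => expR (p x) * velocity p x - density p x).
Proof.
move=> ap; have pr s := side_primitive s ap.
apply: primitive_eq (primitiveZ 2^-1 (primitiveB (pr false) (pr true))) _ _ => // x.
by rewrite /velocity /sgs; field.
Qed.

(** The x-derivative of the strain has two terms, each at most expR M * K. *)
Lemma strain_lipschitz_x M p : admissible M p ->
  forall x y, `|strain p x - strain p y| <= 2 * K * expR M * `|x - y|.
Proof.
move=> ap; apply: primitive_lipschitz (strain_primitive ap) _ => x.
have /andP[_ h] := admissible_expR x ap.
have h1 : `|expR (p x) * velocity p x| <= expR M * K.
  by rewrite normrM (ger0_norm (expR_ge0 _)) ler_pM ?expR_ge0//; exact: velocity_bound ap x.
have h2 : `|density p x| <= expR M * K.
  by apply: le_trans (density_bound p x) _; rewrite mulrC ler_wpM2r.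
by apply: (le_trans (ler_normB _ _)); lra.
Qed.

(* The relative form of the estimate is what makes the difference of the kernels
   bounded uniformly in [x] and [y], by [expRN_relative_lipschitz]. *)
Lemma label_relative p r M d x y : admissible M p -> admissible M r -> (forall x, `|p x - r x| <= d) ->
  `|label p x - label p y| <= (1 + expR (2 * M) * d) * `|label r x - label r y|.
Proof.
move=> ap ar pr; have d0 : 0 <= d by exact: le_trans (pr 0).
wlog : x y / y <= x; last move=> xy.
  by move=> h; have [yx|/ltW xy] := leP y x; [exact (h x y yx)|rewrite (distrC (label p x)) [X in _ <= _ * X]distrC; exact (h y x xy)].
have pp := label_primitive ap; have prr := label_primitive ar.
rewrite (proj2 pp _ _ xy) (proj2 prr _ _ xy) ger0_norm ?[`|_|]ger0_norm; last 2 first.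
- by apply: Rintegral_ge0 => z _; exact: expR_ge0.
- by apply: Rintegral_ge0 => z _; exact: expR_ge0.
rewrite -RintegralZ_on//; last exact: (proj1 prr).
apply: le_Rintegral_on => //; [exact: (proj1 pp)|by apply: integrable_onZ => //; exact: (proj1 prr)|].
move=> z _; rewrite mulrDl mul1r -lerBlDl.
have /andP[lo _] := admissible_expR z ar.
have := @expR_lipschitz M (p z) (r z).
have /(_ z) hp := proj2 ap; have /(_ z) hr := proj2 ar.
move=> /(_ (le_trans (ler_norm _) hp) (le_trans (ler_norm _) hr)) h.
apply: (le_trans (ler_norm _)); apply: (le_trans h).
apply: (@le_trans _ _ (expR M * d)); first by rewrite ler_wpM2l ?expR_ge0.
have eM : expR M = expR (2 * M) * expR (- M) by rewrite -expRD; congr expR; ring.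
rewrite eM [leLHS](_ : _ = expR (2 * M) * d * expR (- M)); last by ring.
by rewrite ler_wpM2l// mulr_ge0 ?expR_ge0.
Qed.

(** The first term comes from varying the kernel, through [label_relative], against a density at
    most |m0| exp(M); the second from varying the density. *)
Definition operator_lipschitz M : R := (expR (2 * M) * expR M + expR M) * mass.

Lemma operator_lipschitz_ge0 M : 0 <= operator_lipschitz M.
Proof. by rewrite !mulr_ge0 ?mass_ge0// addr_ge0// ?mulr_ge0 ?expR_ge0. Qed.

Lemma side_lipschitz s p r M d : admissible M p -> admissible M r -> (forall x, `|p x - r x| <= d) ->
  forall x, `|side s p x - side s r x| <= operator_lipschitz M * d.
Proof.
move=> ap ar pr x; have d0 : 0 <= d by exact: le_trans (pr 0).
have rp y : `|r y - p y| <= d by rewrite distrC.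
have ip := integrable_kernel s x (label_measurable ap) (density_integrable ap).
have ir := integrable_kernel s x (label_measurable ar) (density_integrable ar).
rewrite /side /kint -RintegralB_on//.
rewrite [leRHS](_ : _ = \int[mu]_y ((expR (2 * M) * expR M + expR M) * d * `|m0 y|)); last first.
  by rewrite RintegralZ_on//; [rewrite /operator_lipschitz /mass; ring|exact: integrable_on_norm].
apply: le_Rintegral_dom => //.
- by apply: integrable_onM; exact: integrable_onB.
- by apply: integrable_onZ => //; exact: integrable_on_norm.
move=> y _.
have kd : `|kernel s (label p) x y - kernel s (label r) x y| <= expR (2 * M) * d.
  rewrite /kernel -mulrBr normrM; have /andP[i0 i1] := indic_le1 (half s x) y.
  rewrite (ger0_norm i0) (@le_trans _ _ (1 * `|expR (- `|label p x - label p y|) - expR (- `|label r x - label r y|)|))//.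
    exact: ler_wpM2r.
  rewrite mul1r; apply: expRN_relative_lipschitz => //.
  - by rewrite mulr_ge0 ?expR_ge0.
  - exact: label_relative.
  - exact: label_relative.
have hp := proj2 ap y; have hr := proj2 ar y.
have ed : `|expR (p y) - expR (r y)| <= expR M * d.
  apply: le_trans (expR_lipschitz (le_trans (ler_norm _) hp) (le_trans (ler_norm _) hr)) _.
  by rewrite ler_wpM2l ?expR_ge0.
have /andP[_ eM] := admissible_expR y ap.
have /andP[k0 k1] := kernel_bound s (label r) x y.
have alg (a b c e e' : R) : a * (c * e) - b * (c * e') = (a - b) * (c * e) + b * (c * (e - e')) by ring.
rewrite /density alg.
move: (kernel s (label p) x y) (kernel s (label r) x y) kd k0 k1 => a b ab b0 b1.
apply: (le_trans (ler_normD _ _)); rewrite !normrM (ger0_norm b0) (ger0_norm (expR_ge0 (p y))).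
have h1 : `|a - b| * (`|m0 y| * expR (p y)) <= expR (2 * M) * d * (`|m0 y| * expR M).
  by rewrite ler_pM// ?mulr_ge0 ?expR_ge0// ler_wpM2l.
have h2 : b * (`|m0 y| * `|expR (p y) - expR (r y)|) <= 1 * (`|m0 y| * (expR M * d)).
  by rewrite ler_pM// ?mulr_ge0// ler_wpM2l.
lra.
Qed.

Lemma strain_lipschitz p r M d : admissible M p -> admissible M r -> (forall x, `|p x - r x| <= d) ->
  forall x, `|strain p x - strain r x| <= operator_lipschitz M * d.
Proof.
move=> ap ar pr x; have rp y : `|r y - p y| <= d by rewrite distrC.
have alg (a b a' b' : R) : 2^-1 * (b - a) - 2^-1 * (b' - a') = 2^-1 * ((b - b') + (a' - a)) by ring.
rewrite /strain alg; apply: mean_norm_le; first exact: side_lipschitz.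
exact: side_lipschitz.
Qed.

Lemma velocity_lipschitz p r M d : admissible M p -> admissible M r -> (forall x, `|p x - r x| <= d) ->
  forall x, `|velocity p x - velocity r x| <= operator_lipschitz M * d.
Proof.
move=> ap ar pr x.
have alg (a b a' b' : R) : 2^-1 * (b + a) - 2^-1 * (b' + a') = 2^-1 * ((b - b') + (a - a')) by ring.
rewrite /velocity alg; apply: mean_norm_le; first exact: side_lipschitz.
exact: side_lipschitz.
Qed.

End lagrangian_operators.

(** * The flow, its Jacobian and its inverse *)

Section flow.
Context {R : realType}.
Notation mu := (@lebesgue_measure R).
Implicit Types (s t r a b x y T M : R).
Variables (m0 : R -> R) (K : R).
Hypothesis m0_integrable : integrable_on setT m0.
Hypothesis m0_bound : forall x, `|m0 x| <= K.

Let K0 : 0 <= K. Proof. exact: le_trans (m0_bound 0). Qed.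

Definition logjac : R -> R -> R := picard_sol (strain m0).
Definition jac t x : R := expR (logjac t x).
Definition vel t x : R := velocity m0 (logjac t) x.
Definition str t x : R := strain m0 (logjac t) x.
(** Unlike [label], this moves with the velocity, so that it transports the momentum; the two differ
    by a function of time. *)
Definition flow t x : R := x + \int[mu]_(s in `[0, t]) vel s x.

Let strain_lip_x M p : admissible M p ->
  forall x y, `|strain m0 p x - strain m0 p y| <= 2 * K * expR M * `|x - y|.
Proof. exact: strain_lipschitz_x. Qed.

Let lip_ge0 M : 0 <= 2 * K * expR M.
Proof. by rewrite !mulr_ge0 ?expR_ge0. Qed.

Lemma logjac_regular : regular K (fun M => 2 * K * expR M) logjac.
Proof.
apply: (@picard_sol_regular _ _ _ _ (operator_lipschitz m0)) => //.
- exact: operator_lipschitz_ge0.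
- by move=> M p ap; exact: strain_bound ap.
- by move=> M p r d ap ar pr; exact: strain_lipschitz ap ar pr.
Qed.

Lemma logjacE t x : logjac t x = \int[mu]_(s in `[0, t]) str s x.
Proof.
apply: (@picard_solE _ _ K (fun M => 2 * K * expR M) (operator_lipschitz m0)) => //.
- exact: operator_lipschitz_ge0.
- by move=> M p ap; exact: strain_bound ap.
- by move=> M p r d ap ar pr; exact: strain_lipschitz ap ar pr.
Qed.

Lemma logjac_admissible t T : `|t| <= T -> admissible (K * T) (logjac t).
Proof.
apply: (@regular_admissible _ (strain m0) K (fun M => 2 * K * expR M)); last exact: logjac_regular.
by move=> M p ap; exact: strain_bound ap.
Qed.

Let adm t : admissible (K * `|t|) (logjac t).
Proof. exact: logjac_admissible. Qed.

Lemma logjac_neg t x : t <= 0 -> logjac t x = 0.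
Proof.
rewrite logjacE le_eqVlt => /predU1P[->|t0]; first exact: Rintegral_itv1.
exact: Rintegral_itv_gt.
Qed.

Lemma jac_gt0 t x : 0 < jac t x. Proof. exact: expR_gt0. Qed.

Lemma jac_continuous t : continuous (jac t).
Proof. exact: admissible_expR_continuous (adm t). Qed.

Lemma jac_bounds t T x : `|t| <= T -> expR (- (K * T)) <= jac t x <= expR (K * T).
Proof. by move=> tT; exact: admissible_expR (logjac_admissible tT). Qed.

Lemma vel_bound t x : `|vel t x| <= K.
Proof. exact: velocity_bound (adm t) x. Qed.

Lemma str_bound t x : `|str t x| <= K.
Proof. exact: strain_bound (adm t) x. Qed.

Lemma vel_primitive t : primitive_of (vel t) (fun x => jac t x * str t x).
Proof. exact: velocity_primitive (adm t). Qed.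

Let continuous_time (P : (R -> R) -> R -> R) x :
  (forall M p, admissible M p -> forall x, `|P p x| <= K) ->
  (forall (M : R) (p r : R -> R) (d : R), admissible M p -> admissible M r ->
   (forall x, `|p x - r x| <= d) -> forall x, `|P p x - P r x| <= operator_lipschitz m0 M * d) ->
  continuous (fun t => P (logjac t) x).
Proof.
move=> h1 h2.
exact: (@regular_continuous _ P K (fun M => 2 * K * expR M) (operator_lipschitz m0) h1 h2 _ x logjac_regular).
Qed.

Lemma str_continuous_time x : continuous (str^~ x).
Proof.
apply: (@continuous_time (strain m0)); first by move=> M p ap; exact: strain_bound ap.
by move=> M p r d ap ar pr; exact: strain_lipschitz ap ar pr.
Qed.

Lemma vel_continuous_time x : continuous (vel^~ x).
Proof.
apply: (@continuous_time (velocity m0)); first by move=> M p ap; exact: velocity_bound ap.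
by move=> M p r d ap ar pr; exact: velocity_lipschitz ap ar pr.
Qed.

Lemma is_derive_itv0 (f : R -> R) (t : R) : continuous f -> 0 < t ->
  is_derive t (1 : R) (fun t => \int[mu]_(s in `[0, t]) f s) (f t).
Proof.
move=> cf t0; have lf := continuous_loc cf.
apply: near_eq_is_derive (primitive_is_derive (sprim_primitive lf) cf t).
near=> s; rewrite /sprim (@Rintegral_itv_gt _ _ s 0) ?subr0//.
by near: s; exact: lt_nbhsr.
Unshelve. all: by end_near. Qed.

Lemma logjac_derive t x : 0 < t -> is_derive t (1 : R) (logjac^~ x) (str t x).
Proof.
move=> t0; rewrite (_ : logjac^~ x = (fun t => \int[mu]_(s in `[0, t]) str s x)).
  by apply: is_derive_itv0 => //; exact: str_continuous_time.
by apply/funext => s; exact: logjacE.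
Qed.

Lemma jac_derive t x : 0 < t -> is_derive t (1 : R) (jac^~ x) (jac t x * str t x).
Proof. by move=> t0; apply: is_derive_comp1; exact: logjac_derive. Qed.

Lemma flow_derive t x : 0 < t -> is_derive t (1 : R) (flow^~ x) (vel t x).
Proof.
move=> t0; rewrite -[vel t x]add0r.
apply: is_deriveD; apply: is_derive_itv0 => //; exact: vel_continuous_time.
Qed.

Lemma flow_lipschitz_time s t x : `|flow s x - flow t x| <= K * `|s - t|.
Proof.
have alg (a b c : R) : (a + b) - (a + c) = b - c by ring.
rewrite /flow alg; apply: Rintegral_itv0_lipschitz; last by move=> r; exact: vel_bound.
by apply: continuous_loc; exact: vel_continuous_time.
Qed.

Lemma flow_neg t x : t <= 0 -> flow t x = x.
Proof.
rewrite /flow le_eqVlt => /predU1P[->|t0]; first by rewrite Rintegral_itv1 addr0.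
by rewrite Rintegral_itv_gt ?addr0.
Qed.

Lemma jac_lipschitz_time s t T x : `|s| <= T -> `|t| <= T ->
  `|jac s x - jac t x| <= expR (K * T) * (K * `|s - t|).
Proof.
move=> sT tT; have [_ h _] := logjac_regular.
have b r : `|r| <= T -> logjac r x <= K * T.
  by move=> rT; exact: le_trans (ler_norm _) (proj2 (logjac_admissible rT) x).
apply: le_trans (expR_lipschitz (b _ sT) (b _ tT)) _.
by rewrite ler_wpM2l ?expR_ge0.
Qed.

Lemma jac_integral_derive a b t : 0 < t ->
  is_derive t (1 : R) (fun t => \int[mu]_(x in `[a, b]) jac t x)
    (\int[mu]_(x in `[a, b]) (jac t x * str t x)).
Proof.
(* Bounds the time derivative of [jac] on the window ]0, 2 t[ around t. *)
move=> t0; pose C := expR (K * (2 * t)) * K.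
have i0 : `](0 : R), (2 * t)[%classic t by rewrite /= in_itv/=; apply/andP; split; lra.
have h1 (s : R) : `](0 : R), (2 * t)[%classic s -> mu.-integrable `[a, b] (EFin \o jac s).
  by move=> _; apply: (continuous_loc (@jac_continuous s)).
have h2 (s y : R) : `](0 : R), (2 * t)[%classic s -> `[a, b]%classic y -> derivable (jac^~ y) s 1.
  by rewrite /= in_itv/= => /andP[s0 _] _; case: (jac_derive y s0).
have pE (s y : R) : 0 < s -> partial1of2 jac s y = jac s y * str s y.
  by move=> s0; rewrite /partial1of2 derive1E; case: (jac_derive y s0).
have C0 : 0 <= C by rewrite mulr_ge0 ?expR_ge0.
have h3 : mu.-integrable `[a, b] (EFin \o (fun=> C)).
  by apply: (continuous_loc (@cst_continuous _ _ C)).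
have h4 (s y : R) : `](0 : R), (2 * t)[%classic s -> `[a, b]%classic y -> `|partial1of2 jac s y| <= C.
  rewrite /= in_itv/= => /andP[s0 st] _; rewrite pE// normrM.
  rewrite ler_pM// ?str_bound// gtr0_norm ?jac_gt0//.
  have sT : `|s| <= 2 * t by rewrite gtr0_norm// ltW.
  by case/andP: (jac_bounds y sT).
have d := @derivable_under_integral R _ _ mu jac `[a, b]%classic (measurable_itv _) t 0 (2 * t) i0 h1 h2 (fun=> C) (fun=> C0) h3 h4.
have e := @differentiation_under_integral R _ _ mu jac `[a, b]%classic (measurable_itv _) t 0 (2 * t) i0 h1 h2 (fun=> C) (fun=> C0) h3 h4.
split; first exact: d.
rewrite -derive1E e; apply: eq_Rintegral => y _; exact: pE.
Qed.

Lemma jac_integral_continuous a b : continuous (fun t => \int[mu]_(x in `[a, b]) jac t x).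
Proof.
have [ab|ba] := leP a b; last first.
  by under eq_fun do rewrite Rintegral_itv_gt//; exact: cst_continuous.
apply: (@local_lipschitz_continuous _ _ (fun T => expR (K * T) * K * (b - a))) => T s t sT tT.
have lj r : loc_integrable (jac r) by apply: continuous_loc; exact: jac_continuous.
rewrite -RintegralB_on//; [|exact: lj..].
rewrite [leRHS](_ : _ = expR (K * T) * (K * `|s - t|) * (b - a)); last by ring.
apply: Rintegral_itv_norm_le => //; first exact: loc_integrableB.
by move=> x _; exact: jac_lipschitz_time.
Qed.

Lemma flow_continuous_time x : continuous (flow^~ x).
Proof. exact: lipschitz_continuous (fun s t => flow_lipschitz_time s t x). Qed.

Lemma constant_of_derive0 (H : R -> R) (t : R) : 0 <= t -> continuous H ->
  (forall s : R, 0 < s -> is_derive s (1 : R) H 0) -> H t = H 0.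
Proof.
rewrite le_eqVlt => /predU1P[<-//|t0] cH dH.
have [|c _] := @MVT _ H (fun=> 0) 0 t t0 _ (continuous_subspaceT cH).
  by move=> s; rewrite in_itv/= => /andP[s0 _]; exact: dH.
by rewrite mul0r => /eqP; rewrite subr_eq0 => /eqP.
Qed.

(** The ODE was solved for a candidate log-Jacobian; here it becomes that of the flow. Flow
    increment minus integral of [jac] vanishes at time 0, and its time derivative is zero by
    [vel_primitive]. *)
Lemma flow_primitive t : primitive_of (flow t) (jac t).
Proof.
split; first by apply: continuous_loc; exact: jac_continuous.
move=> a b ab; have [t0|/ltW t0] := leP t 0.
  rewrite !flow_neg// (@eq_Rintegral _ _ _ _ _ (fun=> 1)).
    by rewrite Rintegral_cst_itv// mul1r.
  by move=> x _; rewrite /jac logjac_neg// expR0.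
pose H r := flow r b - flow r a - \int[mu]_(x in `[a, b]) jac r x.
have H0 : H 0 = 0.
  rewrite /H !flow_neg// (@eq_Rintegral _ _ _ _ _ (fun=> 1)).
    by rewrite Rintegral_cst_itv// mul1r subrr.
  by move=> x _; rewrite /jac logjac_neg// expR0.
suff : H t = 0 by move/eqP; rewrite subr_eq0 => /eqP.
rewrite -H0; apply: constant_of_derive0 => //.
  move=> r; apply: cvgB; last exact: jac_integral_continuous.
  by apply: cvgB; exact: flow_continuous_time.
move=> s s0; rewrite (_ : 0 = vel s b - vel s a - \int[mu]_(x in `[a, b]) (jac s x * str s x)).
  apply: is_deriveB; last exact: jac_integral_derive.
  by apply: is_deriveB; exact: flow_derive.
by rewrite (proj2 (vel_primitive s))// subrr.
Qed.

Lemma vel_lipschitz_time s t T x : `|s| <= T -> `|t| <= T ->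
  `|vel s x - vel t x| <= operator_lipschitz m0 (K * T) * (K * `|s - t|).
Proof.
move=> sT tT; have [_ h _] := logjac_regular.
exact: velocity_lipschitz (logjac_admissible sT) (logjac_admissible tT) (h s t) x.
Qed.

Opaque logjac jac vel str flow.

Lemma flow_continuous t : continuous (flow t).
Proof. exact: primitive_of_continuous (flow_primitive t). Qed.

Lemma flow_le t x y : x <= y -> flow t x <= flow t y.
Proof. by apply: primitive_le (flow_primitive t) _ => z; exact: ltW (jac_gt0 t z). Qed.

Lemma monotone_expansive (f : R -> R) (c : R) x y : 0 <= c ->
  (forall a b, b <= a -> c * (a - b) <= f a - f b) -> c * `|x - y| <= `|f x - f y|.
Proof.
move=> c0 h; have [yx|/ltW xy] := leP y x.
  by rewrite (ger0_norm (_ : 0 <= x - y)) ?subr_ge0//; apply: le_trans (h _ _ yx) (ler_norm _).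
rewrite distrC (distrC (f x)) (ger0_norm (_ : 0 <= y - x)) ?subr_ge0//.
exact: le_trans (h _ _ xy) (ler_norm _).
Qed.

(** The lower bound on the Jacobian, integrated. It yields injectivity, surjectivity and the time
    regularity of the inverse. *)
Lemma flow_expansive t T x y : `|t| <= T -> expR (- (K * T)) * `|x - y| <= `|flow t x - flow t y|.
Proof.
move=> tT; have key a b : b <= a -> expR (- (K * T)) * (a - b) <= flow t a - flow t b.
  move=> ba; rewrite (proj2 (flow_primitive t))// -Rintegral_cst_itv//.
  apply: le_Rintegral_on => //.
  - by apply: (continuous_loc (@cst_continuous _ _ _)).
  - exact: (proj1 (flow_primitive t)).
  - by move=> z _; case/andP: (jac_bounds z tT).
by apply: monotone_expansive => //; exact: expR_ge0.
Qed.

Lemma flow_inj t : injective (flow t).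
Proof.
move=> x y xy; have := flow_expansive x y (lexx `|t|); rewrite xy subrr normr0 {xy}.
by rewrite pmulr_rle0 ?expR_gt0// normr_le0 subr_eq0 => /eqP.
Qed.

Lemma flow_surj t y : exists x, flow t x = y.
Proof.
have c0 : 0 < expR (- (K * `|t|)) by exact: expR_gt0.
(* By expansivity the images of D and -D are then at least |y - flow t 0| away from flow t 0, on
   either side, so y lies between them. *)
have [D D0 DE] : exists2 D, 0 <= D & expR (- (K * `|t|)) * D = `|y - flow t 0|.
  exists (`|y - flow t 0| / expR (- (K * `|t|))); first by rewrite divr_ge0// ltW.
  by rewrite mulrC divfK ?gt_eqF.
have nz (z : R) : 0 <= z -> `|z| <= z by move=> z0; rewrite ger0_norm.
have h1 : `|y - flow t 0| <= flow t D - flow t 0.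
  have := flow_expansive D 0 (lexx `|t|).
  have f0 : 0 <= flow t D - flow t 0 by rewrite subr_ge0; exact: flow_le.
  have e : `|D - 0| = D by rewrite subr0 ger0_norm.
  by rewrite e DE => h; exact: le_trans h (nz _ f0).
have h2 : `|y - flow t 0| <= flow t 0 - flow t (- D).
  have e : `|0 - - D| = D by rewrite sub0r opprK ger0_norm.
  have := flow_expansive 0 (- D) (lexx `|t|); rewrite e DE.
  have f0 : 0 <= flow t 0 - flow t (- D) by rewrite subr_ge0; apply: flow_le; rewrite oppr_le0.
  by move=> h; exact: le_trans h (nz _ f0).
have DD : - D <= D by rewrite (le_trans _ D0)// oppr_le0.
have := @IVT _ (flow t) (- D) D y DD (continuous_subspaceT (@flow_continuous t)).
case; last by move=> x _ <-; exists x.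
have lo := flow_le t DD; rewrite (min_idPl lo) (max_idPr lo).
have := le_trans (ler_norm _) h1; rewrite lerD2r => ->; rewrite andbT.
rewrite distrC in h2; have := le_trans (ler_norm _) h2.
by rewrite lerD2l lerN2.
Qed.

Definition flow_inv t y : R := xget 0 [set x | flow t x = y].

Lemma flow_invK t : cancel (flow_inv t) (flow t).
Proof.
by move=> y; rewrite /flow_inv; case: xgetP => [x -> //|h]; have [x xy] := flow_surj t y; case: (h x).
Qed.

Lemma flowK t : cancel (flow t) (flow_inv t).
Proof. by move=> x; apply: (@flow_inj t); rewrite flow_invK. Qed.

(** Between times t and s the flow moves the point [flow_inv t y] by at most K |s - t|; expansivity
    at time s carries this back to the labels. *)
Lemma flow_inv_lipschitz_time s t T y : `|s| <= T ->
  `|flow_inv s y - flow_inv t y| <= expR (K * T) * (K * `|s - t|).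
Proof.
move=> sT; have h := flow_expansive (flow_inv s y) (flow_inv t y) sT.
have e := flow_lipschitz_time t s (flow_inv t y).
rewrite flow_invK in h; rewrite flow_invK (distrC t) in e.
by have := le_trans h e; rewrite expRN ler_pdivrMl ?expR_gt0.
Qed.

End flow.

(** * Transport of the momentum *)

Section transport.
Context {R : realType}.
Notation mu := (@lebesgue_measure R).
Implicit Types (s t r a b x y T M : R).
(** An abstract flow: [psi] is its inverse, [q] its Jacobian, [V] and [S] the velocity and the
    strain along it. *)
Variables (phi psi q V S : R -> R -> R) (K : R) (CV : R -> R).
Hypothesis K0 : 0 <= K.
Hypothesis phi_primitive : forall t, primitive_of (phi t) (q t).
Hypothesis q_continuous : forall t, continuous (q t).
Hypothesis q_bounds : forall t T x, `|t| <= T -> expR (- (K * T)) <= q t x <= expR (K * T).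
Hypothesis phiK : forall t, cancel (phi t) (psi t).
Hypothesis psiK : forall t, cancel (psi t) (phi t).
Hypothesis phi_lip : forall s t x, `|phi s x - phi t x| <= K * `|s - t|.
Hypothesis phi0 : forall x, phi 0 x = x.
Hypothesis psi_lip : forall s t T y, `|s| <= T -> `|psi s y - psi t y| <= expR (K * T) * (K * `|s - t|).
Hypothesis q_lip : forall s t T x, `|s| <= T -> `|t| <= T ->
  `|q s x - q t x| <= expR (K * T) * (K * `|s - t|).
Hypothesis V_primitive : forall t, primitive_of (V t) (fun x => q t x * S t x).
Hypothesis V_bound : forall t x, `|V t x| <= K.
Hypothesis S_bound : forall t x, `|S t x| <= K.
Hypothesis V_lip : forall s t T x, `|s| <= T -> `|t| <= T -> `|V s x - V t x| <= CV T * `|s - t|.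
Hypothesis phi_derive : forall t x, 0 < t -> is_derive t (1 : R) (phi^~ x) (V t x).
Hypothesis q_derive : forall t x, 0 < t -> is_derive t (1 : R) (q^~ x) (q t x * S t x).

Let q_gt0 t x : 0 < q t x.
Proof. by have /andP[h _] := q_bounds x (lexx `|t|); exact: lt_le_trans (expR_gt0 _) h. Qed.

Let q_ge0 t x : 0 <= q t x. Proof. exact: ltW. Qed.

Let mq t : measurable_fun setT (q t).
Proof. exact: continuous_measurable_fun. Qed.

Let cphi t : continuous (phi t).
Proof. exact: primitive_of_continuous (phi_primitive t). Qed.

Let mphi t : measurable_fun setT (phi t).
Proof. exact: continuous_measurable_fun. Qed.

Let mpsi t : measurable_fun setT (psi t).
Proof. exact: (@measurable_inverse _ (phi t) _ _ (phi_primitive t)). Qed.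

Let cV t : continuous (V t).
Proof. exact: primitive_of_continuous (V_primitive t). Qed.

Let change t (F : R -> R) : measurable_fun setT F ->
  integrable_on setT (fun x => F x * q t x) ->
  integrable_on setT (fun y => F (psi t y)) /\ \int[mu]_y F (psi t y) = \int[mu]_x (F x * q t x).
Proof. exact: (@integral_change _ (phi t)). Qed.

Let integrable_q t (F : R -> R) : integrable_on setT F -> integrable_on setT (fun x => F x * q t x).
Proof.
move=> iF; under eq_fun do rewrite mulrC.
apply: (@integrable_on_bounded _ _ (expR (K * `|t|))) => // x _.
by rewrite ger0_norm//; case/andP: (q_bounds x (lexx `|t|)).
Qed.

Lemma pull_integrable t (F : R -> R) : integrable_on setT F -> integrable_on setT (fun y => F (psi t y)).
Proof. by move=> iF; apply: (proj1 (change (integrable_onM iF) (integrable_q t iF))). Qed.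

Lemma pull_L2 t (F : R -> R) : L2 F -> L2 (fun y => F (psi t y)).
Proof.
move=> [mF F2]; split; first exact: measurableT_comp mF (@mpsi t).
exact: (@pull_integrable t (fun x => F x ^+ 2)).
Qed.

Lemma pull_nsq t T (F : R -> R) : `|t| <= T -> L2 F -> nsq (fun y => F (psi t y)) <= expR (K * T) * nsq F.
Proof.
move=> tT [mF F2]; rewrite /nsq (proj2 (@change t (fun x => F x ^+ 2) (integrable_onM F2) (integrable_q t F2))).
rewrite -RintegralZ_on//; apply: le_Rintegral_on => //; [exact: integrable_q|exact: integrable_onZ|].
move=> x _; rewrite mulrC ler_wpM2r ?sqr_ge0//.
by case/andP: (q_bounds x tT).
Qed.

Lemma nsq_cvg_quadratic (D : R -> R -> R) t (C : R) :
  (\forall s \near t, nsq (D s) <= C * `|s - t| ^+ 2) -> nsq (D s) @[s --> t] --> 0.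
Proof.
move=> h; apply/cvgrPdistC_le => e e0.
have C0 : 0 < `|C| + 1 by rewrite ltr_wpDl.
near=> s; rewrite subr0 ger0_norm ?nsq_ge0//.
apply: (@le_trans _ _ (C * `|s - t| ^+ 2)); first by near: s.
have s1 : `|s - t| <= 1 by near: s; exact: near_dist_le ltr01.
have se : `|s - t| <= e / (`|C| + 1) by near: s; apply: near_dist_le; rewrite divr_gt0.
apply: (@le_trans _ _ ((`|C| + 1) * `|s - t| ^+ 2)).
  by rewrite ler_wpM2r ?sqr_ge0//; have := ler_norm C; lra.
rewrite -ler_pdivlMl// mulrC; apply: le_trans se.
by rewrite expr2 ler_piMl.
Unshelve. all: by end_near. Qed.

Lemma near_abs_le t : \forall s \near t, `|s| <= `|t| + 1.
Proof.
near=> s; rewrite -lerBlDl; apply: le_trans (lerB_dist _ _) _.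
near: s; exact: near_dist_le ltr01.
Unshelve. all: by end_near. Qed.

Lemma psi_dist t y : `|y - psi t y| <= K * `|t|.
Proof. by have := phi_lip t 0 (psi t y); rewrite psiK phi0 subr0. Qed.

Lemma test_lipschitz (chi : R -> R) : test_function chi ->
  exists C, 0 <= C /\ forall x y, `|chi x - chi y| <= C * `|x - y|.
Proof.
move=> tc; have tc' := test_derive tc.
have [M [C [M0 C0 hC]]] := test_bounded tc'; exists C; split => //.
apply: (@primitive_lipschitz _ _ (derive1n 1 chi)).
  by apply: primitive_of_derivable; [exact: test_continuous|exact: test_is_derive].
by move=> x; apply: (le_trans (hC x)); rewrite -[leRHS]mulr1 ler_wpM2l.
Qed.

(** [chi] is Lipschitz and [psi] is Lipschitz in time. As [psi] displaces points by at most K T, the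
    difference lives on the fixed interval [-A, A]. *)
Lemma pull_test_cvg (chi : R -> R) t : test_function chi ->
  nsq (fun y => chi (psi s y) - chi (psi t y)) @[s --> t] --> 0.
Proof.
move=> tc; have [C [C0 hC]] := test_lipschitz tc.
have [_ [M hM]] := tc; pose T := `|t| + 1; pose A := M + K * T.
have T0 : 0 <= T by rewrite addr_ge0.
pose c := C * (expR (K * T) * K).
have c0 : 0 <= c by rewrite !mulr_ge0 ?expR_ge0.
apply: (@nsq_cvg_quadratic (fun s y => chi (psi s y) - chi (psi t y)) t (c ^+ 2 * nsq (\1_(`[- A, A])))).
apply: filterS (near_abs_le t) => s sT.
have tT : `|t| <= T by rewrite lerDl.
have Li := L2_indic_itv (R := R) (- A) A.
rewrite mulrAC -exprMn -nsqZ//.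
have Lc r : L2 (fun y => chi (psi r y)) by apply: pull_L2; exact: test_L2.
apply: nsq_le; [exact: L2B|exact: L2Z|].
move=> y; rewrite normrM (ger0_norm (_ : 0 <= c * `|s - t|)) ?mulr_ge0//.
have [yA|yA] := leP `|y| A.
  rewrite indicE mem_set; last by rewrite /= in_itv/= -ler_norml.
  rewrite normr1 mulr1; apply: (le_trans (hC _ _)); rewrite -mulrA ler_wpM2l//.
  by rewrite -mulrA; exact: psi_lip.
have out r : `|r| <= T -> chi (psi r y) = 0.
  move=> rT; apply: hM; have := le_trans (psi_dist r y) (ler_wpM2l K0 rT).
  by have := lerB_dist y (psi r y); rewrite /A in yA; lra.
by rewrite !out// subrr normr0 !mulr_ge0.
Qed.

(** Composition with [psi s] is bounded on L^2 uniformly for s near t, so F t may be replaced by a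
    nearby test function, for which [pull_test_cvg] applies. *)
Lemma pull_cvg (F : R -> R -> R) t : (forall s, L2 (F s)) ->
  nsq (fun x => F s x - F t x) @[s --> t] --> 0 ->
  nsq (fun y => F s (psi s y) - F t (psi t y)) @[s --> t] --> 0.
Proof.
move=> LF cF; apply/cvgrPdistC_le => e e0; pose T := `|t| + 1; pose E := expR (K * T).
have E0 : 0 < E by exact: expR_gt0.
have tT : `|t| <= T by rewrite lerDl.
(* The difference splits into four pieces, three of squared norm at most E d and one at most d; two
   rounds of the triangle inequality multiply their sum by 4. *)
pose d := e / (4 * (3 * E + 1)).
have D0 : 0 < 4 * (3 * E + 1) by lra.
have d0 : 0 < d by rewrite divr_gt0.
have [chi tc hc] := L2_test_dense (LF t) d0.
have Lc := test_L2 tc; have LB := L2B (LF t) Lc.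
move/cvgrPdistC_le : cF => /(_ d d0) cF.
move/cvgrPdistC_le : (@pull_test_cvg chi t tc) => /(_ d d0) cc.
apply: filterS3 (near_abs_le t) cF cc => s sT; rewrite !subr0 !ger0_norm ?nsq_ge0// => hF hchi.
have Pl r (G : R -> R) : L2 G -> L2 (fun y => G (psi r y)) by exact: pull_L2.
have LBs := L2B (LF s) (LF t).
have La := Pl s _ LBs; have Lb := Pl s _ LB; have Ld := Pl t _ LB.
have Lcc := L2B (Pl s _ Lc) (Pl t _ Lc).
have na : nsq (fun y => F s (psi s y) - F t (psi s y)) <= E * d.
  by apply: le_trans (pull_nsq sT LBs) _; rewrite ler_wpM2l// ltW.
have nb : nsq (fun y => F t (psi s y) - chi (psi s y)) <= E * d.
  by apply: le_trans (pull_nsq sT LB) _; rewrite ler_wpM2l// ltW.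
have nd : nsq (fun y => F t (psi t y) - chi (psi t y)) <= E * d.
  by apply: le_trans (pull_nsq tT LB) _; rewrite ler_wpM2l// ltW.
have h1 := nsqD La Lb; have h2 := nsqB Lcc Ld; have h3 := nsqD (L2D La Lb) (L2B Lcc Ld).
rewrite [X in nsq X](_ : _ = fun x : R => F s (psi s x) - F t (psi s x) + (F t (psi s x) - chi (psi s x)) +
          (chi (psi s x) - chi (psi t x) - (F t (psi t x) - chi (psi t x)))); last by apply/funext => y; ring.
have -> : e = 4 * (3 * E + 1) * d by rewrite /d mulrC divfK// gt_eqF.
apply: (le_trans h3).
move: h1 h2 na nb nd hchi.
set u1 := nsq _; set u2 := nsq _; set u3 := nsq _; set u4 := nsq _; set u5 := nsq _; set u6 := nsq _.
move: u1 u2 u3 u4 u5 u6 => u1 u2 u3 u4 u5 u6; lra.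
Qed.

Lemma coefficient_cvg (c : R -> R -> R) (C : R -> R) (g : R -> R) t : L2 g ->
  (forall s, measurable_fun setT (c s)) ->
  (forall s t T x, `|s| <= T -> `|t| <= T -> `|c s x - c t x| <= C T * `|s - t|) ->
  nsq (fun x => c s x * g x - c t x * g x) @[s --> t] --> 0.
Proof.
move=> Lg mc hc; pose T := `|t| + 1.
apply: (@nsq_cvg_quadratic _ t (C T ^+ 2 * nsq g)).
apply: filterS (near_abs_le t) => s sT.
have tT : `|t| <= T by rewrite lerDl.
have h x : `|c s x - c t x| <= C T * `|s - t| by exact: hc.
have C0 : 0 <= C T * `|s - t| by exact: le_trans (h 0).
rewrite mulrAC -exprMn -nsqZ//.
have E : (fun x => c s x * g x - c t x * g x) = (fun x => (c s x - c t x) * g x).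
  by apply/funext => x; rewrite mulrBl.
rewrite E; apply: nsq_le; last by move=> x; rewrite normrM [X in _ <= X]normrM (ger0_norm C0) ler_wpM2r.
- by apply: L2_bounded h Lg; exact: measurable_funB.
- exact: L2Z.
Qed.

Variables (m0 g : R -> R).
Hypothesis m0_primitive : primitive_of m0 g.
Hypothesis m0_L2 : L2 m0.
Hypothesis g_L2 : L2 g.
Hypothesis m0_integrable : integrable_on setT m0.

Definition momentum t y : R := m0 (psi t y).
(** Chain rule: the derivative of psi is 1 / q (psi). As V (psi) is the Eulerian velocity,
    [transport_term] stands for u m_x. *)
Definition momentum_x t y : R := (q t (psi t y))^-1 * g (psi t y).
Definition transport_term t y : R := V t (psi t y) / q t (psi t y) * g (psi t y).

Let mg : measurable_fun setT g. Proof. exact: loc_integrableM (proj1 m0_primitive). Qed.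

Let measurable_Vq t : measurable_fun setT (fun x => V t x / q t x).
Proof.
apply: continuous_measurable_fun => x; apply: cvgM; first exact: cV.
by apply: cvgV; [rewrite gt_eqF|exact: q_continuous].
Qed.

Let measurable_qV t : measurable_fun setT (fun x => (q t x)^-1).
Proof.
apply: continuous_measurable_fun => x.
by apply: cvgV; [rewrite gt_eqF|exact: q_continuous].
Qed.

Let qV_bound t T x : `|t| <= T -> (q t x)^-1 <= expR (K * T).
Proof.
move=> tT; have /andP[h _] := q_bounds x tT.
by rewrite -[leRHS]invrK lef_pV2 ?posrE ?invr_gt0 ?expR_gt0// -expRN.
Qed.

Let qV_ge0 t x : 0 <= (q t x)^-1. Proof. by rewrite invr_ge0. Qed.

Let qV_lip s t T x : `|s| <= T -> `|t| <= T ->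
  `|(q s x)^-1 - (q t x)^-1| <= expR (K * T) * expR (K * T) * (expR (K * T) * K) * `|s - t|.
Proof.
move=> sT tT; have E : (q s x)^-1 - (q t x)^-1 = (q s x)^-1 * (q t x)^-1 * (q t x - q s x).
  by field; rewrite !gt_eqF.
rewrite E normrM distrC ger0_norm ?mulr_ge0// -mulrA.
apply: ler_pM; [by rewrite mulr_ge0|by []| |by rewrite -mulrA; exact: q_lip].
by apply: ler_pM => //; exact: qV_bound.
Qed.

Let Vq_lip s t T x : `|s| <= T -> `|t| <= T ->
  `|V s x / q s x - V t x / q t x| <=
  (CV T * expR (K * T) + K * (expR (K * T) * expR (K * T) * (expR (K * T) * K))) * `|s - t|.
Proof.
move=> sT tT; have E : V s x / q s x - V t x / q t x =
    (V s x - V t x) * (q s x)^-1 + V t x * ((q s x)^-1 - (q t x)^-1) by ring.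
rewrite E; apply: (le_trans (ler_normD _ _)); rewrite [leRHS]mulrDl; apply: lerD.
  rewrite normrM (ger0_norm (qV_ge0 s x)) mulrAC; apply: ler_pM => //; first exact: V_lip.
  exact: qV_bound.
by rewrite normrM -mulrA; apply: ler_pM => //; exact: qV_lip.
Qed.

Lemma momentum_x_coefficient_L2 t : L2 (fun x => (q t x)^-1 * g x).
Proof.
apply: (@L2_bounded _ (expR (K * `|t|))) => // x.
by rewrite ger0_norm//; exact: qV_bound.
Qed.

Lemma transport_coefficient_L2 t : L2 (fun x => V t x / q t x * g x).
Proof.
apply: (@L2_bounded _ (K * expR (K * `|t|))) => // x.
by rewrite normrM (ger0_norm (qV_ge0 t x)); apply: ler_pM => //; exact: qV_bound.
Qed.

Lemma momentum_integrable t : integrable_on setT (momentum t).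
Proof. exact: pull_integrable. Qed.

Lemma momentum_L2 t : L2 (momentum t).
Proof. exact: pull_L2. Qed.

Lemma momentum_x_L2 t : L2 (momentum_x t).
Proof. exact: (pull_L2 t (momentum_x_coefficient_L2 t)). Qed.

Lemma transport_term_L2 t : L2 (transport_term t).
Proof. exact: (pull_L2 t (transport_coefficient_L2 t)). Qed.

Lemma momentum_cvg t : nsq (fun y => momentum s y - momentum t y) @[s --> t] --> 0.
Proof.
apply: (@pull_cvg (fun=> m0)) => //; apply: (@nsq_cvg_quadratic _ t 0).
apply: filterE => s; rewrite mul0r (_ : (fun x => _) = (fun=> 0)) ?nsq0//.
by apply/funext => x; rewrite subrr.
Qed.

Lemma momentum_x_cvg t : nsq (fun y => momentum_x s y - momentum_x t y) @[s --> t] --> 0.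
Proof.
apply: (@pull_cvg (fun t x => (q t x)^-1 * g x)); first exact: momentum_x_coefficient_L2.
apply: (@coefficient_cvg (fun t x => (q t x)^-1)
  (fun T => expR (K * T) * expR (K * T) * (expR (K * T) * K))) => // *; exact: qV_lip.
Qed.

Lemma transport_term_cvg t : nsq (fun y => transport_term s y - transport_term t y) @[s --> t] --> 0.
Proof.
apply: (@pull_cvg (fun t x => V t x / q t x * g x)); first exact: transport_coefficient_L2.
apply: (@coefficient_cvg (fun t x => V t x / q t x)
  (fun T => CV T * expR (K * T) + K * (expR (K * T) * expR (K * T) * (expR (K * T) * K)))) => // *.
Qed.

Lemma momentum_primitive t : primitive_of (momentum t) (momentum_x t).
Proof.
split; first exact: L2_loc (momentum_x_L2 t).
move=> a b ab; have h x y : (phi t x <= phi t y) = (x <= y).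
  have hd x' y' : x' <= y' -> phi t x' <= phi t y' by exact: (primitive_le (phi_primitive t) (q_ge0 t)).
  apply/idP/idP => [xy|]; last exact: hd.
  rewrite leNgt; apply/negP => yx; have yx' := hd _ _ (ltW yx).
  have : phi t x = phi t y by apply/eqP; rewrite eq_le xy.
  by move/(can_inj (@phiK t)) => e; rewrite e ltxx in yx.
have pab : psi t a <= psi t b by rewrite -h !psiK.
rewrite /momentum (proj2 m0_primitive)//.
rewrite [LHS]Rintegral_indic [RHS]Rintegral_indic.
(* In labels the interval [a, b] becomes [psi a, psi b], and the Jacobian of the substitution
   cancels 1 / q. *)
pose F x := \1_(`[a, b]) (phi t x) * ((q t x)^-1 * g x).
have E x : F x * q t x = \1_(`[psi t a, psi t b]) x * g x.
  rewrite /F !indicE !mem_setE !in_itv/= -(h _ x) -(h x) !psiK; field.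
  by rewrite gt_eqF.
have mF : measurable_fun setT F.
  apply: measurable_funM; last exact: measurable_funM.
  by apply: (@measurableT_comp _ _ _ _ _ _ (\1_(`[a, b]) : R -> R)).
have iF : integrable_on setT (fun x => F x * q t x).
  under eq_fun do rewrite E.
  by apply: (proj1 (integrable_on_restrict _ _)) => //; exact: (proj1 m0_primitive).
rewrite (@eq_RintegralT _ (fun x => F x * q t x)); last by move=> x; rewrite E.
rewrite -(proj2 (change mF iF)); apply: eq_RintegralT => y.
by rewrite /F /momentum_x psiK.
Qed.

(** * The transport equation tested against a fixed function *)

Section test_pairing.
Variable chi : R -> R.
Hypothesis chi_test : test_function chi.
Let chi' := derive1n 1 chi.

Let tc' : test_function chi'. Proof. exact: test_derive. Qed.

Let chi_phi_derive t x : is_derive x (1 : R) (fun x => chi (phi t x)) (chi' (phi t x) * q t x).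
Proof.
apply: is_derive_comp1; first exact: test_is_derive.
exact: primitive_is_derive.
Qed.

Let comp_continuous (f : R -> R) t : continuous f -> continuous (fun x => f (phi t x)).
Proof. by move=> cf x; apply: continuous_comp; [exact: cphi|exact: cf]. Qed.

Let chi_phi_primitive t : primitive_of (fun x => chi (phi t x)) (fun x => chi' (phi t x) * q t x).
Proof.
apply: primitive_of_derivable; last exact: chi_phi_derive.
move=> x; apply: cvgM; last exact: q_continuous.
by apply: comp_continuous; exact: test_continuous.
Qed.

(** As V = phi_t and q = phi_x, the x-derivative [flux'] is also the time derivative of chi(phi) q.
    This conservation law allows the time derivative to be integrated by parts onto [m0]. *)
Let flux r x := chi (phi r x) * V r x.
Let flux' r x := chi' (phi r x) * q r x * V r x + chi (phi r x) * (q r x * S r x).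

Let flux_primitive r : primitive_of (flux r) (flux' r).
Proof. exact: primitive_mul. Qed.

Lemma chi_phi_L2 (f : R -> R) t : test_function f -> L2 (fun x => f (phi t x)).
Proof.
move=> tf; have [M [C [M0 C0 hC]]] := test_bounded tf.
pose A := M + K * `|t|.
apply: (@L2_le _ (fun x => C * \1_(`[- A, A]) x)).
- by apply: continuous_measurable_fun; apply: comp_continuous; exact: test_continuous.
- by apply: L2Z; exact: L2_indic_itv.
move=> x; apply: (le_trans (hC _)); rewrite normrM (ger0_norm C0) ler_wpM2l//.
rewrite [leRHS]ger0_norm// !indicE !mem_setE !in_itv/= -!ler_norml.
have [h|h] := leP `|phi t x| M; last by rewrite ler0n.
rewrite (_ : `|x| <= A)//; have := phi_lip t 0 x; rewrite phi0 subr0 distrC.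
have := lerB_dist x (phi t x); rewrite /A; lra.
Qed.

Let flux'_bound : exists2 C : R -> R, (forall T, 0 <= C T) & forall r T x, `|r| <= T -> `|flux' r x| <= C T.
Proof.
have [M1 [C1 [_ C10 h1]]] := test_bounded chi_test.
have [M2 [C2 [_ C20 h2]]] := test_bounded tc'.
have b1 y : `|chi y| <= C1 by apply: (le_trans (h1 y)); rewrite -[leRHS]mulr1 ler_wpM2l.
have b2 y : `|chi' y| <= C2 by apply: (le_trans (h2 y)); rewrite -[leRHS]mulr1 ler_wpM2l.
exists (fun T => C2 * expR (K * T) * K + C1 * (expR (K * T) * K)).
  by move=> T; rewrite addr_ge0 ?mulr_ge0 ?expR_ge0.
move=> r T x rT; have /andP[_ qT] := q_bounds x rT.
apply: (le_trans (ler_normD _ _)); rewrite !normrM (ger0_norm (q_ge0 r x)).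
apply: lerD.
  by apply: ler_pM => //; [exact: mulr_ge0|apply: ler_pM].
by apply: ler_pM => //; [exact: mulr_ge0|apply: ler_pM].
Qed.

Definition pairing r : R := \int[mu]_y (momentum r y * chi y).

(** In labels all the time dependence falls on the test function and the Jacobian, which are
    differentiable in time, while [m0] stays fixed. *)
Let pairingE r : pairing r = \int[mu]_x (m0 x * (chi (phi r x) * q r x)).
Proof.
have mF : measurable_fun setT (fun x => m0 x * chi (phi r x)).
  apply: measurable_funM; first exact: integrable_onM m0_integrable.
  exact: (proj1 (chi_phi_L2 r chi_test)).
have iF : integrable_on setT (fun x => m0 x * chi (phi r x) * q r x).
  by apply: integrable_q; apply: L2_mul => //; exact: chi_phi_L2.
rewrite /pairing (@eq_RintegralT _ (fun y => m0 (psi r y) * chi (phi r (psi r y)))); last first.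
  by move=> y; rewrite psiK.
rewrite (proj2 (@change r (fun x => m0 x * chi (phi r x)) mF iF)).
by apply: eq_RintegralT => x; ring.
Qed.

Let transport_pairing r : \int[mu]_y (transport_term r y * chi y) = \int[mu]_x (g x * flux r x).
Proof.
have mF : measurable_fun setT (fun x => V r x / q r x * g x * chi (phi r x)).
  apply: measurable_funM; first exact: (proj1 (transport_coefficient_L2 r)).
  exact: (proj1 (chi_phi_L2 r chi_test)).
have iF : integrable_on setT (fun x => V r x / q r x * g x * chi (phi r x) * q r x).
  apply: integrable_q; apply: L2_mul; [exact: transport_coefficient_L2|exact: chi_phi_L2].
rewrite (@eq_RintegralT _ (fun y => V r (psi r y) / q r (psi r y) * g (psi r y) * chi (phi r (psi r y)))); last first.
  by move=> y; rewrite psiK.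
rewrite (proj2 (@change r (fun x => V r x / q r x * g x * chi (phi r x)) mF iF)).
by apply: eq_RintegralT => x; rewrite /flux; field; rewrite gt_eqF.
Qed.

Let flux_L2 r : L2 (flux r).
Proof.
rewrite /flux; under eq_fun do rewrite mulrC.
apply: (@L2_bounded _ K); [exact: continuous_measurable_fun|by []|exact: chi_phi_L2].
Qed.

Let m0_flux' r : integrable_on setT (fun x => m0 x * flux' r x).
Proof.
have [C C0 hC] := flux'_bound; under eq_fun do rewrite mulrC.
apply: (@integrable_on_bounded _ _ (C `|r|)) => //; last by move=> x _; exact: hC.
exact: loc_integrableM (proj1 (flux_primitive r)).
Qed.

Let pairing_by_parts r : \int[mu]_x (m0 x * flux' r x) = - \int[mu]_y (transport_term r y * chi y).
Proof.
rewrite transport_pairing; apply/eqP; rewrite -addr_eq0 addrC; apply/eqP.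
have i1 : integrable_on setT (fun x => g x * flux r x) by exact: L2_mul.
rewrite -RintegralD_on//.
apply: (primitive_integral0 (primitive_mul m0_primitive (flux_primitive r))).
  exact: L2_mul.
exact: integrable_onD.
Qed.

(** Differentiation under the integral, dominated by a multiple of |m0| on ]0, 2 r[, then
    integration by parts of [flux'] against [m0]. *)
Lemma pairing_derive r : 0 < r ->
  is_derive r (1 : R) pairing (- \int[mu]_y (transport_term r y * chi y)).
Proof.
move=> r0; rewrite (_ : pairing = fun r => \int[mu]_x (m0 x * (chi (phi r x) * q r x))); last first.
  by apply/funext => s; exact: pairingE.
rewrite -pairing_by_parts; pose f s x : R := m0 x * (chi (phi s x) * q s x).
have df s x : 0 < s -> is_derive s (1 : R) (f^~ x) (m0 x * flux' s x).
  move=> s0; apply: is_deriveZ.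
  rewrite (_ : flux' s x = chi (phi s x) *: (q s x * S s x) + q s x *: (chi' (phi s x) * V s x)); last first.
    by rewrite /flux' /GRing.scale/=; ring.
  apply: is_deriveM; last exact: q_derive.
  by apply: is_derive_comp1; [exact: test_is_derive|exact: phi_derive].
have [C C0 hC] := flux'_bound.
pose G x := C (2 * r) * `|m0 x|.
have i0 : `](0 : R), (2 * r)[%classic r by rewrite /= in_itv/=; apply/andP; split; lra.
have h1 (s : R) : `](0 : R), (2 * r)[%classic s -> mu.-integrable setT (EFin \o f s).
  move=> _; have : integrable_on setT (fun x => m0 x * chi (phi s x) * q s x).
    by apply: integrable_q; apply: L2_mul => //; exact: chi_phi_L2.
  by under eq_fun do rewrite -mulrA.
have h2 (s y : R) : `](0 : R), (2 * r)[%classic s -> setT y -> derivable (f^~ y) s 1.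
  by rewrite /= in_itv/= => /andP[s0 _] _; case: (df s y s0).
have pE (s y : R) : 0 < s -> partial1of2 f s y = m0 y * flux' s y.
  by move=> s0; rewrite /partial1of2 derive1E; case: (df s y s0).
have G0 y : 0 <= G y by rewrite mulr_ge0.
have h3 : mu.-integrable setT (EFin \o G).
  by apply: integrable_onZ => //; exact: integrable_on_norm.
have h4 (s y : R) : `](0 : R), (2 * r)[%classic s -> setT y -> `|partial1of2 f s y| <= G y.
  rewrite /= in_itv/= => /andP[s0 sr] _; rewrite pE// normrM mulrC ler_wpM2r//.
  by apply: hC; rewrite gtr0_norm// ltW.
have d := @derivable_under_integral R _ _ mu f setT measurableT r 0 (2 * r) i0 h1 h2 G G0 h3 h4.
have e := @differentiation_under_integral R _ _ mu f setT measurableT r 0 (2 * r) i0 h1 h2 G G0 h3 h4.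
split; first exact: d.
rewrite -derive1E e; apply: eq_RintegralT => y; exact: pE.
Qed.

Lemma pairing_continuous : continuous pairing.
Proof.
move=> t; apply: (@cvg_ip _ _ (nbhs t) _ momentum (fun=> chi)).
- by apply: nearW => s; split; [exact: momentum_L2|exact: test_L2].
- exact: momentum_L2.
- exact: test_L2.
- exact: momentum_cvg.
- rewrite (_ : (fun s => _) = fun=> 0); first exact: cvg_cst.
  apply/funext => s; rewrite (_ : (fun x => _) = (fun=> 0)) ?nsq0//.
  by apply/funext => x; rewrite subrr.
Qed.

(** The intermediate time depends on [chi]; only its distance to t is recorded. Continuity of the
    pairing lets s or t be 0. *)
Lemma pairing_mvt s t : 0 <= s -> 0 <= t -> s != t ->
  exists2 r, `|r - t| <= `|s - t| &
    pairing s - pairing t = (s - t) * - \int[mu]_y (transport_term r y * chi y).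
Proof.
move=> s0 t0 st.
have key a b : 0 <= a -> a < b -> exists2 c, c \in `]a, b[ &
    pairing b - pairing a = (- \int[mu]_y (transport_term c y * chi y)) * (b - a).
  move=> a0 ab; apply: MVT => //; last exact: (continuous_subspaceT pairing_continuous).
  move=> x; rewrite in_itv/= => /andP[ax _]; apply: pairing_derive; exact: le_lt_trans ax.
have [lt|lt|/eqP e] := ltgtP s t; last by rewrite e in st.
- have [c /[!in_itv]/= /andP[c1 c2] e] := key s t s0 lt; exists c.
    by rewrite !ler0_norm ?subr_le0 ?ltW//; lra.
  by rewrite -opprB e mulrC -mulNr opprB.
- have [c /[!in_itv]/= /andP[c1 c2] e] := key t s t0 lt; exists c.
    by rewrite !ger0_norm ?subr_ge0 ?ltW//; lra.
  by rewrite e mulrC.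
Qed.

End test_pairing.

(** Letting [chi] tend to [D] in L^2 gives (nsq D)^2 <= E * nsq D. *)
Lemma nsq_le_dual (D : R -> R) (E : R) : L2 D -> 0 <= E ->
  (forall chi, test_function chi -> (\int[mu]_x (D x * chi x)) ^+ 2 <= E * nsq chi) -> nsq D <= E.
Proof.
move=> LD E0 h.
have ch : forall n : nat, exists2 c, test_function c & nsq (fun x => D x - c x) < n.+1%:R^-1.
  by move=> n; apply: L2_test_dense; rewrite ?invr_gt0.
pose c n : R -> R := xget (fun=> 0) [set c | test_function c /\ nsq (fun x => D x - c x) < n.+1%:R^-1].
have hc n : test_function (c n) /\ nsq (fun x => D x - c n x) < n.+1%:R^-1.
  by rewrite /c; case: xgetP => [x -> //|no]; have [x tx hx] := ch n; case: (no x).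
have Lc n : L2 (c n) by apply: test_L2; case: (hc n).
have c0 : nsq (fun x => c n x - D x) @[n --> \oo] --> 0.
  apply: (@squeeze_cvgr _ _ _ _ (fun=> 0) (fun n => n.+1%:R^-1)).
  - apply: nearW => n; rewrite nsq_ge0/= ltW//; have [_] := hc n.
    by rewrite -nsqN; under [X in nsq X]eq_fun do rewrite opprB.
  - exact: cvg_cst.
  - exact: cvg_harmonic.
have cD : nsq (fun x => D x - D x) @[n --> \oo] --> 0.
  rewrite (_ : (fun x => _) = (fun=> 0)) ?nsq0; first exact: cvg_cst.
  by apply/funext => x; rewrite subrr.
have l1 : \int[mu]_x (D x * c n x) @[n --> \oo] --> nsq D.
  rewrite (_ : nsq D = \int[mu]_x (D x * D x)); last by apply: eq_RintegralT => x; rewrite expr2.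
  apply: (@cvg_ip _ _ \oo _ (fun=> D) c) => //; exact: nearW.
have l2 : nsq (c n) @[n --> \oo] --> nsq D by apply: cvg_nsq => //; exact: nearW.
have l : (nsq D) ^+ 2 <= E * nsq D.
  apply: (@ler_cvg_to _ \oo _ _ (fun n => (\int[mu]_x (D x * c n x)) ^+ 2) (fun n => E * nsq (c n))).
  - by rewrite expr2; under eq_fun do rewrite expr2; exact: cvgM.
  - by apply: cvgM => //; exact: cvg_cst.
  - by apply: nearW => n; apply: h; case: (hc n).
have := nsq_ge0 D; rewrite le_eqVlt => /predU1P[<-//|D0].
by move: l; rewrite expr2 ler_pM2r.
Qed.

(* By duality it suffices to bound the pairings with test functions, for which the
   mean value theorem only involves the transport term at intermediate times. *)
Lemma momentum_derive t : 0 <= t ->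
  nsq (fun y => (s - t)^-1 * (momentum s y - momentum t y) + transport_term t y)
    @[s --> within `[0, +oo[ t^'] --> 0.
Proof.
move=> t0; apply/cvgrPdistC_le => e e0.
move/cvgrPdistC_le : (@transport_term_cvg t) => /(_ e e0)[d /= d0 hd].
have hd' r : `|r - t| < d -> nsq (fun y => transport_term r y - transport_term t y) <= e.
  move=> rd; have /= := hd r; rewrite (distrC t r) => /(_ rd).
  by rewrite subr0 ger0_norm ?nsq_ge0.
exists d => //= s /= sd st s0; rewrite subr0 ger0_norm ?nsq_ge0//.
move: s0; rewrite in_itv/= andbT => s0.
have LD : L2 (fun y => momentum s y - momentum t y) by apply: L2B; exact: momentum_L2.
have Lw := transport_term_L2 t.
apply: nsq_le_dual; [by apply: L2D => //; exact: L2Z|exact: ltW|].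
move=> chi tc; have Lc := test_L2 tc.
have [r rt e1] := @pairing_mvt chi tc s t s0 t0 st.
have ts : s - t != 0 by rewrite subr_eq0.
have Lr := transport_term_L2 r.
have E1 : \int[mu]_x (((s - t)^-1 * (momentum s x - momentum t x) + transport_term t x) * chi x) =
    \int[mu]_x ((transport_term t x - transport_term r x) * chi x).
  have -> : \int[mu]_x (((s - t)^-1 * (momentum s x - momentum t x) + transport_term t x) * chi x) =
      (s - t)^-1 * (pairing chi s - pairing chi t) + \int[mu]_x (transport_term t x * chi x).
    rewrite /pairing -RintegralB_on//; [|exact: L2_mul (momentum_L2 _) Lc..].
    have i1 : integrable_on setT (fun x => momentum s x * chi x - momentum t x * chi x).
      by apply: integrable_onB => //; exact: L2_mul (momentum_L2 _) Lc.
    rewrite -RintegralZ_on// -RintegralD_on//; [|exact: integrable_onZ|exact: L2_mul].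
    by apply: eq_RintegralT => x; ring.
  rewrite e1 mulrA mulVf// mul1r addrC -RintegralB_on//; [|exact: L2_mul..].
  by apply: eq_RintegralT => x; ring.
rewrite E1; apply: le_trans (cauchy_schwarz (L2B Lw Lr) Lc) _.
rewrite ler_wpM2r ?nsq_ge0// -nsqN; under [X in nsq X]eq_fun do rewrite opprB.
by apply: hd'; apply: le_lt_trans rt _; rewrite distrC.
Qed.

End transport.

(** * The global solution *)

Section global_solution.
Context {R : realType}.
Notation mu := (@lebesgue_measure R).
Implicit Types (s t x y T : R).
Variables (m0 g : R -> R) (K : R).
Hypothesis m0_bound : forall x, `|m0 x| <= K.
Hypothesis m0_primitive : primitive_of m0 g.
Hypothesis m0_L2 : L2 m0.
Hypothesis g_L2 : L2 g.
Hypothesis m0_integrable : integrable_on setT m0.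

Let K0 : 0 <= K. Proof. exact: le_trans (m0_bound 0). Qed.

Let m := momentum (flow_inv m0) m0.
Let n := momentum_x (flow_inv m0) (jac m0) g.
Let w := transport_term (flow_inv m0) (jac m0) (vel m0) g.

Let adm t : admissible (K * `|t|) (logjac m0 t).
Proof. exact: logjac_admissible. Qed.

(** Substitute the flow in the integral: flow and label have the same Jacobian, hence the same
    differences, and monotonicity matches the half-lines. *)
Let side_flow b t x : kint b id (m t) (flow m0 t x) = side m0 b (logjac m0 t) x.
Proof.
have pf := flow_primitive m0_integrable m0_bound t.
have pl : primitive_of (label (logjac m0 t)) (jac m0 t) := label_primitive (adm t).
have mf : measurable_fun setT (flow m0 t).
  by apply: continuous_measurable_fun; exact: primitive_of_continuous pf.
have q0 y : 0 <= jac m0 t y by exact: expR_ge0.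
pose F y := kernel b id (flow m0 t x) (flow m0 t y) * m0 y.
have hle y z : (flow m0 t y <= flow m0 t z) = (y <= z).
  have [yz|zy] := leP y z; first exact: primitive_le pf q0 yz.
  apply/negbTE; rewrite -ltNge lt_neqAle (primitive_le pf q0 (ltW zy)) andbT.
  by apply/eqP => /(flow_inj m0_integrable m0_bound) zyE; rewrite zyE ltxx in zy.
have kE y : kernel b id (flow m0 t x) (flow m0 t y) = kernel b (label (logjac m0 t)) x y.
  rewrite /kernel; congr (_ * expR (- _)).
    by rewrite /half; case: (b); rewrite !indicE !mem_setE !in_itv/= ?andbT hle.
  have [yx|/ltW xy] := leP y x.
    by rewrite (proj2 pf _ _ yx) (proj2 pl _ _ yx).
  by rewrite distrC (distrC (label _ x)) (proj2 pf _ _ xy) (proj2 pl _ _ xy).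
have FE y : F y * jac m0 t y = kernel b (label (logjac m0 t)) x y * density m0 (logjac m0 t) y.
  by rewrite /F kE -mulrA.
have mF : measurable_fun setT F.
  apply: measurable_funM; last exact: integrable_onM m0_integrable.
  under eq_fun do rewrite kE; apply: measurable_kernel.
  exact: label_measurable (adm t).
have iF : integrable_on setT (fun y => F y * jac m0 t y).
  under eq_fun do rewrite FE; apply: integrable_kernel.
    exact: label_measurable (adm t).
  exact: density_integrable (adm t).
have [_ e] := integral_change pf q0 (flowK m0_integrable m0_bound t) (flow_invK m0_integrable m0_bound t) mF iF.
rewrite /side /kint -(eq_RintegralT FE) -e; apply: eq_RintegralT => y.
by rewrite /F /m /momentum (flow_invK m0_integrable m0_bound).
Qed.

(** Closes the loop: the velocity that transports the momentum is the one that the momentum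
    generates. *)
Lemma green_momentum t y : green (m t) y = vel m0 t (flow_inv m0 t y).
Proof.
by rewrite -{1}(flow_invK m0_integrable m0_bound t y) /green !side_flow.
Qed.

Let VC T := operator_lipschitz m0 (K * T) * K.

Let V_lip s t T x : `|s| <= T -> `|t| <= T -> `|vel m0 s x - vel m0 t x| <= VC T * `|s - t|.
Proof. by move=> sT tT; rewrite -mulrA; exact: vel_lipschitz_time. Qed.

Let phi_prim t := flow_primitive m0_integrable m0_bound t.
Let q_cont t := jac_continuous m0_integrable m0_bound (t := t).
Let q_bd t T x := @jac_bounds _ _ _ m0_integrable m0_bound t T x.
Let fK t := flowK m0_integrable m0_bound t.
Let fiK t := flow_invK m0_integrable m0_bound t.

Let f_lip s t x := flow_lipschitz_time m0_integrable m0_bound s t x.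
Let f_0 x : flow m0 0 x = x. Proof. exact: flow_neg. Qed.
Let fi_lip s t T y := @flow_inv_lipschitz_time _ _ _ m0_integrable m0_bound s t T y.
Let q_lp s t T x := @jac_lipschitz_time _ _ _ m0_integrable m0_bound s t T x.
Let v_prim t := vel_primitive m0_integrable m0_bound t.
Let v_bd t x := vel_bound m0_integrable m0_bound t x.
Let s_bd t x := str_bound m0_integrable m0_bound t x.
Let f_der t x := @flow_derive _ _ _ m0_integrable m0_bound t x.
Let q_der t x := @jac_derive _ _ _ m0_integrable m0_bound t x.

Let m_integrable t : integrable_on setT (m t).
Proof. exact: (momentum_integrable phi_prim q_cont q_bd fK fiK m0_integrable t). Qed.

Let m_L2 t : L2 (m t).
Proof. exact: (momentum_L2 phi_prim q_cont q_bd fK fiK m0_L2 t). Qed.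

Let n_L2 t : L2 (n t).
Proof. exact: (momentum_x_L2 phi_prim q_cont q_bd fK fiK g_L2 t). Qed.

Let w_L2 t : L2 (w t).
Proof. exact: (transport_term_L2 phi_prim q_cont q_bd fK fiK v_prim v_bd g_L2 t). Qed.

Let m_primitive t : primitive_of (m t) (n t).
Proof. exact: (momentum_primitive phi_prim q_cont q_bd fK fiK m0_primitive g_L2 t). Qed.

Let wE t y : w t y = green (m t) y * n t y.
Proof. by rewrite green_momentum /w /transport_term /n /momentum_x mulrA. Qed.

Let U t := green_chain (m t) (n t).

Let U_chain t : sobolev_chain 3 (U t).
Proof. exact: green_chain3. Qed.

Let w_integrable t : integrable_on setT (w t).
Proof.
rewrite (_ : w t = fun y => green (m t) y * n t y); last by apply/funext => y; exact: wE.
by apply: L2_mul => //; case: (U_chain t) => _ /(_ 0%N isT).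
Qed.

(** This is m_t = - u m_x, so that [Ut] is the chain of u_t = (1 - d_x^2)^{-1} m_t. *)
Let f t y : R := -1 * w t y.
Let f_integrable t : integrable_on setT (f t). Proof. exact: integrable_onZ. Qed.
Let f_L2 t : L2 (f t). Proof. exact: L2Z. Qed.

Let Ut t := helmholtz_chain (f t).

Let Ut_chain t : sobolev_chain 2 (Ut t).
Proof. exact: green_chain2. Qed.

Let helmholtz_cvg (A : set_system R) {FA : Filter A} (h : R -> R -> R) j : (j <= 2)%N ->
  (forall s, integrable_on setT (h s)) -> (forall s, L2 (h s)) ->
  nsq (h s) @[s --> A] --> 0 -> nsq (helmholtz_chain (h s) j) @[s --> A] --> 0.
Proof.
move=> j2 ih Lh ch.
apply: (@squeeze_cvgr _ _ _ _ (fun=> 0) (fun s => 4 * nsq (h s))).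
- apply: filterE => s; rewrite nsq_ge0/=.
  have [h0 h1 h2] := green_nsq (ih s) (Lh s); have := nsq_ge0 (h s).
  by case: j j2 => [|[|[|//]]] _ ? /=; [apply: (le_trans h0)|apply: (le_trans h1)|exact: h2]; lra.
- exact: cvg_cst.
- by rewrite -(mulr0 4); apply: cvgM => //; exact: cvg_cst.
Qed.

Let helmholtzB (h1 h2 : R -> R) j : (j <= 2)%N -> integrable_on setT h1 -> integrable_on setT h2 ->
  helmholtz_chain (fun x => h1 x - h2 x) j = fun x => helmholtz_chain h1 j x - helmholtz_chain h2 j x.
Proof.
move=> j2 i1 i2; apply/funext => x; have [e1 e2] := greenB x i1 i2.
by case: j j2 => [|[|[|//]]] _ //=; rewrite e1; ring.
Qed.

Let helmholtzZ (k : R) (h : R -> R) j : (j <= 2)%N -> integrable_on setT h ->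
  helmholtz_chain (fun x => k * h x) j = fun x => k * helmholtz_chain h j x.
Proof.
move=> j2 i1; apply/funext => x; have [e1 e2] := greenZ k x i1.
by case: j j2 => [|[|[|//]]] _ //=; rewrite e1; ring.
Qed.

Let UE t j : (j <= 2)%N -> U t j = helmholtz_chain (m t) j.
Proof. by case: j => [|[|[|]]]. Qed.

Let m_cvg t : nsq (fun y => m s y - m t y) @[s --> t] --> 0.
Proof. exact: (@momentum_cvg _ _ _ _ _ K0 phi_prim q_cont q_bd fK fiK f_lip f_0 fi_lip _ m0_L2 t). Qed.

Let n_cvg t : nsq (fun y => n s y - n t y) @[s --> t] --> 0.
Proof.
exact: (@momentum_x_cvg _ _ _ _ _ K0 phi_prim q_cont q_bd fK fiK f_lip f_0 fi_lip q_lp _ g_L2 t).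
Qed.

Let w_cvg t : nsq (fun y => w s y - w t y) @[s --> t] --> 0.
Proof.
exact: (@transport_term_cvg _ _ _ _ _ _ _ _ K0 phi_prim q_cont q_bd fK fiK f_lip f_0 fi_lip q_lp
  v_prim v_bd V_lip _ g_L2 t).
Qed.

Let U_cvg t j : (j <= 3)%N -> nsq (fun x => U s j x - U t j x) @[s --> t] --> 0.
Proof.
move=> j3; have cj i : (i <= 2)%N -> nsq (fun x => U s i x - U t i x) @[s --> t] --> 0.
  move=> i2; rewrite (_ : (fun s => _) = fun s => nsq (helmholtz_chain (fun y => m s y - m t y) i)); last first.
    by apply/funext => s; rewrite helmholtzB// -!UE.
  apply: (@helmholtz_cvg (nbhs t) _ (fun s y => m s y - m t y) i i2).
  - by move=> s; exact: integrable_onB.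
  - by move=> s; exact: L2B.
  - exact: m_cvg.
(* At order 3 the chain is [U t 1%N] minus [n t], so the continuity of m_x in L^2 is called for. *)
move: j3; rewrite leq_eqVlt => /orP[/eqP->|]; last exact: cj.
have alg (a b c d : R) : (a - c) - (b - d) = (a - b) - (c - d) by ring.
rewrite (_ : (fun s => _) = fun s => nsq (fun x => (U s 1%N x - U t 1%N x) - (n s x - n t x))); last first.
  by apply/funext => s; congr nsq; apply/funext => x; exact: alg.
apply: (@cvg_nsq0B _ _ (nbhs t) _ (fun s x => U s 1%N x - U t 1%N x)); [|exact: cj|exact: n_cvg].
apply: filterE => s; split; last exact: L2B.
by apply: L2B; [have [_ h] := U_chain s|have [_ h] := U_chain t]; exact: (h 1%N).
Qed.

Let Ut_cvg t j : (j <= 2)%N -> nsq (fun x => Ut s j x - Ut t j x) @[s --> t] --> 0.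
Proof.
move=> j2; rewrite (_ : (fun s => _) = fun s => nsq (helmholtz_chain (fun y => f s y - f t y) j)); last first.
  by apply/funext => s; rewrite helmholtzB.
apply: (@helmholtz_cvg (nbhs t) _ (fun s y => f s y - f t y) j j2).
- by move=> s; exact: integrable_onB.
- by move=> s; exact: L2B.
rewrite (_ : (fun s => _) = fun s => nsq (fun x => -1 * (w s x - w t x))); last first.
  by apply/funext => s; congr nsq; apply/funext => x; rewrite [RHS]mulrBr.
apply: (@cvg_nsq0Z _ _ (nbhs t) _ (-1) (fun s x => w s x - w t x)); last exact: w_cvg.
by apply: filterE => s; exact: L2B.
Qed.

(** The inverse Helmholtz operator is linear and bounded from L^2 to H^2, so it transfers
    [momentum_derive] from m to u. *)
Let U_derive t j : 0 <= t -> (j <= 2)%N ->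
  nsq (fun x => (s - t)^-1 * (U s j x - U t j x) - Ut t j x) @[s --> within `[0, +oo[ t^'] --> 0.
Proof.
move=> t0 j2; pose h s y := (s - t)^-1 * (m s y - m t y) - f t y.
have iB s : integrable_on setT (fun y => m s y - m t y) by exact: integrable_onB.
have iZ s : integrable_on setT (fun y => (s - t)^-1 * (m s y - m t y)) by exact: integrable_onZ.
rewrite (_ : (fun s => _) = fun s => nsq (helmholtz_chain (h s) j)); last first.
  apply/funext => s; congr nsq; rewrite /h helmholtzB// helmholtzZ// helmholtzB//.
  by apply/funext => x; rewrite !UE.
apply: (@helmholtz_cvg (within `[0, +oo[ t^') _ h j j2).
- by move=> s; exact: integrable_onB.
- by move=> s; apply: L2B => //; apply: L2Z; exact: L2B.
have := @momentum_derive _ _ _ _ _ _ _ _ K0 phi_prim q_cont q_bd fK fiK f_lip f_0 fi_lip q_lp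
  v_prim v_bd s_bd V_lip f_der q_der _ _ m0_primitive m0_L2 g_L2 m0_integrable t t0.
rewrite (_ : (fun s => nsq (h s)) = fun s => nsq (fun y => (s - t)^-1 * (m s y - m t y) + w t y))//.
by apply/funext => s; congr nsq; apply/funext => y; rewrite /h /f mulN1r opprK.
Qed.

Lemma global_chain_solution : exists U Ut : R -> nat -> R -> R, [/\ chain_solution `[0, +oo[ U Ut,
  (forall t j, (j <= 2)%N -> nsq (fun x => Ut s j x - Ut t j x) @[s --> t] --> 0) &
  U 0 0%N = green m0].
Proof.
exists U, Ut; split; last 2 first.
- by move=> t j; exact: Ut_cvg.
- rewrite /U /=; congr green; apply/funext => y; rewrite /m /momentum; congr m0.
  by apply: (@flow_inj _ _ _ m0_integrable m0_bound 0); rewrite fiK f_0.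
split.
- by [].
- by move=> t _ j j3; apply: cvg_within_filter; exact: U_cvg.
- by move=> t; rewrite /= in_itv/= andbT => t0 j j2; exact: U_derive.
(* By construction u_t - u_txx = - u m_x and u_x - u_xxx = m_x, so the equation holds at every x. *)
- move=> t _; apply: ae_all => x; rewrite /= /f wE.
  have alg (a b c e : R) : a - (a - -1 * (b * c)) + b * e - b * (e - c) = 0 by ring.
  exact: alg.
Qed.

End global_solution.

(** * Return to the Sobolev formulation *)

Section existence.
Context {R : realType}.
Notation mu := (@lebesgue_measure R).
Implicit Types (I J : set R) (s t x y T : R).

Lemma chain_solution_solution I (U Ut : R -> nat -> R -> R) (u0 : R -> R) :
  chain_solution I U Ut ->
  (forall t j, (j <= 2)%N -> nsq (fun x => Ut s j x - Ut t j x) @[s --> t] --> 0) ->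
  {ae mu, forall x, U 0 0%N x = u0 x} -> is_solution I u0 (fun t => U t 0%N).
Proof.
move=> [ch cU dU eU] cUt U0.
have cU3 t : I t -> sobolev_chain 3 (U t) by move=> /ch[].
have cU2 t : I t -> sobolev_chain 2 (Ut t) by move=> /ch[].
have mU t : I t -> measurable_fun setT (U t 0%N) by move=> /cU3[_ /(_ 0%N isT)[]].
have mUt t : I t -> measurable_fun setT (Ut t 0%N) by move=> /cU2[_ /(_ 0%N isT)[]].
have refl (f : R -> R) : {ae mu, forall x, f x = f x} by exact: ae_all.
split; first split.
- by move=> t It; exact: chain_in_sobolev (cU3 t It) (mU t It) (refl _).
- move=> t It.
  apply: (proj2 (cvg_sobolev_norm (F := fun s j x => U s j x - U t j x) (f := fun s => U s 0%N \- U t 0%N) _)); last exact: cU.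
  have NI : \forall s \near within I (nbhs t), I s by exact: near_withinI.
  move: NI; apply: filterS => s Is; split.
  + by apply: chainB; exact: cU3.
  + by apply: measurable_funB; exact: mU.
  + exact: refl.
exists (fun t => Ut t 0%N); split; last exact: U0.
- split; first by move=> t It; exact: chain_in_sobolev (cU2 t It) (mUt t It) (refl _).
  move=> t It.
  apply: (proj2 (cvg_sobolev_norm (F := fun s j x => Ut s j x - Ut t j x) (f := fun s => Ut s 0%N \- Ut t 0%N) _)); last first.
    by move=> j j2; apply: cvg_within_filter; exact: cUt.
  have NI : \forall s \near within I (nbhs t), I s by exact: near_withinI.
  move: NI; apply: filterS => s Is; split.
  + by apply: chainB; exact: cU2.
  + by apply: measurable_funB; exact: mUt.
  + exact: refl.
- move=> t It.
  apply: (proj2 (cvg_sobolev_norm (F := fun s j x => (s - t)^-1 * (U s j x - U t j x) - Ut t j x)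
    (f := fun s x => (U s 0%N x - U t 0%N x) / (s - t) - Ut t 0%N x) _)); last exact: dU.
  have NI : \forall s \near within I t^', I s by exact: near_withinI.
  move: NI; apply: filterS => s Is; split.
  + apply: chainB; last exact: cU2.
    have [p3 L3] := chainB (cU3 s Is) (cU3 t It).
    by apply: chainZ; split=> j jn; [apply: p3|apply: L3]; exact: leq_trans jn _.
  + apply: measurable_funB; last exact: mUt.
    by apply: measurable_funM => //; apply: measurable_funB; exact: mU.
  + by apply: ae_all => x; rewrite mulrC.
- move=> t It.
  have w j : (j <= 3)%N -> {ae mu, forall x, weak_derivative j (U t 0%N) x = U t j x}.
    by move=> j3; have [] := chain_weak_derivativeE (cU3 t It) (mU t It) (refl _) j3.
  have [_ w2] := chain_weak_derivativeE (cU2 t It) (mUt t It) (refl _) (isT : (2 <= 2)%N).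
  have h : {ae mu, forall x, [/\ weak_derivative 1 (U t 0%N) x = U t 1%N x,
      weak_derivative 3 (U t 0%N) x = U t 3%N x & weak_derivative 2 (Ut t 0%N) x = Ut t 2%N x]}.
    by apply: (ae_imp2 _ (w 1%N isT) (ae_imp2 (fun x a b => conj a b) (w 3%N isT) w2)) => x -> [-> ->].
  by apply: (ae_imp2 _ (eU t It) h) => x + [-> -> ->].
Qed.

Lemma cvg_within_subset (T : topologicalType) I J (F : set_system R) {FF : Filter F} (f : R -> T) (l : T) :
  J `<=` I -> f s @[s --> within I F] --> l -> f s @[s --> within J F] --> l.
Proof.
move=> JI h A /h; rewrite /nbhs/= /within/=; apply: filterS => x hI /JI; exact: hI.
Qed.

Lemma is_solution_subset I J (u0 : R -> R) u : J `<=` I -> is_solution I u0 u -> is_solution J u0 u.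
Proof.
move=> JI [[uI cu] [ut [[utI cut] dut eqn init]]]; split.
  split; first by move=> t /JI; exact: uI.
  by move=> t /JI It; apply: cvg_within_subset JI _; exact: cu.
exists ut; split=> //.
- split; first by move=> t /JI; exact: utI.
  by move=> t /JI It; apply: cvg_within_subset JI _; exact: cut.
- by move=> t /JI It; apply: cvg_within_subset JI _; exact: dut.
- by move=> t /JI; exact: eqn.
Qed.

Lemma primitive_bounded (F f : R -> R) : primitive_of F f -> L2 F -> L2 f ->
  exists K, forall x, `|F x| <= K.
Proof.
move=> pF LF Lf; exists (1 + (nsq F + nsq f)) => x; have h := sobolev_sup x pF LF Lf.
have h0 : 0 <= nsq F + nsq f by rewrite addr_ge0 ?nsq_ge0.
by apply: sqr_bounds; [rewrite addr_ge0|apply: le_trans h _; exact: le_sqr1D].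
Qed.

(** The difference of the two chains has zero Helmholtz image, so [elliptic_bound] annihilates
    it. *)
Lemma green_unique (G : nat -> R -> R) (h : R -> R) : sobolev_chain 2 G ->
  integrable_on setT h -> L2 h -> {ae mu, forall x, h x = G 0%N x - G 2%N x} ->
  {ae mu, forall x, green h x = G 0%N x}.
Proof.
move=> cG ih Lh hG; have cW := chainB cG (green_chain2 ih Lh).
have := elliptic_bound cW; set W := (fun j x => _) in cW *.
have L2W j : (j <= 2)%N -> L2 (W j) by case: cW => _; exact.
rewrite (@nsq_ae _ (fun x => W 0%N x - W 2%N x) (fun=> 0)) ?nsq0//; last 2 first.
- by apply: measurable_funB; [case: (L2W 0%N)|case: (L2W 2%N)].
- by apply: ae_imp hG => x e; rewrite /W /=; move: e; lra.
move=> W0; have : nsq (W 0%N) = 0.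
  apply/eqP; rewrite eq_le nsq_ge0 andbT; apply: le_trans W0.
  by rewrite lerDl nsq_ge0.
move=> /(nsq_eq0 (L2W 0%N isT)); apply: ae_imp => x; rewrite /W /= => e.
by apply/esym/eqP; rewrite -subr_eq0 e.
Qed.

End existence.

Unset Implicit Arguments.

Theorem theorem2p4 (R : realType) (u0 m0 : R -> R)
    (hu0 : in_sobolev 3 u0)
    (hm0 : {ae lebesgue_measure, forall x : R,
              m0 x = u0 x - weak_derivative 2 u0 x})
    (hm0_L1 : m0 \in Lfun (@lebesgue_measure R) 1%E)
    (hm0_H1 : in_sobolev 1 m0)
    (hm0_sign : (forall x, 0 <= m0 x) \/ (forall x, m0 x <= 0)) :
  exists u : R -> R -> R,
    is_solution `[0, +oo[ u0 u /\
    (forall (T : R) (v : R -> R -> R), 0 < T ->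
       is_solution `[0, T[ u0 v ->
       forall t, 0 <= t < T ->
         {ae lebesgue_measure, forall x : R, v t x = u t x}).
Proof.
(* The flow needs pointwise bounds and a primitive, so [m0] is replaced by its absolutely continuous
   representative. *)
have [F cF m0F] := in_sobolev_chain hm0_H1.
have pF : primitive_of (F 0%N) (F 1%N) by case: cF => /(_ 0%N isT).
have LF0 : L2 (F 0%N) by case: cF => _ /(_ 0%N isT).
have LF1 : L2 (F 1%N) by case: cF => _ /(_ 1%N isT).
have iF : integrable_on setT (F 0%N).
  apply: (@ae_integrable_on _ _ m0) => //; first by case: LF0.
    by apply: ae_imp m0F => x.
  by move: hm0_L1 => /Lfun1_integrable.
have [K hK] := primitive_bounded pF LF0 LF1.
have [U [Ut [cU cUt U0]]] := global_chain_solution hK pF LF0 LF1 iF.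
have sol : is_solution `[0, +oo[ u0 (fun t => U t 0%N).
  apply: chain_solution_solution cU cUt _; rewrite U0.
  (* Initial value: [u0] and [green (F 0%N)] have almost everywhere the same Helmholtz image, hence
     they agree by [green_unique]. *)
  have [G cG u0G] := in_sobolev_chain hu0.
  have mu0 : measurable_fun setT u0 by case: hu0 => /LfunP2[].
  have [_ w2] := chain_weak_derivativeE cG mu0 u0G (isT : (2 <= 3)%N).
  apply: ae_trans (ae_sym u0G); apply: green_unique => //.
    by case: cG => pG LG; split=> j j2; [apply: pG|apply: LG]; exact: leq_trans j2 _.
  apply: ae_trans (ae_sym m0F) _; apply: ae_trans hm0 _.
  by apply: ae_imp2 u0G w2 => x -> ->.
exists (fun t => U t 0%N); split => // T v T0 sv.
apply: solution_unique sv; apply: is_solution_subset sol.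
by move=> t; rewrite /= !in_itv/= => /andP[-> _].
Qed.
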